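(* Let $(\pi,A)$ be a vincular pattern, with $\pi$ of size $k$, and let $m=k-|A|$. There exist two polynomial functions $f$ and $g$ (depending only on $(\pi,A)$) such that the following holds. Let $(\lambda^n)_{n\ge 1}$ be any sequence where $\lambda^n$ is an integer partition of $n$, and suppose that $\frac{m_1(\lambda^n)}{n}\to p_1$ and $\frac{m_2(\lambda^n)}{n}\to p_2$ as $n\to\infty$. Then $$\frac{X^{(\pi,A)}(\sigma_{\lambda^n})-\mathbb{E}\big(X^{(\pi,A)}(\sigma_{\lambda^n})\big)}{n^{m-\frac12}}\ \xrightarrow[n\to\infty]{d}\ \mathcal{N}\big(0,\,f(p_1)+p_2\,g(p_1)\big),$$ and moreover all moments of the left-hand side converge to the corresponding moments of the limiting distribution.
   Context: Write $[n]=\{1,\dots,n\}$, let $S_n$ be the symmetric group on $[n]$, and write permutations in one-line notation $\sigma=\sigma_1\cdots\sigma_n$. A vincular pattern is a pair $(\pi,A)$ where $\pi$ is a permutation of size $k$ and $A\subseteq[k-1]$. An occurrence of $(\pi,A)$ in a permutation $\sigma$ of size $n$ is a tuple $(i_1,\dots,i_k)$ of elements of $[n]$ with $i_1<\cdots<i_k$ such that (i) $\sigma_{i_{\pi^{-1}_1}}<\cdots<\sigma_{i_{\pi^{-1}_k}}$ (that is, $(\sigma_{i_1},\dots,\sigma_{i_k})$ is in the same relative order as $(\pi_1,\dots,\pi_k)$), and (ii) $i_{s+1}=i_s+1$ for all $s\in A$. $X^{(\pi,A)}(\sigma)$ denotes the number of occurrences of $(\pi,A)$ in $\sigma$. For an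 integer partition $\lambda$ of $n$, $\mathcal{C}_\lambda\subset S_n$ is the conjugacy class of permutations of cycle type $\lambda$, $\sigma_\lambda$ is a uniform random element of $\mathcal{C}_\lambda$, and $m_i(\lambda)$ is the number of parts of $\lambda$ equal to $i$. $\mathcal{N}(0,v)$ is the centered Gaussian law of variance $v\ge 0$, with $\mathcal{N}(0,0)$ the Dirac mass at $0$; $\xrightarrow{d}$ denotes convergence in distribution. *)

(* Defs.v *)
From HB Require Import structures.
From mathcomp Require Import all_boot all_order all_algebra fingroup perm.
From mathcomp Require Import all_classical all_reals all_analysis.

Set Implicit Arguments.
Unset Strict Implicit.
Unset Printing Implicit Defensive.

Import Order.TTheory GRing.Theory Num.Theory.
Import numFieldNormedType.Exports.

Local Open Scope classical_set_scope.
Local Open Scope ring_scope.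

Definition is_partition (n : nat) (lam : seq nat) : bool :=
  [&& sorted geq lam, all (leq 1) lam & sumn lam == n].

(* Fixed points are singleton blocks of [porbits s], hence parts equal to 1. *)
Definition cycle_type (n : nat) (s : 'S_n) : seq nat :=
  sort geq [seq #|c| | c : {set 'I_n} <- enum (porbits s)].

Definition cycle_class (n : nat) (lam : seq nat) : {set 'S_n} :=
  [set s : 'S_n | cycle_type s == lam]%SET.

(* Indices are 0-based: the element [a : 'I_k.-1] of [A] stands for [a + 1] in
   [{1, ..., k - 1}] and forces the entries at the 0-based indices [a] and
   [a + 1] of the occurrence to be adjacent. *)
Definition is_occurrence (k n : nat) (tau : 'S_k) (A : {set 'I_k.-1})
    (s : 'S_n) (i : {ffun 'I_k -> 'I_n}) : bool :=
  [&& [forall a : 'I_k, forall b : 'I_k, (a < b)%N ==> (i a < i b)%N],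
      [forall a : 'I_k, forall b : 'I_k, (a < b)%N ==>
         (s (i ((tau^-1)%g a)) < s (i ((tau^-1)%g b)))%N] &
      [forall a in A, forall b : 'I_k, forall c : 'I_k,
         ((b == a :> nat) && (c == a.+1 :> nat)) ==> (i c == (i b).+1 :> nat)]].

Definition num_occurrences (k n : nat) (tau : 'S_k) (A : {set 'I_k.-1})
    (s : 'S_n) : nat :=
  #|[set i : {ffun 'I_k -> 'I_n} | is_occurrence tau A s i]%SET|.

HB.instance Definition _ (T : finType) := isPointed.Build (perm_type T) 1%g.
HB.instance Definition _ (T : finType) :=
  @isMeasurable.Build default_measure_display (perm_type T) discrete_measurable
    discrete_measurable0 discrete_measurableC discrete_measurableU.

Lemma measurable_perm (n : nat) (U : set 'S_n) : measurable U.
Proof. by []. Qed.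

(* The Dirac mass is the default value of [mnormalize] for an empty class; the
   class is never empty when [lam] is a partition of [n]. *)
Definition uniform_class (R : realType) (n : nat) (lam : seq nat) :
    probability 'S_n R :=
  mnormalize (mrestr (@counting 'S_n R)
                     (measurable_perm [set` cycle_class n lam]))
             (\d_(1%g : 'S_n)).

Definition normalized_occurrences (R : realType) (k n : nat) (tau : 'S_k)
    (A : {set 'I_k.-1}) (lam : seq nat) (s : 'S_n) : R :=
  let X := fun s' : 'S_n => (num_occurrences tau A s')%:R : R in
  let m := (k - #|A|)%N in
  (X s - fine 'E_(uniform_class R n lam)[X]) / n%:R `^ (m%:R - 2^-1).

Lemma measurable_normalized_occurrences (R : realType) (k n : nat) (tau : 'S_k)
    (A : {set 'I_k.-1}) (lam : seq nat) :
  measurable_fun [set: 'S_n] (@normalized_occurrences R k n tau A lam).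
Proof. by []. Qed.

HB.instance Definition _ (R : realType) (k n : nat) (tau : 'S_k)
    (A : {set 'I_k.-1}) (lam : seq nat) :=
  isMeasurableFun.Build _ _ 'S_n R (@normalized_occurrences R k n tau A lam)
    (@measurable_normalized_occurrences R k n tau A lam).

Arguments normalized_occurrences R {k} n tau A lam s.

(* [normal_prob] takes the standard deviation and is not a Dirac mass at
   standard deviation 0. *)
Definition gaussian (R : realType) (v : R) : probability (measurableTypeR R) R :=
  if v == 0 then (\d_(0 : measurableTypeR R) : probability (measurableTypeR R) R)
  else (normal_prob 0 (Num.sqrt v) : probability (measurableTypeR R) R).

(* Each [X n] may live on its own probability space. *)
Definition cvg_in_distribution (R : realType) (d : nat -> measure_display)
    (T : forall n, measurableType (d n)) (P : forall n, probability (T n) R)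
    (X : forall n, {RV (P n) >-> R}) (mu : probability (measurableTypeR R) R) : Prop :=
  forall h : R -> R, continuous h -> bounded_fun h ->
    ('E_(P n)[h \o X n])%E @[n --> \oo] --> (\int[mu]_x (h x)%:E)%E.

(* Main.v *)
Require Import Defs.
From HB Require Import structures.
From mathcomp Require Import all_boot all_order all_algebra fingroup perm.
From mathcomp Require Import ring lra zify.

Set Implicit Arguments.
Unset Strict Implicit.
Unset Printing Implicit Defensive.

Import Order.TTheory GRing.Theory Num.Theory.

Local Open Scope ring_scope.

(* If [s0] has cycle type [lam], the uniform element of its class has the law of
   [s0 ^ t] for a uniform permutation [t], and the number of occurrences is a sum
   over tuples [a] of indicators that only depend on the values of [t] on [a] and
   [s0 a].  Let [Z] be this sum, centered and divided by [n ^ (m - 1/2)].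
   Resampling [t] on the support of one indicator gives
     E (Z h(Z)) = \sum_j q_j E (h (Z o M_j) - h Z)
   with nonnegative weights of total mass O(sqrt n) and steps of size
   O(1 / sqrt n).  A second-order Taylor expansion, and a bound on the fluctuations
   of \sum_j q_j (Z o M_j - Z), yield
     E Z^(r+2) = (r+1) E Z^2 E Z^r + O(1 / sqrt n),
   uniformly in [s0]: this is the recursion of Gaussian moments.

   The first two moments of the count are sums over tuples of labels of a weight
   that only depends on the coincidences between the labels and their images under
   [s0]; up to a relative error O(1 / n^2) only one coincidence matters, and the
   number of such tuples is a polynomial in the numbers of fixed points and of
   points in 2-cycles, of degree one in the latter.  The leading terms of E X^2
   and (E X)^2 cancel because Var Z is bounded, so that
     E Z^2 = f(m1/n) + (m2/n) g(m1/n) + O(1/n).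

   Convergence of moments implies convergence in distribution because Taylor's
   formula for [cos] gives the convergence of trigonometric polynomials, among
   which one finds the Bernstein polynomials in [sin (c x) / c], close to any
   prescribed bounded continuous function up to a small polynomial error. *)

(** * Averages over finite types *)

(** The fluctuation bound is where the geometry of patterns enters. The conditional mean of the
    increments given [t] moves by O(1/n), once normalized, when [t] is multiplied by a
    transposition: every modification alters the conjugate at boundedly many points, two
    modifications far apart interact only through tuples meeting both, and two points at distance at
    least [k] cannot lie in one block of adjacent positions. Variance O(1/n) follows.

    Adjacencies make the weight of a label tuple depend on [n], but only through a falling
    factorial: inserting a fresh value into a permutation breaks each adjacency in exactly one way.

    Two orders in 1/n must be kept, since the leading one cancels in the variance. The cancellation
    is an identity of polynomials, obtained from the values 1/2, 1/3, ... of the ratio of fixed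
    points, each reached by arbitrarily large permutations.

    Test functions are built from sines because convergence of moments controls one cosine at a
    time, and products of cosines are sums of cosines; a polynomial approximation would not be
    bounded on the line. *)

HB.lock Definition mean (R : realFieldType) (T : finType) (f : T -> R) : R :=
  (\sum_x f x) / #|T|%:R.

Section Mean.
Variables (R : realFieldType) (T : finType).
Implicit Types f g : T -> R.

Lemma eq_mean f g : f =1 g -> mean f = mean g.
Proof. by move=> fg; rewrite mean.unlock; congr (_ / _); apply: eq_bigr => x _. Qed.

Lemma meanD f g : mean (fun x => f x + g x) = mean f + mean g.
Proof. by rewrite mean.unlock big_split mulrDl. Qed.

Lemma meanB f g : mean (fun x => f x - g x) = mean f - mean g.
Proof. by rewrite mean.unlock sumrB mulrBl. Qed.

Lemma meanZ a f : mean (fun x => a * f x) = a * mean f.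
Proof. by rewrite mean.unlock -mulr_sumr mulrA. Qed.

Lemma mean_sum (I : finType) (F : I -> T -> R) :
  mean (fun x => \sum_i F i x) = \sum_i mean (F i).
Proof. by rewrite mean.unlock exchange_big mulr_suml. Qed.

Lemma mean_cst (a : R) : (0 < #|T|)%N -> mean (fun _ : T => a) = a.
Proof.
move=> T0; rewrite mean.unlock; have -> : \sum_(x : T) a = a * #|T|%:R.
  by rewrite sumr_const mulr_natr.
by rewrite mulfK // pnatr_eq0 -lt0n.
Qed.

Lemma ler_mean f g : (forall x, f x <= g x) -> mean f <= mean g.
Proof.
by move=> fg; rewrite mean.unlock; apply: ler_wpM2r; rewrite ?invr_ge0 ?ler0n //; apply: ler_sum.
Qed.

Lemma mean_ge0 f : (forall x, 0 <= f x) -> 0 <= mean f.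
Proof. by move=> f0; rewrite mean.unlock divr_ge0 ?ler0n ?sumr_ge0. Qed.

Lemma ler_norm_mean f : `|mean f| <= mean (fun x => `|f x|).
Proof.
rewrite mean.unlock normrM [Num.norm (_^-1)]ger0_norm ?invr_ge0 ?ler0n //.
by rewrite ler_wpM2r ?invr_ge0 ?ler0n // ler_norm_sum.
Qed.

Lemma mean_reindex (h : T -> T) f : injective h -> mean (f \o h) = mean f.
Proof.
by move=> hi; rewrite mean.unlock; congr (_ / _); rewrite [RHS](reindex_inj hi).
Qed.

(** Cauchy-Schwarz: the quadratic form in [key] is nonnegative, and well-chosen [u], [v] replace its
    discriminant. *)
Lemma mean_mul_sqr f g : mean (fun x => f x * g x) ^+ 2 <=
  mean (fun x => f x ^+ 2) * mean (fun x => g x ^+ 2).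
Proof.
set a := mean (fun x => f x ^+ 2); set b := mean (fun x => g x ^+ 2).
set m := mean _.
have a0 : 0 <= a by apply: mean_ge0 => x; exact: sqr_ge0.
have b0 : 0 <= b by apply: mean_ge0 => x; exact: sqr_ge0.
have key u v : 0 <= u ^+ 2 * a + v ^+ 2 * b - (2 * u * v) * m.
  rewrite /a /b /m -!meanZ -meanD -meanB; apply: mean_ge0 => x.
  by have := sqr_ge0 (u * f x - v * g x); lra.
have [b_eq|bn0] := eqVneq b 0.
  (* For [b = 0] this choice turns the form into [- (a + 2) * m ^+ 2], which forces [m = 0]. *)
  have := key m (a + 1); have := mulr_ge0 (sqr_ge0 m) a0; have := sqr_ge0 m.
  by rewrite b_eq; lra.
have bp : 0 < b by rewrite lt_def bn0.
have := key b m => h.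
have : 0 <= b * (a * b - m ^+ 2) by lra.
by rewrite pmulr_rge0 // subr_ge0.
Qed.

End Mean.

Lemma mean_mul_le (R : realFieldType) (T : finType) (f g : T -> R) a b :
  0 <= a -> 0 <= b ->
  mean (fun x => f x ^+ 2) <= a ^+ 2 -> mean (fun x => g x ^+ 2) <= b ^+ 2 ->
  `|mean (fun x => f x * g x)| <= a * b.
Proof.
move=> a0 b0 fa gb; rewrite -(@ler_pXn2r _ 2) ?nnegrE ?mulr_ge0 //.
rewrite real_normK ?num_real // (le_trans (mean_mul_sqr f g)) // exprMn.
by apply: ler_pM => //; apply: mean_ge0 => x; exact: sqr_ge0.
Qed.

(** * Moments from a Stein identity *)

Section PowerIncrements.
Variable R : realFieldType.

(** The bound involves [a] only, so that increments of powers of [Z] are controlled by moments of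
    [Z] itself and not of [Z] after a move. The hypothesis [e <= 1] gives
    [|b| <= (1 + c) * (1 + |a|)]. *)
Lemma exprS_increment (c : R) r : 0 <= c -> exists2 K, 0 <= K &
  forall a b e : R, 0 <= e -> e <= 1 -> `|b - a| <= c * e ->
    `|b ^+ r.+1 - a ^+ r.+1| <= K * e * (1 + `|a|) ^+ r.
Proof.
move=> c0; elim: r => [|r [K K0 IH]].
  by exists c => // a b e e0 e1 ab; rewrite !expr1 expr0 mulr1.
exists ((1 + c) * K + c) => [|a b e e0 e1 ab].
  by rewrite addr_ge0 // mulr_ge0 // addr_ge0.
have -> : b ^+ r.+2 - a ^+ r.+2 =
  b * (b ^+ r.+1 - a ^+ r.+1) + (b - a) * a ^+ r.+1 by rewrite !exprS; ring.
have ce : c * e <= c by rewrite ler_piMr.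
have bb : `|b| <= (1 + c) * (1 + `|a|).
  have -> : b = a + (b - a) by ring.
  rewrite (le_trans (ler_normD _ _)) //.
  have := mulr_ge0 c0 (normr_ge0 a); lra.
rewrite (le_trans (ler_normD _ _)) // !normrM normrX.
have h1 : `|b| * `|b ^+ r.+1 - a ^+ r.+1| <=
    (1 + c) * (1 + `|a|) * (K * e * (1 + `|a|) ^+ r).
  by apply: ler_pM => //; exact: IH.
have h2 : `|b - a| * `|a| ^+ r.+1 <= c * e * (1 + `|a|) ^+ r.+1.
  apply: ler_pM => //; rewrite ?exprn_ge0 //.
  by apply: lerXn2r; rewrite ?nnegrE ?addr_ge0 ?lerDr.
apply: le_trans (lerD h1 h2) _; rewrite exprS.
by rewrite le_eqVlt; apply/orP; left; apply/eqP; ring.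
Qed.

Lemma exprS_taylor1 (c : R) r : 0 <= c -> exists2 K, 0 <= K &
  forall a b e : R, 0 <= e -> e <= 1 -> `|b - a| <= c * e ->
    `|b ^+ r.+1 - a ^+ r.+1 - r.+1%:R * a ^+ r * (b - a)|
      <= K * e ^+ 2 * (1 + `|a|) ^+ r.
Proof.
move=> c0; elim: r => [|r [K K0 IH]].
  exists 0 => // a b e _ _ _.
  by rewrite !expr1 !expr0 !mul1r mul0r subrr normr0 mul0r.
exists ((1 + c) * K + r.+1%:R * c ^+ 2) => [|a b e e0 e1 ab].
  by rewrite addr_ge0 // mulr_ge0 // ?addr_ge0 ?sqr_ge0 ?ler0n.
(* Splitting off one factor [b] leaves the previous remainder and a term already quadratic in
   [b - a]. *)
have -> : b ^+ r.+2 - a ^+ r.+2 - r.+2%:R * a ^+ r.+1 * (b - a) =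
  b * (b ^+ r.+1 - a ^+ r.+1 - r.+1%:R * a ^+ r * (b - a))
  + r.+1%:R * a ^+ r * (b - a) ^+ 2.
  have -> : r.+2%:R = r.+1%:R + 1 :> R by rewrite natr1.
  by rewrite !exprS; ring.
have ce : c * e <= c by rewrite ler_piMr.
have bb : `|b| <= (1 + c) * (1 + `|a|).
  have -> : b = a + (b - a) by ring.
  rewrite (le_trans (ler_normD _ _)) //.
  have := mulr_ge0 c0 (normr_ge0 a); lra.
rewrite (le_trans (ler_normD _ _)) // !normrM !normrX normr_nat.
have a1 : 0 <= 1 + `|a| by rewrite addr_ge0.
have h1 : `|b| * `|b ^+ r.+1 - a ^+ r.+1 - r.+1%:R * a ^+ r * (b - a)| <=
    (1 + c) * (1 + `|a|) * (K * e ^+ 2 * (1 + `|a|) ^+ r).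
  by apply: ler_pM => //; exact: IH.
have h2 : r.+1%:R * `|a| ^+ r * `|b - a| ^+ 2 <=
    r.+1%:R * (1 + `|a|) ^+ r.+1 * (c * e) ^+ 2.
  apply: ler_pM; rewrite ?mulr_ge0 ?exprn_ge0 ?ler0n //.
    rewrite ler_wpM2l ?ler0n // (@le_trans _ _ ((1 + `|a|) ^+ r)) //.
      by apply: lerXn2r; rewrite ?nnegrE ?lerDr.
    by rewrite exprS ler_peMl ?exprn_ge0 ?lerDl.
  by apply: lerXn2r; rewrite ?nnegrE ?mulr_ge0.
apply: le_trans (lerD h1 h2) _; rewrite !exprS expr0.
by rewrite le_eqVlt; apply/orP; left; apply/eqP; ring.
Qed.

Lemma exprD1_le (x : R) r : 0 <= x -> (1 + x) ^+ r <= 2 ^+ r * (1 + x ^+ r).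
Proof.
move=> x0; have [x1|x1] := lerP x 1.
  rewrite -[leLHS]mulr1 ler_pM ?exprn_ge0 ?ler01 ?addr_ge0 //.
    by rewrite lerXn2r ?nnegrE ?addr_ge0 //; lra.
  by rewrite lerDl exprn_ge0.
apply: (@le_trans _ _ (2 ^+ r * x ^+ r)).
  by rewrite -exprMn lerXn2r ?nnegrE ?addr_ge0 ?mulr_ge0 //; lra.
by rewrite ler_wpM2l ?exprn_ge0 // lerDr.
Qed.

End PowerIncrements.

(* In the application [e] is [n ^ (-1/2)]. *)
Record stein_family (R : realFieldType) (c e : R) (T J : finType) (Z : T -> R)
    (q : J -> R) (M : J -> T -> T) : Prop := SteinFamily {
  stein_card : (0 < #|T|)%N;
  stein_e0 : 0 < e;
  stein_e1 : e <= 1;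
  stein_q0 : forall j, 0 <= q j;
  stein_mass : e * \sum_j q j <= c;
  stein_step : forall j t, `|Z (M j t) - Z t| <= c * e;
  stein_id : forall h : R -> R, mean (fun t => Z t * h (Z t)) =
    \sum_j q j * mean (fun t => h (Z (M j t)) - h (Z t)) }.

Section Stein.
Variables (R : realFieldType) (c : R).
Hypothesis c0 : 0 <= c.

(** With [h x = x ^+ p.*2.+1] the identity produces increments of order [e], and the total weight of
    order [1 / e] cancels that factor: the bound passes from [p] to [p.+1]. *)
Lemma stein_even_moment p : exists2 C, 0 <= C &
  forall e (T J : finType) (Z : T -> R) (q : J -> R) (M : J -> T -> T),
  stein_family c e Z q M -> mean (fun t => Z t ^+ p.*2) <= C.
Proof.
elim: p => [|p [C C0 IH]].
  exists 1 => // e T J Z q M ZM.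
  under eq_mean do rewrite double0 expr0.
  by rewrite mean_cst ?(stein_card ZM).
have [K K0 HK] := exprS_increment p.*2 c0.
exists (c * (K * (2 ^+ p.*2 * (1 + C)))).
  by rewrite !mulr_ge0 ?exprn_ge0 ?addr_ge0.
move=> e T J Z q M ZM.
have e0 := ltW (stein_e0 ZM).
under eq_mean do rewrite doubleS exprS.
rewrite (stein_id ZM (fun x => x ^+ p.*2.+1)).
have step j : mean (fun t => Z (M j t) ^+ p.*2.+1 - Z t ^+ p.*2.+1) <=
    e * (K * (2 ^+ p.*2 * (1 + C))).
  apply: (@le_trans _ _ (mean (fun t => e * (K * (2 ^+ p.*2 * (1 + Z t ^+ p.*2)))))).
    apply: ler_mean => t; apply: le_trans (ler_norm _) _.
    apply: le_trans (HK _ _ e e0 (stein_e1 ZM) (stein_step ZM j t)) _.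
    rewrite mulrCA -mulrA ler_wpM2l // ler_wpM2l //.
    apply: le_trans (exprD1_le _ (normr_ge0 _)) _.
    by rewrite -normrX ger0_norm // exprn_even_ge0 ?odd_double.
  rewrite !meanZ meanD mean_cst ?(stein_card ZM) //.
  by rewrite !ler_wpM2l ?exprn_ge0 // lerD2l (IH _ _ _ _ _ _ ZM).
apply: (@le_trans _ _ (\sum_j q j * (e * (K * (2 ^+ p.*2 * (1 + C)))))).
  by apply: ler_sum => j _; rewrite ler_wpM2l ?(stein_q0 ZM).
rewrite -mulr_suml mulrA [_ * e]mulrC ler_wpM2r ?(stein_mass ZM) //.
by rewrite !mulr_ge0 ?exprn_ge0 ?addr_ge0.
Qed.

Lemma stein_moment_bound r : exists2 C, 0 <= C &
  forall e (T J : finType) (Z : T -> R) (q : J -> R) (M : J -> T -> T),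
  stein_family c e Z q M -> mean (fun t => (1 + `|Z t|) ^+ r) <= C.
Proof.
have [C C0 HC] := stein_even_moment r.
exists (2 ^+ r.*2 * (1 + C)); first by rewrite mulr_ge0 ?exprn_ge0 ?addr_ge0.
move=> e T J Z q M ZM.
apply: (@le_trans _ _ (mean (fun t => 2 ^+ r.*2 * (1 + Z t ^+ r.*2)))).
  apply: ler_mean => t; apply: (@le_trans _ _ ((1 + `|Z t|) ^+ r.*2)).
    by rewrite ler_weXn2l ?lerDl // -addnn leq_addr.
  apply: le_trans (exprD1_le _ (normr_ge0 _)) _.
  by rewrite -normrX ger0_norm // exprn_even_ge0 ?odd_double.
rewrite meanZ meanD mean_cst ?(stein_card ZM) //.
by rewrite ler_wpM2l ?exprn_ge0 // lerD2l (HC _ _ _ _ _ _ ZM).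
Qed.

Lemma stein_moment_recursion r : exists C,
  forall e (T J : finType) (Z : T -> R) (q : J -> R) (M : J -> T -> T),
  stein_family c e Z q M ->
  let U t := \sum_j q j * (Z (M j t) - Z t) in
  mean (fun t => (U t - mean U) ^+ 2) <= (c * e) ^+ 2 ->
  `|mean (fun t => Z t ^+ r.+2)
    - r.+1%:R * mean (fun t => Z t ^+ 2) * mean (fun t => Z t ^+ r)| <= C * e.
Proof.
have [K K0 HK] := exprS_taylor1 r c0.
have [C C0 HC] := stein_moment_bound r.
have [D D0 HD] := stein_even_moment r.
exists (c * (K * C) + r.+1%:R * ((1 + D) * c)).
move=> e T J Z q M ZM U HU; have e0 := ltW (stein_e0 ZM).
have Z2 : mean (fun t => Z t ^+ 2) = mean U.
  under eq_mean do rewrite expr2.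
  rewrite (stein_id ZM id) mean_sum; apply: eq_bigr => j _.
  by rewrite -meanZ.
pose rem j t := Z (M j t) ^+ r.+1 - Z t ^+ r.+1
                - r.+1%:R * Z t ^+ r * (Z (M j t) - Z t).
(* The Taylor remainders add up to order [e ^+ 2 / e]. The linear term yields the Gaussian recursion
   once the drift [U] is replaced by its mean, which is the second moment by [Z2]; the price is a
   covariance of [Z ^+ r] with [U]. *)
have decomp : mean (fun t => Z t ^+ r.+2)
    - r.+1%:R * mean (fun t => Z t ^+ 2) * mean (fun t => Z t ^+ r) =
    \sum_j q j * mean (rem j)
    + r.+1%:R * mean (fun t => Z t ^+ r * (U t - mean U)).
  have -> : mean (fun t => Z t ^+ r * (U t - mean U)) =
      mean (fun t => Z t ^+ r * U t) - mean U * mean (fun t => Z t ^+ r).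
    by rewrite -meanZ -meanB; apply: eq_mean => t; ring.
  have -> : r.+1%:R * (mean (fun t => Z t ^+ r * U t)
      - mean U * mean (fun t => Z t ^+ r)) =
      \sum_j q j * mean (fun t => r.+1%:R * Z t ^+ r * (Z (M j t) - Z t))
      - r.+1%:R * mean U * mean (fun t => Z t ^+ r).
    rewrite mulrBr; congr (_ - _); last by rewrite [LHS]mulrA.
    under [RHS]eq_bigr do rewrite -meanZ.
    rewrite -meanZ -mean_sum; apply: eq_mean => t.
    by rewrite /U !mulr_sumr; apply: eq_bigr => j _; ring.
  rewrite Z2 addrA; congr (_ - _); rewrite -big_split /=.
  rewrite (eq_mean (fun t => exprS (Z t) r.+1)) (stein_id ZM (fun x => x ^+ r.+1)).
  apply: eq_bigr => j _; rewrite -mulrDr -meanD; congr (_ * _).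
  by apply: eq_mean => t; rewrite /rem; ring.
rewrite decomp (le_trans (ler_normD _ _)) // mulrDl lerD //.
  apply: (@le_trans _ _ (\sum_j q j * (e ^+ 2 * (K * C)))).
    apply: le_trans (ler_norm_sum _ _ _) _; apply: ler_sum => j _.
    rewrite normrM ger0_norm ?(stein_q0 ZM) // ler_wpM2l ?(stein_q0 ZM) //.
    apply: le_trans (ler_norm_mean _) _.
    apply: (@le_trans _ _ (mean (fun t => e ^+ 2 * (K * (1 + `|Z t|) ^+ r)))).
      apply: ler_mean => t; rewrite mulrCA mulrA.
      exact: HK _ _ e e0 (stein_e1 ZM) (stein_step ZM j t).
    by rewrite !meanZ !ler_wpM2l ?exprn_ge0 // (HC _ _ _ _ _ _ ZM).
  rewrite -mulr_suml expr2 -mulrA mulrA [_ * e]mulrC.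
  rewrite [e * (K * C)]mulrC mulrA ler_wpM2r // ler_wpM2r ?mulr_ge0 //.
  exact: stein_mass ZM.
rewrite normrM normr_nat -[leRHS]mulrA ler_wpM2l ?ler0n // -mulrA.
apply: mean_mul_le; rewrite ?addr_ge0 ?mulr_ge0 //.
(* [(1 + D) ^+ 2] dominates [D]; this replaces a square root, which a real field need not
   contain. *)
apply: le_trans (_ : D <= _); last by nra.
under eq_mean do rewrite -exprM muln2.
exact: HD ZM.
Qed.

End Stein.

(** * Random permutations: variance bound and resampling *)

Section LiftPerm.
Variables (n : nat) (i : 'I_n.+1).

Lemma lift_perm_pair_bij :
  bijective (fun p : 'I_n.+1 * 'S_n => lift_perm i p.1 p.2).
Proof.
apply: inj_card_bij; last first.
  by rewrite card_prod card_ord !card_Sn factS.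
move=> [j s] [j' s'] /= ss.
have jj : j = j' by rewrite -(lift_perm_id i j s) ss lift_perm_id.
rewrite -jj in ss *; congr pair; apply/permP => k; apply: (@lift_inj _ j).
by rewrite -(lift_perm_lift i) ss lift_perm_lift.
Qed.

Lemma lift_perm_exists (t : 'S_n.+1) : exists s, t = lift_perm i (t i) s.
Proof.
have [g _ gK] := lift_perm_pair_bij; have := gK t.
by case: (g t) => j s /= <-; exists s; rewrite lift_perm_id.
Qed.

Lemma mean_lift_perm (R : realFieldType) (F : 'S_n.+1 -> R) :
  mean F = mean (fun j => mean (fun s => F (lift_perm i j s))).
Proof.
rewrite mean.unlock (reindex _ (onW_bij _ lift_perm_pair_bij)) /=.
rewrite -(pair_bigA _ (fun j s => F (lift_perm i j s))) /= -mulr_suml.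
by rewrite -mulrA -invfM -natrM card_ord !card_Sn factS mulnC.
Qed.

Lemma lift_tperm (u v : 'I_n) :
  lift_perm i i (tperm u v) = tperm (lift i u) (lift i v).
Proof.
apply/permP => x; case: (unliftP i x) => [y|] ->.
  by rewrite lift_perm_lift -(inj_tperm _ _ _ (@lift_inj _ i)).
by rewrite lift_perm_id tpermD // eq_sym neq_lift.
Qed.

End LiftPerm.

Lemma mean_sqr_center (R : realFieldType) (T : finType) (f : T -> R) (a : R) :
  (0 < #|T|)%N ->
  mean (fun x => (f x - a) ^+ 2) =
  mean (fun x => (f x - mean f) ^+ 2) + (mean f - a) ^+ 2.
Proof.
move=> T0; set m := mean f.
have -> : mean (fun x => (f x - a) ^+ 2) = mean (fun x =>
    (f x - m) ^+ 2 + (2 * (m - a) * f x + (a ^+ 2 - m ^+ 2))).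
  by apply: eq_mean => x; ring.
by rewrite meanD; congr (_ + _); rewrite meanD meanZ mean_cst // -/m; ring.
Qed.

(* Martingale argument: reveal the image of one point at a time. *)
Lemma perm_variance_le (R : realFieldType) (n : nat) (T : 'S_n -> R) (c : R) :
  (forall u v t, `|T (tperm u v * t)%g - T t| <= c) ->
  mean (fun t => (T t - mean T) ^+ 2) <= n%:R * c ^+ 2.
Proof.
elim: n T => [|n IH] T Tc.
  have T1 t : T t = T 1%g by congr T; apply/permP; case.
  have S0 : (0 < #|{: 'S_0}|)%N by rewrite card_Sn.
  rewrite mul0r (eq_mean (g := fun=> 0)) ?mean_cst // => t.
  by rewrite (eq_mean T1) mean_cst // T1 subrr expr0n.
have Sn0 : (0 < #|{: 'S_n}|)%N by rewrite card_Sn fact_gt0.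
pose i : 'I_n.+1 := ord0.
pose m j := mean (fun s => T (lift_perm i j s)).
(* The laws conditioned on [i] being sent to [j] and to [j'] are coupled by the transposition of
   these two values; conjugation turns it into a transposition acting on the left, where [Tc]
   applies. *)
have mm j j' : `|m j - m j'| <= c.
  have [p] := lift_perm_exists j (tperm j j'); rewrite tpermL => Ep.
  have -> : m j' = mean (fun s => T (lift_perm i j' (s * p)%g)).
    exact/esym/(mean_reindex (fun s => T (lift_perm i j' s)) (mulIg p)).
  rewrite -meanB; apply: le_trans (ler_norm_mean _) _.
  rewrite -[leRHS](mean_cst c Sn0); apply: ler_mean => s.
  by rewrite -(lift_permM i j) -Ep conjgCV tpermJ distrC.
have mT j : `|m j - mean T| <= c.
  have n0 : (0 < #|'I_n.+1|)%N by rewrite card_ord.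
  rewrite (mean_lift_perm i) -[X in `|X - _|](mean_cst _ n0) -meanB.
  apply: le_trans (ler_norm_mean _) _; rewrite -[leRHS](mean_cst c n0).
  by apply: ler_mean => x; exact: mm.
rewrite (mean_lift_perm i) -[leRHS](mean_cst (T := 'I_n.+1)) ?card_ord //.
(* Given the image [j] of [i], the deviation splits into a conditional variance, bounded by
   induction, and the squared deviation of the conditional mean, bounded by [mT]. *)
apply: ler_mean => j; rewrite mean_sqr_center //.
rewrite -natr1 mulrDl mul1r lerD //.
  apply: IH => u v s.
  have -> : lift_perm i j (tperm u v * s)%g =
      (lift_perm i i (tperm u v) * lift_perm i j s)%g by rewrite lift_permM.
  by rewrite lift_tperm.
have c0 : 0 <= c := le_trans (normr_ge0 _) (Tc ord0 ord0 1%g).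
by rewrite -[leLHS]real_normK ?num_real // lerXn2r ?nnegrE // mT.
Qed.

(* Modifies [t] by transpositions so as to agree with [t'] on [bs]. *)
Fixpoint resample n (bs : seq 'I_n) (t t' : 'S_n) : 'S_n :=
  if bs is b :: bs' then resample bs' (t * tperm (t b) (t' b))%g t' else t.

Section Resample.
Variable n : nat.
Implicit Types (bs : seq 'I_n) (t r : 'S_n).

Lemma resample_id bs t t' b : t b = t' b -> resample bs t t' b = t' b.
Proof.
elim: bs t => //= a bs IH t tb; apply: IH; rewrite permM.
have [->|ab] := eqVneq a b; first by rewrite tpermL.
rewrite tb tpermD //; last by rewrite (inj_eq perm_inj).
by rewrite -tb (inj_eq perm_inj).
Qed.

Lemma resample_agree bs t t' b : b \in bs -> resample bs t t' b = t' b.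
Proof.
elim: bs t => //= a bs IH t; rewrite inE => /orP[/eqP <-|]; last exact: IH.
by apply: resample_id; rewrite permM tpermL.
Qed.

(** The transpositions act on values, and multiplying both arguments by [t] on the right renames
    these values; what remains is the modification that makes [r] agree with the identity on
    [bs]. *)
Lemma resample_mulr bs r t : resample bs (r * t)%g t = (resample bs r 1 * t)%g.
Proof.
elim: bs r => //= a bs IH r.
by rewrite -IH perm1 permM -tpermJ -mulgA -conjgC mulgA.
Qed.

(* Writing [t = r * t'], the resampled permutation is the image of [t'] under
   left multiplication by a permutation that fixes [bs] and depends on [r]
   only. *)
Lemma resample_mean (R : realFieldType) bs (phi h : 'S_n -> R) :
  (forall t t', {in bs, t =1 t'} -> phi t = phi t') ->
  mean (fun t => mean (fun t' => phi t' * h (resample bs t t'))) =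
  mean (fun t => phi t * h t).
Proof.
move=> phibs.
have Sn0 : (0 < #|{: 'S_n}|)%N by rewrite card_Sn fact_gt0.
have -> : mean (fun t => mean (fun t' => phi t' * h (resample bs t t'))) =
    mean (fun r => mean (fun t' => phi t' * h (resample bs (r * t')%g t'))).
  rewrite mean.unlock -!mulr_suml; congr (_ / _ / _).
  rewrite exchange_big [RHS]exchange_big; apply: eq_bigr => t' _.
  by rewrite (reindex_inj (mulIg t')).
rewrite -[RHS](mean_cst _ Sn0); apply: eq_mean => r.
rewrite -[RHS](mean_reindex (fun t => phi t * h t) (mulgI (resample bs r 1))).
apply: eq_mean => t /=; rewrite resample_mulr; congr (_ * _).
by apply: phibs => b bbs; rewrite permM resample_agree // perm1.
Qed.

(** By [resample_mean], the mean of [phi j * h] can be computed with [phi j] evaluated at an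
    independent copy [t']; with the same copy, [phi j t' * h t] averages to the product of the
    means. The covariance is thus a sum of increments of [h], which is the Stein identity. *)
Lemma resample_cov (R : realFieldType) (J : finType) (bs : J -> seq 'I_n)
    (phi : J -> 'S_n -> R) (h : 'S_n -> R) :
  (forall j t t', {in bs j, t =1 t'} -> phi j t = phi j t') ->
  let X t := \sum_j phi j t in
  mean (fun t => (X t - mean X) * h t) =
  \sum_j mean (fun t => mean (fun t' =>
    phi j t' * (h (resample (bs j) t t') - h t))).
Proof.
move=> phibs X.
have -> : mean (fun t => (X t - mean X) * h t) =
    \sum_j (mean (fun t => phi j t * h t) - mean (phi j) * mean h).
  rewrite sumrB -mulr_suml -!mean_sum -meanZ -meanB.
  by apply: eq_mean => t; rewrite mulrBl mulr_suml.
apply: eq_bigr => j _; rewrite -(resample_mean _ (phibs j)) -meanZ -meanB.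
apply: eq_mean => t; rewrite [_ * h t]mulrC -meanZ -meanB.
by apply: eq_mean => t'; ring.
Qed.

End Resample.

(** * Occurrences in a conjugate *)

Lemma leq_card_bigcup (I T : finType) (P : pred I) (F : I -> {set T}) :
  (#|\bigcup_(i | P i) F i| <= \sum_(i | P i) #|F i|)%N.
Proof.
elim/big_rec2: _ => [|i m B _ Bm]; first by rewrite cards0.
by apply: leq_trans (leq_card_setU _ _) _; rewrite leq_add2l.
Qed.

(** * Counting tuples with prescribed adjacencies *)

Section Adjacency.
Variables (k : nat) (A : {set 'I_k.-1}).

Definition adjacent n (i : {ffun 'I_k -> 'I_n}) : bool :=
  [forall a in A, forall b : 'I_k, forall c : 'I_k,
     ((b == a :> nat) && (c == a.+1 :> nat)) ==> (i c == (i b).+1 :> nat)].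

(** First positions of the maximal runs of forced adjacencies. An adjacent tuple is determined by
    its values there, whence the exponent [k - #|A|] in all the counts. *)
Definition block_root : {set 'I_k} :=
  [set r : 'I_k | ~~ [exists a in A, r == a.+1 :> nat]].

Lemma card_block_root : #|block_root| = (k - #|A|)%N.
Proof.
have succ_lt (a : 'I_k.-1) : (a.+1 < k)%N by case: a => a /=; lia.
pose f a := Ordinal (succ_lt a).
have fi : injective f by move=> a b [] /val_inj.
rewrite -[X in (X - _)%N]card_ord -(card_imset A fi) -cardsT -cardsDS ?subsetT //.
congr #|pred_of_set _|; apply/setP => r; rewrite !inE andbT; congr (~~ _).
apply/exists_inP/imsetP => [[a aA /eqP ra]|[a aA ->]]; last by exists a.
by exists a => //; apply: val_inj.
Qed.

Lemma block_rootP (s : 'I_k) : exists r, [/\ r \in block_root, (r <= s)%N &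
  forall n (i : {ffun 'I_k -> 'I_n}), adjacent i -> i s = (i r + (s - r))%N :> nat].
Proof.
case: s => s; elim: s => [|s IH] sk.
  exists (Ordinal sk); split=> //=; last by move=> n i _; rewrite subn0 addn0.
  by rewrite inE; apply/existsP => -[a /andP[_]].
have [sr|] := boolP (Ordinal sk \in block_root).
  by exists (Ordinal sk); split=> // n i _; rewrite subnn addn0.
rewrite inE negbK => /exists_inP[a aA /= /eqP[sa]].
have [r [rr rs ir]] := IH (ltnW sk); exists r; split=> //=; first exact: leqW.
move=> n i ai; have /forall_inP/(_ a aA)/forallP/(_ (Ordinal (ltnW sk))) := ai.
move=> /forallP/(_ (Ordinal sk)) /= /implyP H.
have /eqP -> : i (Ordinal sk) == (i (Ordinal (ltnW sk))).+1 :> nat.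
  by apply: H; case: sa => ->; rewrite !eqxx.
by rewrite (ir n i ai) /=; move: rs => /= ?; lia.
Qed.

Lemma adjacent_root_inj n (i j : {ffun 'I_k -> 'I_n}) :
  adjacent i -> adjacent j -> {in block_root, i =1 j} -> i = j.
Proof.
move=> ai aj ij; apply/ffunP => s; apply: val_inj => /=.
by have [r [rr _ rs]] := block_rootP s; rewrite (rs _ i) // (rs _ j) // ij.
Qed.

(** Fixing the values at [#|Q|] roots leaves the other roots free. The factor [n ^ #|Q|] stands on
    the left to avoid a truncated subtraction in the exponent. *)
Lemma card_adjacent_fixed n (Q : {set 'I_k}) (v : 'I_k -> 'I_n) :
  Q \subset block_root ->
  (#|[set i : {ffun 'I_k -> 'I_n} | adjacent i & [forall r in Q, i r == v r]]|
     * n ^ #|Q| <= n ^ (k - #|A|))%N.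
Proof.
move=> Qr; set S := [set i | _ & _].
have [->|/set0Pn[i0 i0S]] := eqVneq S set0; first by rewrite cards0.
(* [g] keeps the values at the roots and overwrites the others by those of [i0]: it is injective on
   [S] and takes values in a product of singletons and full sets. *)
pose g (i : {ffun 'I_k -> 'I_n}) := [ffun s => if s \in block_root then i s else i0 s].
have gi : {in S &, injective g}.
  move=> i j; rewrite !inE => /andP[ai _] /andP[aj _] gij.
  apply: adjacent_root_inj => // r rr.
  by have := congr1 (fun f : {ffun _} => f r) gij; rewrite !ffunE rr.
pose F s : pred 'I_n := if s \in block_root :\: Q then predT
  else pred1 (if s \in Q then v s else i0 s).
rewrite -(card_in_imset gi) -card_block_root -(cardsID Q block_root) (setIidPr Qr).
rewrite expnD mulnC leq_pmul2l; last first.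
  case: (posnP #|Q|) => [->//|Q0]; rewrite expn_gt0.
  by case/card_gt0P: Q0 => r _; rewrite (leq_trans _ (ltn_ord (v r))).
have -> : (n ^ #|block_root :\: Q| = #|family F|)%N.
  rewrite card_family foldrE big_map big_enum /=.
  rewrite (bigID (mem (block_root :\: Q))) /= [X in (_ * X)%N]big1 ?muln1.
    rewrite -prod_nat_const; apply: eq_bigr => s sQ.
    by rewrite /F sQ card_ord.
  by move=> s /negPf sQ; rewrite /F sQ card1.
apply/subset_leq_card/subsetP => _ /imsetP[i iS ->].
apply/familyP => s; rewrite /F ffunE in_setD.
have iQ x : x \in Q -> i x == v x.
  by move: iS; rewrite in_set => /andP[_ /forall_inP]; apply.
have [sQ|sQ] := boolP (s \in Q); last by case: ifP => // _; rewrite inE.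
by rewrite (subsetP Qr _ sQ) inE iQ.
Qed.

Lemma card_adjacent n : (0 < n)%N ->
  (#|[set i : {ffun 'I_k -> 'I_n} | adjacent i]| <= n ^ (k - #|A|))%N.
Proof.
move=> n0; have := @card_adjacent_fixed n set0 (fun=> Ordinal n0) (sub0set _).
rewrite cards0 muln1; apply: leq_trans; apply/subset_leq_card/subsetP => i.
by rewrite !inE => ->; apply/forall_inP => r; rewrite inE.
Qed.

Lemma card_adjacent_through n (s : 'I_k) (x : 'I_n) :
  (#|[set i : {ffun 'I_k -> 'I_n} | adjacent i & i s == x]| * n <= n ^ (k - #|A|))%N.
Proof.
have [r [rr rs ir]] := block_rootP s; set S := [set i | _ & _].
have [->|/set0Pn[i0 i0S]] := eqVneq S set0; first by rewrite cards0.
have Q : [set r] \subset block_root by rewrite sub1set.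
have := @card_adjacent_fixed n _ (fun=> i0 r) Q.
rewrite cards1 expn1; apply: leq_trans; rewrite leq_mul2r; apply/orP; right.
apply/subset_leq_card/subsetP => i; move: i0S; rewrite !inE.
move=> /andP[a0 /eqP s0] /andP[ai /eqP si]; rewrite ai /=.
apply/forall_inP => r'; rewrite inE => /eqP ->; apply/eqP/val_inj => /=.
have := ir _ _ a0; have := ir _ _ ai; rewrite s0 si => -> /eqP.
by rewrite eqn_add2r => /eqP.
Qed.

(** Inside one block the values differ by less than [k], so two values at distance at least [k]
    prescribe two distinct roots. The sum of the two truncated differences is the absolute
    difference. *)
Lemma card_adjacent_through2 n (s s' : 'I_k) (x x' : 'I_n) :
  (k <= x - x' + (x' - x))%N ->
  (#|[set i : {ffun 'I_k -> 'I_n} | adjacent i & (i s == x) && (i s' == x')]|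
     * n ^ 2 <= n ^ (k - #|A|))%N.
Proof.
have [r [rr rs ir]] := block_rootP s; have [r' [rr' rs' ir']] := block_rootP s'.
set S := [set i | _ & _] => xx'.
have [->|/set0Pn[i0 i0S]] := eqVneq S set0; first by rewrite cards0.
have Q : [set r; r'] \subset block_root by rewrite subUset !sub1set rr.
have := @card_adjacent_fixed n _ i0 Q; move: i0S.
rewrite !inE => /and3P[a0 /eqP s0 /eqP s0'].
have rr'N : r != r'.
  apply/eqP => E; have := ir _ _ a0; have := ir' _ _ a0; rewrite s0 s0' -E.
  by move: xx'; have := ltn_ord s; have := ltn_ord s'; lia.
rewrite cards2 rr'N; apply: leq_trans; rewrite leq_mul2r; apply/orP; right.
apply/subset_leq_card/subsetP => i; rewrite !inE.
move=> /and3P[ai /eqP si /eqP si']; rewrite ai /=.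
apply/forall_inP => q; rewrite !inE => /orP[]/eqP ->; apply/eqP/val_inj => /=.
  have := ir _ _ a0; have := ir _ _ ai; rewrite s0 si => -> /eqP.
  by rewrite eqn_add2r => /eqP.
have := ir' _ _ a0; have := ir' _ _ ai; rewrite s0' si' => -> /eqP.
by rewrite eqn_add2r => /eqP.
Qed.

(* Bounds for the number of tuples meeting a given set, and meeting two sets at
   distance at least [k]: in the latter case the two hits lie in different
   blocks of the tuple. *)
Lemma card_adjacent_meets n (P : {set 'I_n}) :
  (#|[set i : {ffun 'I_k -> 'I_n} | adjacent i & [exists s, i s \in P]]| * n
     <= k * #|P| * n ^ (k - #|A|))%N.
Proof.
set S := [set i | _ & _].
have : (#|S| <= \sum_(s < k) \sum_(x in P)
    #|[set i : {ffun 'I_k -> 'I_n} | adjacent i & i s == x]|)%N.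
  apply: (@leq_trans #|\bigcup_(s < k) \bigcup_(x in P)
      [set i : {ffun 'I_k -> 'I_n} | adjacent i & i s == x]|).
    apply/subset_leq_card/subsetP => i; rewrite inE => /andP[ai /existsP[s iP]].
    apply/bigcupP; exists s => //; apply/bigcupP; exists (i s) => //.
    by rewrite inE ai eqxx.
  apply: leq_trans (leq_card_bigcup _ _) _; apply: leq_sum => s _.
  exact: leq_card_bigcup.
move/(leq_mul (leqnn n)); rewrite mulnC => /leq_trans; apply.
rewrite mulnC big_distrl /=.
apply: (@leq_trans (\sum_(s < k) \sum_(x in P) n ^ (k - #|A|))).
  apply: leq_sum => s _; rewrite big_distrl; apply: leq_sum => x _.
  exact: card_adjacent_through.
by rewrite !sum_nat_const card_ord mulnA.
Qed.

Lemma card_adjacent_meets2 n (P Q : {set 'I_n}) :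
  (forall x y, x \in P -> y \in Q -> (k <= x - y + (y - x))%N) ->
  (#|[set i : {ffun 'I_k -> 'I_n} | adjacent i &
       [exists s, i s \in P] && [exists s, i s \in Q]]| * n ^ 2
     <= k * k * (#|P| * #|Q|) * n ^ (k - #|A|))%N.
Proof.
move=> PQ; set S := [set i | _ & _].
pose E s s' x y := [set i : {ffun 'I_k -> 'I_n} |
                    adjacent i & (i s == x) && (i s' == y)].
have : (#|S| <= \sum_(s < k) \sum_(s' < k) \sum_(x in P) \sum_(y in Q)
    #|E s s' x y|)%N.
  apply: (@leq_trans #|\bigcup_(s < k) \bigcup_(s' < k) \bigcup_(x in P)
      \bigcup_(y in Q) E s s' x y|).
    apply/subset_leq_card/subsetP => i; rewrite inE.
    move=> /and3P[ai /existsP[s iP] /existsP[s' iQ]].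
    apply/bigcupP; exists s => //; apply/bigcupP; exists s' => //.
    apply/bigcupP; exists (i s) => //; apply/bigcupP; exists (i s') => //.
    by rewrite inE ai !eqxx.
  do 3 (apply: leq_trans (leq_card_bigcup _ _) _; apply: leq_sum => ? _).
  exact: leq_card_bigcup.
move/(leq_mul (leqnn (n ^ 2))); rewrite mulnC => /leq_trans; apply.
rewrite mulnC big_distrl /=.
apply: (@leq_trans (\sum_(s < k) \sum_(s' < k) \sum_(x in P) \sum_(y in Q)
   n ^ (k - #|A|))).
  apply: leq_sum => s _; rewrite big_distrl; apply: leq_sum => s' _.
  rewrite big_distrl; apply: leq_sum => x xP.
  rewrite big_distrl; apply: leq_sum => y yQ.
  by apply: card_adjacent_through2; exact: PQ.
by rewrite !sum_nat_const !card_ord !mulnA.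
Qed.

End Adjacency.

(** * Effect of local modifications on the number of occurrences *)

Lemma conjg_fix n (s d : 'S_n) (D : {set 'I_n}) x :
  (forall y, y \notin D -> d y = y) -> x \notin D -> s x \notin D ->
  (s ^ d)%g x = s x.
Proof. by move=> dD xD sxD; rewrite -{1}(dD x xD) permJ dD. Qed.

Lemma resample_disp n (bs : seq 'I_n) (t t' : 'S_n) :
  exists2 d, resample bs t t' = (t * d)%g &
  forall y, (forall b, b \in bs -> (y != t b) && (y != t' b)) -> d y = y.
Proof.
elim: bs t => [|b bs IH] t /=; first by exists 1%g; rewrite ?mulg1 // => y _; rewrite perm1.
have [d -> dy] := IH (t * tperm (t b) (t' b))%g.
exists (tperm (t b) (t' b) * d)%g; first by rewrite mulgA.
move=> y yb; have /andP[y1 y2] := yb b (mem_head _ _).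
have ty : tperm (t b) (t' b) y = y by rewrite tpermD // eq_sym.
rewrite permM ty dy // => c cbs.
have /andP[y3 ->] : (y != t c) && (y != t' c) by apply: yb; rewrite inE cbs orbT.
by rewrite andbT permM -{1}ty (inj_eq perm_inj).
Qed.

Lemma resample_tperm n (bs : seq 'I_n) (t t' : 'S_n) u v :
  u \notin bs -> v \notin bs ->
  resample bs (tperm u v * t)%g t' = (tperm u v * resample bs t t')%g.
Proof.
elim: bs t => //= b bs IH t; rewrite !inE !negb_or => /andP[ub uS] /andP[vb vS].
by rewrite permM tpermD -?mulgA ?IH // eq_sym.
Qed.

Section Occurrences.
Variables (R : realFieldType) (k : nat) (tau : 'S_k) (A : {set 'I_k.-1}).
Local Notation m := (k - #|A|)%N.

Lemma occurrence_adjacent n (s : 'S_n) i : is_occurrence tau A s i -> adjacent A i.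
Proof. by case/and3P. Qed.

Lemma occurrence_local n (s s' : 'S_n) (i : {ffun 'I_k -> 'I_n}) :
  (forall a, s (i a) = s' (i a)) -> is_occurrence tau A s i = is_occurrence tau A s' i.
Proof.
move=> ss; congr [&& _, _ & _].
by apply: eq_forallb => a; apply: eq_forallb => b; rewrite !ss.
Qed.

Lemma num_occurrencesE n (s : 'S_n) : (num_occurrences tau A s)%:R =
  \sum_(i : {ffun 'I_k -> 'I_n}) (is_occurrence tau A s i)%:R :> R.
Proof.
rewrite /num_occurrences -sum1dep_card natr_sum big_mkcond /=.
by apply: eq_bigr => i _; case: is_occurrence.
Qed.

Lemma num_occurrences_le n (s : 'S_n) : (0 < n)%N ->
  (num_occurrences tau A s <= n ^ m)%N.
Proof.
move=> n0; apply: leq_trans (card_adjacent A n0).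
by apply/subset_leq_card/subsetP => i; rewrite !inE => /occurrence_adjacent.
Qed.

Lemma num_occurrences_diff n (P : {set 'I_n}) (s s' : 'S_n) :
  (forall x, x \notin P -> s x = s' x) ->
  `|(num_occurrences tau A s)%:R - (num_occurrences tau A s')%:R| * n%:R
    <= (k * #|P|)%:R * n%:R ^+ m :> R.
Proof.
move=> ss; rewrite !num_occurrencesE -sumrB.
apply: (@le_trans _ _ (#|[set i : {ffun 'I_k -> 'I_n} |
    adjacent A i & [exists s, i s \in P]]| * n)%:R); last first.
  by rewrite -natrX -natrM ler_nat card_adjacent_meets.
rewrite natrM ler_wpM2r // (le_trans (ler_norm_sum _ _ _)) //.
rewrite -sum1dep_card natr_sum [leRHS]big_mkcond /=; apply: ler_sum => i _.
case: ifPn => [_|].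
  by do 2!case: is_occurrence; rewrite ?subrr ?subr0 ?sub0r ?normrN ?normr0 ?normr1.
rewrite negb_and => /orP[ai|/existsPn iP].
  suff E u : is_occurrence tau A u i = false by rewrite !E subrr normr0.
  by apply: contraNF ai; exact: occurrence_adjacent.
rewrite (@occurrence_local _ s s') ?subrr ?normr0 // => a; apply: ss; exact: iP.
Qed.

(** For a tuple avoiding [P] the terms of [s11] and [s01], and those of [s10] and [s00], cancel; for
    one avoiding [Q] they cancel the other way. The tuples meeting both sets contribute at most 2
    each. *)
Lemma num_occurrences_diff2 n (P Q : {set 'I_n}) (s00 s10 s01 s11 : 'S_n) :
  (forall x y, x \in P -> y \in Q -> (k <= x - y + (y - x))%N) ->
  (forall x, x \notin P -> s10 x = s00 x) ->
  (forall x, x \notin P -> s11 x = s01 x) ->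
  (forall x, x \notin Q -> s01 x = s00 x) ->
  (forall x, x \notin Q -> s11 x = s10 x) ->
  `|(num_occurrences tau A s11)%:R - (num_occurrences tau A s01)%:R
    - ((num_occurrences tau A s10)%:R - (num_occurrences tau A s00)%:R)| * n%:R ^+ 2
    <= 2 * (k * k * (#|P| * #|Q|))%:R * n%:R ^+ m :> R.
Proof.
move=> PQ e1 e2 e3 e4; rewrite !num_occurrencesE -!sumrB.
apply: (@le_trans _ _ (2 * (#|[set i : {ffun 'I_k -> 'I_n} | adjacent A i &
       [exists s, i s \in P] && [exists s, i s \in Q]]| * n ^ 2)%:R)); last first.
  by rewrite -mulrA ler_wpM2l // -natrX -natrM ler_nat card_adjacent_meets2.
rewrite natrM mulrA natrX ler_wpM2r ?exprn_ge0 // (le_trans (ler_norm_sum _ _ _)) //.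
rewrite -sum1dep_card natr_sum mulr_sumr [leRHS]big_mkcond /=.
apply: ler_sum => i _; rewrite mulr1; case: ifPn => [_|].
  by rewrite ler_norml; do 4!case: is_occurrence => /=; lra.
rewrite !negb_and => /orP[ai|/orP[]/existsPn iP].
- suff E u : is_occurrence tau A u i = false by rewrite !E !subrr normr0.
  by apply: contraNF ai; exact: occurrence_adjacent.
- rewrite (@occurrence_local _ s10 s00) 1?(@occurrence_local _ s11 s01).
  + by rewrite !subrr normr0.
  + by move=> a; apply: e2; exact: iP.
  + by move=> a; apply: e1; exact: iP.
- rewrite (@occurrence_local _ s01 s00) 1?(@occurrence_local _ s11 s10).
  + by rewrite subrr normr0.
  + by move=> a; apply: e4; exact: iP.
  + by move=> a; apply: e3; exact: iP.
Qed.

Section Conjugates.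
Variables (n : nat) (s0 : 'S_n).
Implicit Types (t : 'S_n) (a : {ffun 'I_k -> 'I_n}).

Definition occ_conj t : R := (num_occurrences tau A (s0 ^ t)%g)%:R.

Definition occ_at a t : R :=
  (is_occurrence tau A (s0 ^ t)%g [ffun j => t (a j)])%:R.

Definition support_seq a : seq 'I_n :=
  codom a ++ codom (fun j => s0 (a j)).

Lemma reindex_perm_ffun t (F : {ffun 'I_k -> 'I_n} -> R) :
  \sum_(a : {ffun 'I_k -> 'I_n}) F [ffun j => t (a j)] = \sum_i F i.
Proof.
rewrite [RHS](reindex_inj (h := fun a : {ffun 'I_k -> 'I_n} => [ffun j => t (a j)])) //.
move=> a b /ffunP ab; apply/ffunP => j; have := ab j.
by rewrite !ffunE => /perm_inj.
Qed.

Lemma occ_conjE t : occ_conj t = \sum_a occ_at a t.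
Proof.
rewrite /occ_conj num_occurrencesE.
by rewrite -(reindex_perm_ffun t (fun i => (is_occurrence tau A (s0 ^ t)%g i)%:R)).
Qed.

Lemma occ_at_local a t t' : {in support_seq a, t =1 t'} -> occ_at a t = occ_at a t'.
Proof.
move=> tt'; have t1 j : t (a j) = t' (a j).
  by apply: tt'; rewrite mem_cat codom_f.
have t2 j : t (s0 (a j)) = t' (s0 (a j)).
  by apply: tt'; rewrite mem_cat (codom_f (fun j => s0 (a j))) orbT.
rewrite /occ_at; have -> : [ffun j => t (a j)] = [ffun j => t' (a j)].
  by apply/ffunP => j; rewrite !ffunE.
congr (nat_of_bool _)%:R; apply: occurrence_local => j.
by rewrite ffunE permJ -t1 permJ.
Qed.

Lemma support_seqP a b :
  reflect (exists j, b = a j \/ b = s0 (a j)) (b \in support_seq a).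
Proof.
rewrite mem_cat; apply: (iffP orP) => [[]/codomP[j ->]|[j [->|->]]].
- by exists j; left.
- by exists j; right.
- by left; exact: codom_f.
- by right; exact: (codom_f (fun j => s0 (a j))).
Qed.

Definition moved_values a t t' : {set 'I_n} :=
  [set t b | b in support_seq a] :|: [set t' b | b in support_seq a].

Lemma card_moved_values a t t' : (#|moved_values a t t'| <= 4 * k)%N.
Proof.
have S : (#|support_seq a| <= 2 * k)%N.
  rewrite (leq_trans (card_size _)) // size_cat !size_codom card_ord; lia.
rewrite (leq_trans (leq_card_setU _ _)) // !card_imset; try exact: perm_inj.
by rewrite (leq_trans (leq_add S S)) // ; lia.
Qed.

Lemma moved_valuesP a t t' : exists2 d, resample (support_seq a) t t' = (t * d)%g &
  forall y, y \notin moved_values a t t' -> d y = y.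
Proof.
have [d Ed dy] := resample_disp (support_seq a) t t'; exists d => // y.
rewrite inE negb_or => /andP[/imsetP y1 /imsetP y2]; apply: dy => b bS.
by apply/andP; split; apply/eqP => yb; [apply: y1 | apply: y2]; exists b.
Qed.

Lemma card_preim_perm (s : 'S_n) (D : {set 'I_n}) : #|s @^-1: D| = #|D|.
Proof. by apply: card_preimset; exact: perm_inj. Qed.

Lemma occ_conj_resample a t t' :
  `|occ_conj (resample (support_seq a) t t') - occ_conj t| * n%:R
    <= (8 * k ^ 2)%:R * n%:R ^+ m.
Proof.
have [d -> dD] := moved_valuesP a t t'.
move: (moved_values a t t') dD (card_moved_values a t t') => D dD cD.
rewrite /occ_conj conjgM.
(* Conjugation by [d] alters the permutation only at points of [D] and at points sent into [D],
   hence at no more than [8 * k] points. *)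
apply: le_trans (num_occurrences_diff (P := D :|: (s0 ^ t)%g @^-1: D) _) _.
  move=> x; rewrite !inE negb_or => /andP[xD sxD]; exact: conjg_fix dD xD sxD.
rewrite ler_wpM2r ?exprn_ge0 // ler_nat.
apply: (@leq_trans (k * (4 * k + 4 * k))); last by lia.
rewrite leq_mul2l; apply/orP; right; apply: leq_trans (leq_card_setU _ _) _.
by rewrite leq_add // card_preim_perm.
Qed.

End Conjugates.
End Occurrences.

Definition thicken n k (Q : {set 'I_n}) : {set 'I_n} :=
  [set y : 'I_n | [exists x in Q, x - y + (y - x) <= k]%N].

Lemma card_thicken n k (Q : {set 'I_n}) : (#|thicken k Q| <= #|Q| * k.*2.+1)%N.
Proof.
have -> : thicken k Q = \bigcup_(x in Q) [set y : 'I_n | x - y + (y - x) <= k]%N.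
  apply/setP => y; rewrite inE; apply/exists_inP/bigcupP => -[x xQ xy];
    by exists x => //; move: xy; rewrite inE.
apply: leq_trans (leq_card_bigcup _ _) _; rewrite -sum_nat_const.
apply: leq_sum => x _.
pose f (y : 'I_n) : 'I_(k.*2.+1) := inord (y + k - x).
rewrite -[leqRHS]card_ord -(card_in_imset (f := f)); first exact: max_card.
move=> y y'; rewrite !inE => xy xy' /(congr1 (@nat_of_ord _)).
by rewrite !inordK => [yy||]; first (apply: val_inj => /=); lia.
Qed.

(** Conjugating by [d] changes [s] on [D] and its preimage, conjugating by [e] changes it on [Q].
    When these sets are far apart, [d] and [e] commute and each change is the same whether or not
    the other has been made; the conclusions are the hypotheses of [num_occurrences_diff2]. *)
Lemma conjg_second_difference n (s d : 'S_n) (p q : 'I_n) (D : {set 'I_n}) k :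
  let Q := [set p; q; (s^-1)%g p; (s^-1)%g q] in
  let e := tperm p q in
  (forall y, y \notin D -> d y = y) ->
  (forall y, y \in D -> (y \notin thicken k Q) && ((s^-1)%g y \notin thicken k Q)) ->
  let P := D :|: s @^-1: D in
  [/\ forall x y, x \in P -> y \in Q -> (k <= x - y + (y - x))%N,
      forall x, x \notin P -> (s ^ d)%g x = s x,
      forall x, x \notin P -> (s ^ (e * d))%g x = (s ^ e)%g x,
      forall x, x \notin Q -> (s ^ e)%g x = s x &
      forall x, x \notin Q -> (s ^ (e * d))%g x = (s ^ d)%g x].
Proof.
move=> Q e dD far P.
have nQ y : y \notin thicken k Q -> forall x, x \in Q -> (k < x - y + (y - x))%N.
  by rewrite inE => /exists_inPn H x /H; rewrite ltnNge.
have nQ' y : y \notin thicken k Q -> y \notin Q.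
  by move/nQ => H; apply/negP => /H; rewrite subnn.
have DQ y : y \in D -> y \notin Q by move=> /far /andP[/nQ'].
have sDQ y : y \in D -> (s^-1)%g y \notin Q by move=> /far /andP[_ /nQ'].
have pQ : p \in Q by rewrite !inE eqxx.
have qQ : q \in Q by rewrite !inE eqxx orbT.
have spQ : (s^-1)%g p \in Q by rewrite !inE eqxx !orbT.
have sqQ : (s^-1)%g q \in Q by rewrite !inE eqxx !orbT.
have QD y : y \in Q -> y \notin D by move=> yQ; apply: contraL yQ; exact: DQ.
have eQ y : y \notin Q -> e y = y.
  by move=> yQ; rewrite tpermD //; apply: contraNneq yQ => <-.
have ed : (e ^ d)%g = e by rewrite tpermJ !dD ?QD.
have edC : (e * d = d * e)%g by rewrite [LHS]conjgC ed.
have eE y : y \notin [set p; q] -> e y = y.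
  by rewrite !inE negb_or => /andP[yp yq]; rewrite tpermD // eq_sym.
have QE y : y \notin Q -> y \notin [set p; q].
  by apply: contraNN; rewrite !inE => /orP[]/eqP->; rewrite eqxx ?orbT.
have sQ y : y \notin Q -> s y \notin [set p; q].
  apply: contraNN; rewrite in_set2 => /orP[]/eqP H.
    by rewrite -(permK s y) H.
  by rewrite -(permK s y) H.
split.
- move=> x y; rewrite in_setU => /orP[/far/andP[/nQ H _] yQ|].
    by have := H _ yQ; lia.
  rewrite inE => /far/andP[_]; rewrite permK => /nQ H yQ.
  by have := H _ yQ; lia.
- move=> x; rewrite in_setU negb_or => /andP[xD sxD].
  by apply: (conjg_fix dD xD); move: sxD; rewrite inE.
- move=> x; rewrite in_setU negb_or => /andP[xD]; rewrite inE => sxD.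
  rewrite conjgM; apply: (conjg_fix dD xD).
  apply/negP => yD; set y := (s ^ e)%g x in yD.
  have Ey : s (e x) = y.
    have : e y = s (e x).
      by rewrite /y -{1}[x](tpermK p q) permJ tpermK.
    by rewrite eQ // DQ.
  have Ex : e x = (s^-1)%g y by rewrite -Ey permK.
  have xE : x = (s^-1)%g y.
    by rewrite -[LHS](tpermK p q) -/e Ex eQ ?sDQ.
  by move: sxD; rewrite xE permKV yD.
- move=> x xQ; apply: (conjg_fix eE); [exact: QE|exact: sQ].
- move=> x xQ; rewrite edC conjgM; apply: (conjg_fix eE); first exact: QE.
  have dV z : z \notin D -> (d^-1)%g z = z by move=> zD; rewrite -{1}(dD z zD) permK.
  rewrite -[x](permKV d) permJ in_set2; apply/negP => H.
  suff [z zQ xz] : exists2 z, z \in Q & (d^-1)%g x = z.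
    by move: xQ; rewrite -(permKV d x) xz dD ?zQ // QD.
  case/orP: H => /eqP H.
    exists ((s^-1)%g p) => //; apply: (@perm_inj _ s); rewrite permKV.
    by apply: (@perm_inj _ d); rewrite H dD // QD.
  exists ((s^-1)%g q) => //; apply: (@perm_inj _ s); rewrite permKV.
  by apply: (@perm_inj _ d); rewrite H dD // QD.
Qed.

(** * Lipschitz bound for the mean resampling increment *)

Section SteinKernel.
Variables (R : realFieldType) (k : nat) (tau : 'S_k) (A : {set 'I_k.-1}).
Local Notation m := (k - #|A|)%N.
Variables (n : nat) (s0 : 'S_n).
Hypothesis n0 : (0 < n)%N.
Implicit Types (t : 'S_n) (a : {ffun 'I_k -> 'I_n}).
Local Notation X := (occ_conj R tau A s0).
Local Notation phi := (occ_at R tau A s0).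
Local Notation bs a := (support_seq s0 a).

(** A moved value [y] may interact with the transposition of [t u] and [t v] only if [y] or its
    preimage is within [k] of these two values or of their preimages. *)
Definition bad_values t u v : {set 'I_n} :=
  let s := (s0 ^ t)%g in
  let N := thicken k [set t u; t v; (s^-1)%g (t u); (s^-1)%g (t v)] in
  N :|: [set y | (s^-1)%g y \in N].

Lemma card_bad_values t u v : (#|bad_values t u v| <= 8 * k.*2.+1)%N.
Proof.
rewrite /bad_values; set s := (s0 ^ t)%g; set Q := [set _; _; _; _].
have Q4 : (#|Q| <= 4)%N by rewrite /Q -!setUA !cardsU1 cards1; do !case: (_ \notin _).
have N4 : (#|thicken k Q| <= 4 * k.*2.+1)%N.
  by apply: leq_trans (card_thicken _ _) _; rewrite leq_mul2r Q4 orbT.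
apply: leq_trans (leq_card_setU _ _) _.
have -> : [set y | (s^-1)%g y \in thicken k Q] = (s^-1)%g @^-1: thicken k Q by [].
by rewrite card_preim_perm; lia.
Qed.

Definition near a t t' u v : bool :=
  [exists y in moved_values s0 a t t', y \in bad_values t u v].

Lemma occ_conj_second_difference a t t' u v : ~~ near a t t' u v ->
  `|X (resample (bs a) (tperm u v * t)%g t') - X (tperm u v * t)%g
    - (X (resample (bs a) t t') - X t)| * n%:R ^+ 2
  <= (64 * k ^ 3)%:R * n%:R ^+ m.
Proof.
move=> /exists_inPn far; have [d Ed dD] := moved_valuesP s0 a t t'.
have uv x : x \in [set u; v] -> x \notin bs a.
  move=> xuv; apply/negP => xS.
  have xM : t x \in moved_values s0 a t t'.
    by rewrite in_setU; apply/orP; left; exact: imset_f.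
  have := far _ xM; rewrite in_setU negb_or => /andP[/negP[]].
  rewrite inE; apply/exists_inP; exists (t x); last by rewrite subnn.
  by move: xuv; rewrite !inE => /orP[]/eqP->; rewrite eqxx ?orbT.
rewrite resample_tperm ?uv ?set21 ?set22 // Ed.
have -> : (tperm u v * (t * d) = t * (tperm (t u) (t v) * d))%g.
  by rewrite mulgA [(tperm u v * t)%g]conjgC tpermJ -mulgA.
have -> : (tperm u v * t = t * tperm (t u) (t v))%g by rewrite conjgC tpermJ.
have := @conjg_second_difference n (s0 ^ t)%g d (t u) (t v) _ k dD _.
case.
  move=> y /far; rewrite in_setU negb_or => /andP[-> /=].
  by rewrite inE.
move=> h1 h2 h3 h4 h5; rewrite /occ_conj !(conjgM s0 t).
apply: le_trans (num_occurrences_diff2 R tau A h1 h2 h3 h4 h5) _.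
rewrite ler_wpM2r ?exprn_ge0 // -natrM ler_nat.
set D := moved_values _ _ _ _; have Dk : (#|D| <= 4 * k)%N := card_moved_values _ _ _ _.
set Q := [set _; _; _; _].
have Q4 : (#|Q| <= 4)%N by rewrite /Q -!setUA !cardsU1 cards1; do !case: (_ \notin _).
have P8 : (#|D :|: (s0 ^ t)%g @^-1: D| <= 8 * k)%N.
  by apply: leq_trans (leq_card_setU _ _) _; rewrite card_preim_perm; lia.
apply: (@leq_trans (2 * (k * k * (8 * k * 4)))); last by lia.
by rewrite leq_mul2l leq_mul2l leq_mul ?orbT.
Qed.

(** Read on the positions [t' (a j)], being near means meeting a set of bounded size, which saves a
    factor [n] over all adjacent tuples. *)
Lemma card_near t t' u v :
  (#|[set a : {ffun 'I_k -> 'I_n} | near a t t' u v &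
       adjacent A [ffun j => t' (a j)]]| * n
    <= k * (32 * k.*2.+1) * n ^ m)%N.
Proof.
pose B := bad_values t u v.
(* A moved value is the image under [t] or [t'] of some [a j] or [s0 (a j)]; as functions of the
   position [t' (a j)] these are four permutations, one of them the identity. *)
pose B' := ((t'^-1 * t)%g @^-1: B :|: B) :|:
  ((t'^-1 * s0 * t)%g @^-1: B :|: (t'^-1 * s0 * t')%g @^-1: B).
have cB : (#|B'| <= 32 * k.*2.+1)%N.
  rewrite (leq_trans (leq_card_setU _ _)) //.
  rewrite (leq_trans (leq_add (leq_card_setU _ _) (leq_card_setU _ _))) //.
  by rewrite !card_preim_perm; have := card_bad_values t u v; rewrite -/B; lia.
apply: leq_trans _ (leq_trans (card_adjacent_meets A B') _); last first.
  by rewrite leq_mul2r leq_mul2l cB !orbT.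
rewrite leq_mul2r; apply/orP; right.
pose f a := [ffun j => t' (a j)] : {ffun 'I_k -> 'I_n}.
have fi : injective f.
  by move=> a b /ffunP ab; apply/ffunP => j; have := ab j; rewrite !ffunE => /perm_inj.
rewrite -(card_imset _ fi); apply/subset_leq_card/subsetP => _ /imsetP[a + ->].
rewrite !inE => /andP[/exists_inP[y yM yB] ->] /=.
have [b bS yb] : exists2 b, b \in bs a & y = t b \/ y = t' b.
  move: yM; rewrite in_setU => /orP[]/imsetP[b bS ->]; exists b => //; by [left|right].
have /support_seqP[j bj] := bS; apply/existsP; exists j.
rewrite /f ffunE /B'; move: (yB : y \in B) => {}yB; clearbody B; rewrite !in_setU.
case: bj => bj; case: yb => yE; rewrite yE bj in yB.
- by apply/orP; left; apply/orP; left; rewrite inE permM permK.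
- by apply/orP; left; apply/orP; right.
- by apply/orP; right; apply/orP; left; rewrite inE !permM permK.
- by apply/orP; right; apply/orP; right; rewrite inE !permM permK.
Qed.

(** The drift [U] of the moment recursion, before division by the square of the scale. *)
Definition stein_kernel t : R :=
  mean (fun t' => \sum_a phi a t' * (X (resample (bs a) t t') - X t)).

Lemma sum_occ_at_le t : \sum_a phi a t <= n%:R ^+ m.
Proof. by rewrite -occ_conjE -natrX ler_nat num_occurrences_le. Qed.

(** Far tuples: at most [n ^ m] indicators equal to 1, each with a second difference of order
    [n ^ (m - 2)]. Near tuples: order [n ^ (m - 1)] of them, each with two increments of order
    [n ^ (m - 1)]. Both totals are of order [n ^ (2 m - 2)]. *)
Lemma stein_kernel_lipschitz t u v :
  `|stein_kernel (tperm u v * t)%g - stein_kernel t| * n%:R ^+ 2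
    <= (64 * k ^ 3 + 2 * (8 * k ^ 2) * (k * (32 * k.*2.+1)))%:R * n%:R ^+ m * n%:R ^+ m.
Proof.
have Sn0 : (0 < #|{: 'S_n}|)%N by rewrite card_Sn fact_gt0.
have nn : 0 < n%:R :> R by rewrite ltr0n.
rewrite /stein_kernel -meanB -ler_pdivlMr ?exprn_gt0 //.
apply: le_trans (ler_norm_mean _) _; rewrite -[leRHS](mean_cst _ Sn0).
apply: ler_mean => t'; rewrite ler_pdivlMr ?exprn_gt0 // -sumrB.
pose c2 : R := (64 * k ^ 3)%:R * n%:R ^+ m.
pose c1 : R := (2 * (8 * k ^ 2))%:R * n%:R ^+ m * n%:R.
have nm0 : 0 <= n%:R ^+ m :> R by rewrite exprn_ge0.
have c10 : 0 <= c1 by rewrite mulr_ge0 // mulr_ge0.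
have c20 : 0 <= c2 by rewrite mulr_ge0.
pose N := [set a | near a t t' u v & adjacent A [ffun j => t' (a j)]].
apply: (@le_trans _ _ (\sum_a (phi a t' * c2 + (a \in N)%:R * c1))).
  rewrite -ler_pdivlMr ?exprn_gt0 // (le_trans (ler_norm_sum _ _ _)) // mulr_suml.
  apply: ler_sum => a _; rewrite ler_pdivlMr ?exprn_gt0 // -mulrBr normrM.
  rewrite [Num.norm (phi a t')]ger0_norm ?ler0n // -mulrA.
  have [aN|aN] := boolP (near a t t' u v); last first.
    rewrite -[leLHS]addr0 lerD ?mulr_ge0 ?ler0n //.
    rewrite ler_wpM2l ?ler0n //; exact: occ_conj_second_difference.
  have [->|[ph ai]] : phi a t' = 0 \/ phi a t' = 1 /\ adjacent A [ffun j => t' (a j)].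
    rewrite /occ_at; case E: is_occurrence; [right|left] => //.
    by split => //; exact: occurrence_adjacent E.
    by rewrite !mul0r add0r mulr_ge0 ?ler0n.
  have -> : a \in N by rewrite inE aN ai.
  rewrite -[leLHS]add0r lerD ?mulr_ge0 ?ler0n ?exprn_ge0 //.
  rewrite ph !mul1r expr2 mulrA /c1 ler_wpM2r ?ler0n //.
  have h1 := occ_conj_resample R tau A s0 a (tperm u v * t)%g t'.
  have h2 := occ_conj_resample R tau A s0 a t t'.
  rewrite -[leLHS]ger0_norm ?mulr_ge0 ?ler0n // normrM normr_id -normrM mulrBl.
  apply: le_trans (ler_normB _ _) _; rewrite !normrM normr_nat.
  by rewrite natrM -mulrA; lra.
rewrite big_split /= -!mulr_suml.
have -> : \sum_a (a \in N)%:R = #|N|%:R :> R.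
  by rewrite -sum1_card natr_sum [RHS]big_mkcond /=; apply: eq_bigr => a _; case: ifP.
rewrite natrD !mulrDl lerD //.
  rewrite mulrC ler_wpM2l ?sum_occ_at_le // //.
have := card_near t t' u v; rewrite -/N -(ler_nat R) !natrM natrX => h.
rewrite /c1 mulrCA mulrC [_ * (k%:R * _)]mulrC; rewrite !natrM.
have e0 : 0 <= 2%:R * (8%:R * (k ^ 2)%:R) * n%:R ^+ m :> R.
  by rewrite !mulr_ge0 ?exprn_ge0 ?ler0n.
have := ler_wpM2l e0 h; lra.
Qed.

End SteinKernel.

(** * The normalized count as a Stein family *)

Section NormalizedConjugates.
Variables (R : rcfType) (k : nat) (tau : 'S_k) (A : {set 'I_k.-1}).
Local Notation m := (k - #|A|)%N.

Definition conj_scale n : R := n%:R ^+ m / Num.sqrt n%:R.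

Definition centered_conj n (s0 t : 'S_n) : R :=
  (occ_conj R tau A s0 t - mean (occ_conj R tau A s0)) / conj_scale n.

Let kernel_const : nat := (64 * k ^ 3 + 2 * (8 * k ^ 2) * (k * (32 * k.*2.+1)))%N.
(** The summands serve in turn for the total weight, the steps, and the fluctuations of the
    drift. *)
Let c : R := (1 + 8 * k ^ 2 + kernel_const)%:R.

Section FixedSize.
Variables (n : nat) (s0 : 'S_n).
Hypothesis n0 : (0 < n)%N.

Let N : R := n%:R.
Let e : R := (Num.sqrt N)^-1.
Let L : R := conj_scale n.
(** A move is a pair of an independent permutation [j.1] and a label tuple [j.2]; dividing by the
    number of permutations builds the uniform law of [j.1] into the weight. *)
Let q (j : 'S_n * {ffun 'I_k -> 'I_n}) : R :=
  occ_at R tau A s0 j.2 j.1 / (#|{: 'S_n}|%:R * L).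
Let M (j : 'S_n * {ffun 'I_k -> 'I_n}) t : 'S_n :=
  resample (support_seq s0 j.2) t j.1.
Let Z := centered_conj s0.

Let N0 : 0 < N. Proof. by rewrite ltr0n. Qed.
Let e0 : 0 < e. Proof. by rewrite invr_gt0 sqrtr_gt0. Qed.
Let Ne : N * e ^+ 2 = 1.
Proof. by rewrite /e exprVn sqr_sqrtr ?ltW // divff // gt_eqF. Qed.
Let LE : L = N ^+ m * e. Proof. by []. Qed.
Let L0 : 0 < L. Proof. by rewrite LE mulr_gt0 ?exprn_gt0. Qed.
Let Sn0 : (0 < #|{: 'S_n}|)%N. Proof. by rewrite card_Sn fact_gt0. Qed.

Let sum_q (F : 'S_n * {ffun 'I_k -> 'I_n} -> R) :
  \sum_j q j * F j =
  mean (fun t' => \sum_a occ_at R tau A s0 a t' * F (t', a)) / L.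
Proof.
rewrite mean.unlock -mulrA -invfM mulr_suml.
rewrite [RHS](eq_bigr (fun t' => \sum_a q (t', a) * F (t', a))).
  by rewrite pair_bigA; apply: eq_bigr => -[].
move=> t' _; rewrite mulr_suml; apply: eq_bigr => a _.
by rewrite /q /= mulrAC.
Qed.

Lemma centered_conj_stein : stein_family c e Z q M.
Proof.
split=> //.
- by rewrite /e invf_le1 ?sqrtr_gt0 // -sqrtr1 ler_wsqrtr // ler1n.
- by move=> j; rewrite divr_ge0 ?ler0n // mulr_ge0 ?ler0n // ltW.
- rewrite -[\sum_j q j](eq_bigr _ (fun j _ => mulr1 (q j))) (sum_q (fun=> 1)).
  apply: (@le_trans _ _ (e * (N ^+ m / L))).
    rewrite ler_wpM2l ?(ltW e0) // ler_wpM2r ?invr_ge0 ?(ltW L0) //.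
    rewrite -[leRHS](mean_cst _ Sn0); apply: ler_mean => t.
    under eq_bigr do rewrite mulr1.
    exact: sum_occ_at_le.
  rewrite LE mulrA [e * _]mulrC divff ?mulf_neq0 ?expf_neq0 ?gt_eqF //.
  by rewrite /c ler1n; lia.
- move=> j t; rewrite /Z /centered_conj -mulrBl opprB addrA subrK normrM.
  rewrite [Num.norm (_^-1)]gtr0_norm ?invr_gt0 // ler_pdivrMr //.
  have := occ_conj_resample R tau A s0 j.2 t j.1.
  rewrite -/(M j t) -/N => h.
  apply: (@le_trans _ _ ((8 * k ^ 2)%:R * N ^+ m * e ^+ 2)).
    by rewrite -[leLHS]mulr1 -[X in _ * X <= _]Ne mulrA ler_wpM2r ?exprn_ge0 ?(ltW e0).
  rewrite -/L LE [leRHS]mulrACA -[in leRHS]expr2.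
  rewrite ler_wpM2r ?exprn_ge0 ?(ltW e0) //.
  by rewrite ler_wpM2r ?exprn_ge0 ?(ltW N0) // ler_nat; lia.
- move=> h; rewrite sum_q.
  transitivity (mean (fun t => (occ_conj R tau A s0 t - mean (occ_conj R tau A s0))
      * h (Z t)) / L).
    by rewrite mulrC -meanZ; apply: eq_mean => t; rewrite /Z /centered_conj -/L; ring.
  congr (_ / _).
  have EX : occ_conj R tau A s0 =1 (fun t => \sum_a occ_at R tau A s0 a t).
    exact: occ_conjE.
  rewrite (eq_mean EX).
  under eq_mean do rewrite EX.
  rewrite (@resample_cov _ _ _ (support_seq s0) _ (fun t => h (Z t))); last first.
    by move=> a t t'; exact: occ_at_local.
  rewrite mean_sum; apply: eq_bigr => a _.
  rewrite mean.unlock -!mulr_suml; congr (_ / _).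
  rewrite exchange_big mulr_suml; apply: eq_bigr => t' _.
  by rewrite mulrA -mulr_sumr.
Qed.

Let U t := \sum_j q j * (Z (M j t) - Z t).

(** Dividing the Lipschitz bound by the squared scale [n ^ (2 m - 1)] leaves O([1 / n]), and
    [perm_variance_le] turns this into a variance of order [n * (1 / n) ^ 2 = e ^+ 2]. *)
Lemma centered_conj_kernel_variance :
  mean (fun t => (U t - mean U) ^+ 2) <= (c * e) ^+ 2.
Proof.
have UE t : U t = stein_kernel R tau A s0 t / L ^+ 2.
  rewrite /U (sum_q (fun j => Z (M j t) - Z t)) expr2 [(L * L)^-1]invfM mulrA; congr (_ / _).
  rewrite /stein_kernel mulrC -meanZ; apply: eq_mean => t'; rewrite mulr_sumr.
  by apply: eq_bigr => a _; rewrite /Z /centered_conj -/L /M /=; ring.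
have Ulip u v t : `|U (tperm u v * t)%g - U t| <= kernel_const%:R * e ^+ 2.
  rewrite !UE -mulrBl normrM [Num.norm (_^-1)]gtr0_norm ?invr_gt0 ?exprn_gt0 //.
  rewrite ler_pdivrMr ?exprn_gt0 //.
  have := stein_kernel_lipschitz R tau A s0 n0 t u v; rewrite -/kernel_const -/N => h.
  have E4 : e ^+ 4 * N ^+ 2 = 1.
    by rewrite (exprM e 2 2) -exprMn mulrC Ne expr1n.
  rewrite -[leLHS]mulr1 -[X in _ * X <= _]E4 mulrCA mulrC.
  rewrite (_ : kernel_const%:R * e ^+ 2 * L ^+ 2 =
               kernel_const%:R * N ^+ m * N ^+ m * e ^+ 4); last by rewrite LE; ring.
  by rewrite ler_wpM2r // exprn_ge0 // ltW.
apply: le_trans (perm_variance_le Ulip) _; rewrite -/N.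
rewrite (_ : N * (kernel_const%:R * e ^+ 2) ^+ 2 =
   (N * e ^+ 2) * (kernel_const%:R * e) ^+ 2); last by ring.
rewrite Ne mul1r lerXn2r ?nnegrE ?mulr_ge0 ?ler0n ?(ltW e0) //.
by rewrite ler_wpM2r ?(ltW e0) // ler_nat; lia.
Qed.

End FixedSize.

Lemma conj_moment_recursion r : exists C, forall n (s0 : 'S_n), (0 < n)%N ->
  `|mean (fun t => centered_conj s0 t ^+ r.+2)
    - r.+1%:R * mean (fun t => centered_conj s0 t ^+ 2)
      * mean (fun t => centered_conj s0 t ^+ r)| <= C / Num.sqrt n%:R.
Proof.
have [C HC] := stein_moment_recursion (ler0n _ _ : 0 <= c) r.
exists C => n s0 n0.
exact: HC (centered_conj_stein s0 n0) (centered_conj_kernel_variance s0 n0).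
Qed.

Lemma conj_variance_bound : exists2 C, 0 <= C & forall n (s0 : 'S_n), (0 < n)%N ->
  mean (fun t => centered_conj s0 t ^+ 2) <= C.
Proof.
have [C C0 HC] := stein_even_moment (ler0n _ _ : 0 <= c) 1.
exists C => // n s0 n0; exact: HC (centered_conj_stein s0 n0).
Qed.

Lemma mean_centered_conj n (s0 : 'S_n) : mean (centered_conj s0) = 0.
Proof.
rewrite /centered_conj; under eq_mean do rewrite mulrC.
rewrite meanZ meanB mean_cst ?subrr ?mulr0 //.
by rewrite card_Sn fact_gt0.
Qed.

End NormalizedConjugates.

(** * Expansion of sums over labels *)

Section OrderPatterns.
Variables (R : realFieldType) (I : finType) (B : {set I * I}).
Variable psi : {ffun I * I -> bool} -> R.

Definition adjacent_values (v : I -> nat) : bool :=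
  [forall p in B, v p.2 == (v p.1).+1].

Definition pattern_weight (v : I -> nat) : R :=
  (adjacent_values v)%:R * psi [ffun p => (v p.1 < v p.2)%N].

Lemma eq_pattern_weight v v' : v =1 v' -> pattern_weight v = pattern_weight v'.
Proof.
move=> vv; rewrite /pattern_weight; congr (_%:R * psi _).
  by congr nat_of_bool; apply: eq_forallb => p; rewrite !vv.
by apply/ffunP => p; rewrite !ffunE !vv.
Qed.

(** Making room for the value [j] preserves the order, and separates two consecutive values exactly
    when [j] is the upper one. *)
Lemma pattern_weight_bump j v : pattern_weight (fun i => bump j (v i)) =
  pattern_weight v * [forall p in B, v p.2 != j]%:R.
Proof.
rewrite /pattern_weight mulrAC -natrM mulnb; congr (_%:R * psi _); last first.
  by apply/ffunP => p; rewrite !ffunE /bump; lia.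
congr nat_of_bool; apply/forall_inP/andP => [H|[/forall_inP H1 /forall_inP H2] p pB].
  split; apply/forall_inP => p /H; rewrite /bump; [|apply: contraTN => /eqP].
    by lia.
  by move=> <-; lia.
by have := H1 p pB; have := H2 p pB; rewrite /bump; lia.
Qed.

(** The falling factorial compensates for the probability of [#|B|] adjacencies, which makes the
    quantity independent of [n]. *)
Definition mean_weight n (z : I -> 'I_n) : R :=
  (n ^_ #|B|)%:R * mean (fun t : 'S_n => pattern_weight (fun i => t (z i))).

Lemma mean_weight_lift n (x : 'I_n.+1) (z : I -> 'I_n) :
  {in B &, injective (fun p => (z p.1, z p.2))} ->
  mean_weight (fun i => lift x (z i)) = mean_weight z.
Proof.
move=> zB; rewrite /mean_weight (mean_lift_perm x).
have -> : mean (fun j => mean (fun s => pattern_weight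
      (fun i => lift_perm x j s (lift x (z i))))) =
    (n.+1%:R - #|B|%:R) / n.+1%:R *
    mean (fun t : 'S_n => pattern_weight (fun i => t (z i))).
  rewrite mean.unlock card_ord -mulr_suml exchange_big /=.
  suff -> : \sum_s \sum_(j < n.+1) pattern_weight
        (fun i => lift_perm x j s (lift x (z i))) =
      (n.+1%:R - #|B|%:R) * \sum_(s : 'S_n) pattern_weight (fun i => s (z i)).
    by ring.
  rewrite mulr_sumr; apply: eq_bigr => s _; rewrite [RHS]mulrC.
  under eq_bigr => j _.
    rewrite (@eq_pattern_weight _ (fun i => bump j (s (z i)))); last first.
      by move=> i; rewrite lift_perm_lift.
    rewrite pattern_weight_bump; over.
  rewrite -mulr_sumr.
  have [v1|v0] := boolP (adjacent_values (fun i => s (z i))); last first.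
    by rewrite /pattern_weight (negPf v0) !mul0r.
  congr (_ * _).
  (* Since the adjacencies hold, the upper value of a pair determines the lower one; hence distinct
     pairs have distinct upper values, and [#|B|] of the [n.+1] insertions are forbidden. *)
  have vB : {in B &, injective (fun p => lift ord_max (s (z p.2)))}.
    move=> p q pB qB /lift_inj/perm_inj pq; apply: zB => //; congr pair => //.
    apply: (@perm_inj _ s); apply: val_inj; apply: succn_inj.
    by move/forall_inP: v1 => v1; rewrite -(eqP (v1 p pB)) -(eqP (v1 q qB)) pq.
  rewrite -natr_sum; have -> : (\sum_(j < n.+1) [forall p in B, s (z p.2) != j :> nat])%N =
      #|~: [set lift ord_max (s (z p.2)) | p in B]|.
    rewrite -sum1_card [RHS]big_mkcond /=; apply: eq_bigr => j _.
    rewrite inE; case: ifPn => [H|].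
      suff -> : [forall p in B, s (z p.2) != j :> nat] by [].
      apply/forall_inP => p pB; apply: contraNneq H => pj.
      by apply/imsetP; exists p => //; apply: ord_inj; rewrite lift_max.
    rewrite negbK => /imsetP[p pB ->]; rewrite (_ : [forall _ in _, _] = false) //.
    by apply/forall_inP => /(_ p pB); rewrite lift_max eqxx.
  by rewrite cardsCs setCK card_in_imset // card_ord natrB // -(card_in_imset vB)
    (leq_trans (max_card _)) // card_ord.
rewrite mulrA; congr (_ * _).
have [bn|bn] := leqP #|B| n.+1; last by rewrite !ffact_small // ?mul0r //; lia.
by rewrite mulrA -natrB // -natrM -ffactnSr ffactSS natrM mulrC mulKf // pnatr_eq0.
Qed.

Lemma mean_weight_perm n (f : 'S_n) (z : I -> 'I_n) :
  mean_weight (fun i => f (z i)) = mean_weight z.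
Proof.
congr (_ * _).
rewrite -[RHS](mean_reindex (fun t : 'S_n => pattern_weight (fun i => t (z i))) (mulgI f)).
by apply: eq_mean => t; apply: eq_pattern_weight => i; rewrite permM.
Qed.

Lemma mean_weight_same_kernel n n' (z : I -> 'I_n) (z' : I -> 'I_n') :
  {in B &, injective (fun p => (z p.1, z p.2))} ->
  (forall i j, (z i == z j) = (z' i == z' j)) ->
  mean_weight z = mean_weight z'.
Proof.
have [N] := ubnP (n + n'); elim: N n n' z z' => // N IH n n' z z' nN zB zz'.
have zB' : {in B &, injective (fun p => (z' p.1, z' p.2))}.
  move=> p q pB qB [/eqP + /eqP]; rewrite -!zz' => /eqP e1 /eqP e2.
  by apply: zB => //=; rewrite e1 e2.
have sub (k : nat) (u : I -> 'I_k.+1) x : x \notin codom u ->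
    exists w : I -> 'I_k, u =1 (fun i => lift x (w i)).
  move=> xu; have ux i : x != u i by apply: contraNneq xu => ->; exact: codom_f.
  by exists (fun i => s2val (unlift_some (ux i))) => i; exact: s2valP (unlift_some (ux i)).
have lift_weight (k : nat) (u : I -> 'I_k.+1) (x : 'I_k.+1) (w : I -> 'I_k) :
    u =1 (fun i => lift x (w i)) -> mean_weight u = mean_weight (fun i => lift x (w i)).
  by move=> uw; congr (_ * _); apply: eq_mean => t; apply: eq_pattern_weight => i; rewrite uw.
have [/forallP onto|/forallPn[x xz]] := boolP [forall y, y \in codom z]; last first.
  case: n x z nN zB zz' xz => [[//]|n] x z nN zB zz' /sub[w zw].
  have ker i j : (w i == w j) = (z i == z j) by rewrite !zw (inj_eq lift_inj).
  have wB : {in B &, injective (fun p => (w p.1, w p.2))}.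
    move=> p q pB qB [/eqP + /eqP]; rewrite !ker => /eqP e1 /eqP e2.
    by apply: zB => //=; rewrite e1 e2.
  rewrite (lift_weight _ _ _ _ zw) mean_weight_lift //; apply: IH => // i j.
  by rewrite ker zz'.
have [/forallP onto'|/forallPn[x xz]] := boolP [forall y, y \in codom z']; last first.
  case: n' x z' nN zB' zz' xz => [[//]|n'] x z' nN zB' zz' /sub[w zw].
  have ker i j : (w i == w j) = (z' i == z' j) by rewrite !zw (inj_eq lift_inj).
  have wB : {in B &, injective (fun p => (w p.1, w p.2))}.
    move=> p q pB qB [/eqP + /eqP]; rewrite !ker => /eqP e1 /eqP e2.
    by apply: zB' => //=; rewrite e1 e2.
  rewrite (lift_weight _ _ _ _ zw) mean_weight_lift //; apply: IH => // [|i j].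
    by lia.
  by rewrite ker zz'.
pose f y := z' (iinv (onto y)); pose f' y := z (iinv (onto' y)).
have fz i : f (z i) = z' i by apply/eqP; rewrite /f -zz' f_iinv.
have f'z i : f' (z' i) = z i by apply/eqP; rewrite /f' zz' f_iinv.
have fK : cancel f f' by move=> y; rewrite -(f_iinv (onto y)) fz f'z.
have f'K : cancel f' f by move=> y; rewrite -(f_iinv (onto' y)) f'z fz.
have nn' : n = n'.
  by have := bij_eq_card (Bijective fK f'K); rewrite !card_ord.
move: nn' f f' fz f'z fK f'K => nn'; move: z' zz' zB' onto'; rewrite -nn'.
move=> u zu uB _ f f' fz _ fK _; rewrite -(mean_weight_perm (perm (can_inj fK))).
by congr (_ * _); apply: eq_mean => t; apply: eq_pattern_weight => i; rewrite permE fz.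
Qed.

Definition kernel_of n (z : I -> 'I_n) : {ffun I * I -> bool} :=
  [ffun p => z p.1 == z p.2].

(* The weight is independent of [n], so that [k] may be evaluated on labels taken
   in ['I_#|I|]. *)
Lemma mean_weight_kernel : exists kappa : {ffun I * I -> bool} -> R,
  forall n (z : I -> 'I_n), {in B &, injective (fun p => (z p.1, z p.2))} ->
  mean_weight z = kappa (kernel_of z).
Proof.
pose rep (e : {ffun I * I -> bool}) i : 'I_#|I| :=
  enum_rank (odflt i [pick j | e (j, i)]).
exists (fun e => mean_weight (rep e)) => n z zB.
apply: mean_weight_same_kernel => // i j; rewrite (inj_eq enum_rank_inj).
pose r i := odflt i [pick j | kernel_of z (j, i)].
have rz l : z (r l) = z l.
  rewrite /r; case: pickP => [l' /=|/(_ l)]; last by rewrite ffunE eqxx.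
  by rewrite ffunE => /eqP.
apply/eqP/eqP => [zij|/(congr1 z)]; last by rewrite -/(r i) -/(r j) !rz.
have -> : [pick l | kernel_of z (l, j)] = [pick l | kernel_of z (l, i)].
  by apply: eq_pick => l; rewrite !ffunE zij.
by case: pickP => [l|/(_ i)] //=; rewrite ffunE eqxx.
Qed.

End OrderPatterns.

Section Update.
Variables (I T : finType).
Implicit Types (c : {ffun I -> T}).

Definition update c i x : {ffun I -> T} := [ffun j => if j == i then x else c j].

Lemma update_id c i x : update c i x i = x.
Proof. by rewrite ffunE eqxx. Qed.

Lemma update_neq c i x j : j != i -> update c i x j = c j.
Proof. by move=> /negPf ji; rewrite ffunE ji. Qed.

(** Frees one coordinate without changing the index type; the involution [h] exchanges the old and
    the new value at [i]. *)
Lemma sum_update (R : nzRingType) (F : {ffun I -> T} -> R) i :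
  #|T|%:R * \sum_c F c = \sum_c \sum_x F (update c i x).
Proof.
rewrite pair_bigA /=.
pose h (p : {ffun I -> T} * T) := (update p.1 i p.2, p.1 i).
have hK : involutive h.
  move=> [c x]; rewrite /h /= update_id; congr pair.
  by apply/ffunP => j; rewrite !ffunE; case: eqP => [->|].
rewrite [RHS](reindex_inj (inv_inj hK)) /=.
rewrite -(pair_bigA _ (fun c x => F (update (update c i x) i (c i)))) /= mulr_sumr.
apply: eq_bigr => c _; rewrite (eq_bigr (fun=> F c)) ?sumr_const ?mulr_natl //.
move=> x _; congr F; apply/ffunP => j; rewrite !ffunE.
by case: eqP => [->|].
Qed.

End Update.

(** * Coincidences between labels and their images *)

Section Conflicts.
Variables (n : nat) (s : 'S_n).
Implicit Types x y : 'I_n.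

Definition conflict x y : bool := [|| x == y, s x == y | s y == x].

Definition conflict_kind x y : bool * bool * bool := (x == y, s x == y, s y == x).

Lemma conflictC x y : conflict x y = conflict y x.
Proof. by rewrite /conflict [x == y]eq_sym; congr (_ || _); rewrite orbC. Qed.

Lemma card_conflict x : (\sum_y conflict x y <= 3)%N.
Proof.
have sum_eq1 z : (\sum_(y < n) (y == z) = 1)%N.
  by rewrite (bigD1 z) //= eqxx big1 // => y /negPf ->.
apply: (@leq_trans (\sum_(y < n) ((y == x) + ((y == s x) + (y == (s^-1)%g x))))%N).
  apply: leq_sum => y _; rewrite /conflict [s y == x](can2_eq (permK s) (permKV s)).
  by rewrite [x == y]eq_sym [s x == y]eq_sym; do 3!case: (y == _).
by rewrite !big_split /= !sum_eq1.
Qed.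

(** The labels in conflict with [x] are [x], [s x] and its preimage. All three coincide at a fixed
    point and the last two coincide on a 2-cycle; this is the only place where 2-cycles are
    distinguished from longer cycles. *)
Lemma sum_conflict (R : realFieldType) (h : bool -> bool -> bool * bool * bool -> R) :
  let m1 := #|[set x | s x == x]|%:R in
  let m2 := #|[set x | (s x != x) && (s (s x) == x)]|%:R in
  \sum_x \sum_y (conflict x y)%:R * h (s x == x) (s y == y) (conflict_kind x y) =
  m1 * h true true (true, true, true)
  + (n%:R - m1) * h false false (true, false, false)
  + m2 * h false false (false, true, true)
  + (n%:R - m1 - m2) * (h false false (false, true, false) + h false false (false, false, true)).
Proof.
move=> m1 m2.
pose g x : R := (s x == x)%:R * h true true (true, true, true)
  + (s x != x)%:R * h false false (true, false, false)
  + ((s x != x) && (s (s x) == x))%:R * h false false (false, true, true)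
  + ((s x != x) && (s (s x) != x))%:R *
     (h false false (false, true, false) + h false false (false, false, true)).
have count (P : pred 'I_n) : \sum_(x < n) (P x)%:R = #|[set x | P x]|%:R :> R.
  by rewrite -sum1dep_card natr_sum [RHS]big_mkcond /=; apply: eq_bigr => x _; case: (P x).
have countN (P Q : pred 'I_n) (a : R) : (forall x, (P x)%:R = 1 - (Q x)%:R :> R) ->
    #|[set x | Q x]|%:R = a -> \sum_(x < n) (P x)%:R = n%:R - a.
  move=> PQ <-; under eq_bigr do rewrite PQ.
  by rewrite sumrB count sumr_const card_ord.
transitivity (\sum_x g x); last first.
  rewrite /g !big_split /= -!mulr_suml !count -/m1 -/m2; congr (_ + _ * _ + _ + _ * _).
    by rewrite -count (countN _ (fun x => s x == x) m1) // => x /=; case: (s x == x) => /=; lra.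
  rewrite -count.
  rewrite (eq_bigr (fun x => (s x != x)%:R - ((s x != x) && (s (s x) == x))%:R)).
    rewrite sumrB; congr (_ - _); last exact: count.
    by rewrite (countN _ (fun x => s x == x) m1) // => x /=; case: (s x == x) => /=; lra.
  by move=> x _; case: (s x == x); case: (s (s x) == x) => /=; lra.
apply: eq_bigr => x _.
have V : (s ((s^-1)%g x) == x) by rewrite permKV.
have out y : y != x -> y != s x -> y != (s^-1)%g x -> conflict x y = false.
  move=> yx ysx ysVx; rewrite /conflict eq_sym (negPf yx) eq_sym (negPf ysx).
  by rewrite [s y == x](can2_eq (permK s) (permKV s)) (negPf ysVx).
have cx : conflict x x by rewrite /conflict eqxx.
have kx : conflict_kind x x = (true, s x == x, s x == x) by rewrite /conflict_kind eqxx.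
rewrite /g (bigD1 x) //= cx kx.
have [sx|sx] := eqVneq (s x) x.
  rewrite big1 ?addr0 ?mul0r ?mul1r ?addr0 //.
  by move=> y yx; rewrite out ?mul0r ?sx // -{1}sx permK.
have csx : conflict x (s x) by rewrite /conflict eqxx orbT.
have ksx : conflict_kind x (s x) = (false, true, s (s x) == x).
  by rewrite /conflict_kind eqxx eq_sym (negPf sx).
have ssx : (s (s x) == s x) = false by rewrite (inj_eq perm_inj) (negPf sx).
rewrite (bigD1 (s x)) //= csx ksx ssx.
have [ssx2|ssx2] := eqVneq (s (s x)) x.
  rewrite big1 ?addr0 ?mul0r ?mul1r ?addr0 ?add0r //.
  by move=> y /andP[yx ysx]; rewrite out ?mul0r // -{1}ssx2 permK.
have Vx : (s^-1)%g x != x by rewrite -(inj_eq (@perm_inj _ s)) permKV eq_sym.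
have Vsx : (s^-1)%g x != s x by rewrite -(inj_eq (@perm_inj _ s)) permKV eq_sym.
have cV : conflict x ((s^-1)%g x) by rewrite /conflict V !orbT.
have kV : conflict_kind x ((s^-1)%g x) = (false, false, true).
  by rewrite /conflict_kind V ![_ == (s^-1)%g x]eq_sym (negPf Vx) (negPf Vsx).
rewrite (bigD1 ((s^-1)%g x)) ?Vx //= cV kV permKV [x == _]eq_sym (negPf Vx).
rewrite big1 ?addr0 ?mul0r ?mul1r ?addr0 ?add0r ?addrA //.
by move=> y /andP[/andP[yx ysx] yV]; rewrite out ?mul0r.
Qed.

End Conflicts.

Definition fixed_ratio (R : realFieldType) n (s : 'S_n) : R :=
  #|[set x | s x == x]|%:R / n%:R.

(* Counts points, hence converges to twice [p2]. *)
Definition two_cycle_ratio (R : realFieldType) n (s : 'S_n) : R :=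
  #|[set x | (s x != x) && (s (s x) == x)]|%:R / n%:R.

Definition pair_type (I : finType) n (s : 'S_n) (c : {ffun I -> 'I_n}) :
    {ffun I * I -> bool * bool} :=
  [ffun p => (c p.1 == c p.2, s (c p.1) == c p.2)].

Section TypeSums.
Variables (R : realFieldType) (I : finType).
Variable Gam : {ffun I * I -> bool * bool} -> R.
Local Notation kind := (bool * bool * bool)%type.

Definition pair_lt (p : I * I) : bool := (enum_rank p.1 < enum_rank p.2)%N.

Lemma pair_lt_neq p : pair_lt p -> p.1 != p.2.
Proof. by apply: contraTneq => e; rewrite /pair_lt e ltnn. Qed.

Lemma pair_lt_total (p : I * I) : p.1 != p.2 -> pair_lt p || pair_lt (p.2, p.1).
Proof.
by move=> p12; rewrite /pair_lt /= -neq_ltn (inj_eq val_inj) (inj_eq enum_rank_inj).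
Qed.

Definition free_type (F : {ffun I -> bool}) : {ffun I * I -> bool * bool} :=
  [ffun p => (p.1 == p.2, (p.1 == p.2) && F p.1)].

Definition one_conflict_type (F : {ffun I -> bool}) (p : I * I) (kd : kind) :
    {ffun I * I -> bool * bool} :=
  [ffun q => if q == p then kd.1 else if q == (p.2, p.1) then (kd.1.1, kd.2)
             else free_type F q].

Section FixedSize.
Variables (n : nat) (s : 'S_n).
Implicit Types c : {ffun I -> 'I_n}.

Definition fixed_pattern c : {ffun I -> bool} := [ffun i => s (c i) == c i].

Definition conflict_at c (p : I * I) : bool := conflict s (c p.1) (c p.2).

Lemma pair_type_one_conflict c p :
  (forall q, pair_lt q -> conflict_at c q -> q = p) -> p.1 != p.2 ->
  pair_type s c = one_conflict_type (fixed_pattern c) p (conflict_kind s (c p.1) (c p.2)).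
Proof.
move=> cp p12; apply/ffunP => -[i j]; rewrite !ffunE /=.
have [<- //|ijp] := eqVneq (i, j) p.
have [[-> ->]|ijp'] := eqVneq (i, j) (p.2, p.1); first by rewrite [c p.2 == _]eq_sym.
have [<-|ij] := eqVneq i j; first by rewrite !eqxx.
have : ~~ conflict s (c i) (c j).
  have /orP[lt|lt] := @pair_lt_total (i, j) ij.
    by apply: contraNN ijp => cij; rewrite -(cp (i, j)).
  rewrite conflictC; apply: contraNN ijp' => cij; rewrite -(cp (j, i)) //.
by rewrite /conflict !negb_or => /and3P[n1 n2 _]; rewrite (negPf n1) (negPf n2).
Qed.

Lemma pair_type_free c :
  (forall q, pair_lt q -> ~~ conflict_at c q) ->
  pair_type s c = free_type (fixed_pattern c).
Proof.
move=> cp; apply/ffunP => -[i j]; rewrite !ffunE /=.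
have [<-|ij] := eqVneq i j; first by rewrite !eqxx.
have : ~~ conflict s (c i) (c j).
  have /orP[lt|lt] := @pair_lt_total (i, j) ij; first exact: (cp (i, j)).
  by rewrite conflictC; exact: (cp (j, i)).
by rewrite /conflict !negb_or => /and3P[n1 n2 _]; rewrite (negPf n1) (negPf n2).
Qed.

Definition first_order c (p : I * I) : R :=
  Gam (one_conflict_type (fixed_pattern c) p (conflict_kind s (c p.1) (c p.2)))
  - Gam (free_type (fixed_pattern c)).

(** With at most one conflicting pair the first-order formula is exact. Otherwise the right-hand
    side counts at least one pair of conflicts, and the left-hand side is at most a sum of
    [1 + #|{: I * I}|] differences of two values of [Gam]. *)
Lemma first_order_error c :
  `|Gam (pair_type s c) - Gam (free_type (fixed_pattern c))
    - \sum_(p | pair_lt p) (conflict_at c p)%:R * first_order c p|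
  <= (\sum_T `|Gam T|) * (2 + 2 * #|{: I * I}|%:R) *
     \sum_(p | pair_lt p) \sum_(q | pair_lt q && (q != p))
        (conflict_at c p && conflict_at c q)%:R.
Proof.
set G := \sum_T _; have GT T : `|Gam T| <= G.
  by rewrite /G (bigD1 T) //= lerDl sumr_ge0.
have G0 : 0 <= G by apply: sumr_ge0.
have D0 : 0 <= 2 + 2 * #|{: I * I}|%:R :> R by rewrite addr_ge0 ?mulr_ge0 ?ler0n.
have err0 : 0 <= \sum_(p | pair_lt p) \sum_(q | pair_lt q && (q != p))
        (conflict_at c p && conflict_at c q)%:R :> R.
  by apply: sumr_ge0 => p _; apply: sumr_ge0 => q _; rewrite ler0n.
have GD0 : 0 <= G * (2 + 2 * #|{: I * I}|%:R) by rewrite mulr_ge0.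
have [|nc] := boolP [exists p, pair_lt p && conflict_at c p]; last first.
  have nc' q : pair_lt q -> ~~ conflict_at c q.
    by move=> lq; move/existsPn: nc => /(_ q); rewrite lq.
  rewrite pair_type_free // subrr big1 ?subrr ?normr0 ?mulr_ge0 //.
  by move=> p /nc' /negPf ->; rewrite mul0r.
move=> /existsP[p /andP[lp cp]].
have [|nq] := boolP [exists q, [&& pair_lt q, q != p & conflict_at c q]]; last first.
  have nq' q : pair_lt q -> q != p -> ~~ conflict_at c q.
    by move=> lq qp; move/existsPn: nq => /(_ q); rewrite lq qp.
  rewrite (@pair_type_one_conflict c p); last 2 first.
  - by move=> q lq cq; apply/eqP; apply: contraTT cq => /(nq' _ lq).
  - exact: pair_lt_neq.
  rewrite (bigD1 p) //= cp mul1r big1 ?addr0 ?subrr ?normr0 ?mulr_ge0 //.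
  by move=> q /andP[lq /(nq' _ lq) /negPf ->]; rewrite mul0r.
move=> /existsP[q /and3P[lq qp cq]].
apply: (@le_trans _ _ (G * (2 + 2 * #|{: I * I}|%:R))).
  rewrite mulrDr; apply: le_trans (ler_normB _ _) _; apply: lerD.
    by apply: le_trans (ler_normB _ _) _; rewrite mulrDr mulr1 lerD.
  apply: le_trans (ler_norm_sum _ _ _) _.
  apply: (@le_trans _ _ (\sum_(p : I * I) (G * 2))).
    rewrite [leLHS]big_mkcond /=; apply: ler_sum => r _.
    case: ifP => _; last by rewrite mulr_ge0.
    rewrite normrM normr_nat (@le_trans _ _ `|first_order c r|) //.
      by rewrite ler_piMl // lern1 leq_b1.
    by apply: le_trans (ler_normB _ _) _; rewrite mulrDr mulr1 lerD.
  by rewrite sumr_const -[leLHS]mulr_natr -mulrA.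
rewrite -[leLHS]mulr1 ler_wpM2l // (bigD1 p) //= (bigD1 q) ?lq //= cp cq -addrA lerDl.
rewrite addr_ge0 // sumr_ge0 // => r _; rewrite ?ler0n //.
by apply: sumr_ge0 => r' _; rewrite ler0n.
Qed.

Lemma sum_two_conflicts p q : pair_lt p -> pair_lt q -> q != p ->
  n%:R ^+ 2 * \sum_c (conflict_at c p && conflict_at c q)%:R <= 9 * n%:R ^+ #|I| :> R.
Proof.
move=> lp lq qp; have p12 := pair_lt_neq lp; have q12 := pair_lt_neq lq.
(* Two distinct increasing pairs cannot have the same ends, so [q] has an end [t] outside [p]. The
   conflict at [q] leaves at most 3 choices for the label of [t], then the conflict at [p] at most 3
   for that of [p.1]. *)
have [t [o [ot tp1 tp2 cq]]] : exists t o, [/\ o != t, p.1 != t, p.2 != t &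
    forall c, conflict_at c q = conflict s (c o) (c t)].
  have [/andP[h1 h2]|] := boolP ((p.1 != q.1) && (p.2 != q.1)).
    exists q.1, q.2; split=> // [|c]; first by rewrite eq_sym.
    by rewrite /conflict_at conflictC.
  rewrite negb_and !negbK => H.
  exists q.2, q.1; split => //.
  - case/orP: H => /eqP e; last first.
      apply: contraTneq lq => e'; rewrite /pair_lt -e -e' -leqNgt ltnW //.
    apply: contraNneq p12 => e'; move: q12; rewrite -e -e' => /eqP //.
  - case/orP: H => /eqP e; last by rewrite e.
    apply: contraNneq qp => e'.
    by rewrite [p]surjective_pairing [q]surjective_pairing e e'.
rewrite expr2 -mulrA -[n in n%:R * \sum_c _](card_ord n) (sum_update _ t).
rewrite -[n in n%:R * _](card_ord n) (sum_update _ p.1).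
apply: (@le_trans _ _ (\sum_(c : {ffun I -> 'I_n}) 9)); last first.
  by rewrite sumr_const card_ffun card_ord -natrX mulr_natr.
apply: ler_sum => c _.
apply: (@le_trans _ _ (\sum_x (conflict s (c p.2) x)%:R * 3)); last first.
  rewrite -mulr_suml (_ : 9 = 3 * 3); last by ring.
  by rewrite ler_wpM2r // -natr_sum ler_nat card_conflict.
apply: ler_sum => x _.
under eq_bigr => y _.
  rewrite cq /conflict_at (update_neq _ _ tp1) (update_neq _ _ tp2) update_id.
  rewrite (update_neq _ _ ot) update_id update_neq 1?eq_sym //.
  rewrite conflictC -mulnb natrM; over.
rewrite -mulr_sumr ler_wpM2l // -natr_sum ler_nat; exact: card_conflict.
Qed.

Local Notation m1 := (#|[set x | s x == x]|%:R : R).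
Local Notation m2 := (#|[set x | (s x != x) && (s (s x) == x)]|%:R : R).

Lemma sum_fixed_pattern (L : {ffun I -> bool} -> R) :
  \sum_c L (fixed_pattern c) = \sum_F L F * \prod_i (if F i then m1 else n%:R - m1).
Proof.
rewrite (partition_big fixed_pattern xpredT) //=; apply: eq_bigr => F _.
rewrite (eq_bigr (fun=> L F)) => [|c /eqP -> //].
rewrite sumr_const -[LHS]mulr_natr; congr (_ * _).
have -> : #|[pred c | fixed_pattern c == F]| =
    #|family (fun i => [pred x | (s x == x) == F i])|.
  apply: eq_card => c; rewrite !inE; apply/eqP/familyP => [<- i|H].
    by rewrite inE ffunE.
  by apply/ffunP => i; rewrite ffunE; have := H i; rewrite inE => /eqP.
rewrite card_family foldrE big_map big_enum /= natr_prod; apply: eq_bigr => i _.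
case: (F i).
  by rewrite cardsE; congr _%:R; apply: eq_card => x; rewrite -!topredE /= eqb_id.
have E := cardC [pred x | s x == x]; rewrite card_ord in E.
have -> : n%:R = (#|[pred x | s x == x]| + #|[predC [pred x | s x == x]]|)%:R :> R by rewrite E.
rewrite cardsE natrD addrAC subrr add0r.
by congr _%:R; apply: eq_card => x; rewrite -!topredE /= eqbF_neg.
Qed.

(** Two labels in conflict are both fixed points or both not, so a single flag [b] overwrites the
    fixed pattern at the two freed coordinates. *)
Lemma sum_one_conflict (H : {ffun I -> bool} -> kind -> R) (p : I * I) :
  p.1 != p.2 ->
  let h F b kd := H (update (update F p.1 b) p.2 b) kd in
  n%:R ^+ 2 * \sum_c (conflict_at c p)%:R *
     H (fixed_pattern c) (conflict_kind s (c p.1) (c p.2)) =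
  \sum_F (m1 * h F true (true, true, true)
    + (n%:R - m1) * h F false (true, false, false)
    + m2 * h F false (false, true, true)
    + (n%:R - m1 - m2) * (h F false (false, true, false) + h F false (false, false, true)))
   * \prod_i (if F i then m1 else n%:R - m1).
Proof.
move=> p12 h; rewrite -sum_fixed_pattern.
rewrite expr2 -mulrA -[n in n%:R * \sum_c _](card_ord n) (sum_update _ p.2).
rewrite -[n in n%:R * _](card_ord n) (sum_update _ p.1).
apply: eq_bigr => c _.
rewrite -(@sum_conflict n s R (fun b b' kd =>
  H (update (update (fixed_pattern c) p.1 b) p.2 b') kd)).
apply: eq_bigr => x _; apply: eq_bigr => y _.
rewrite /conflict_at update_id update_neq // update_id; congr (_ * H _ _).
by apply/ffunP => i; rewrite !ffunE; case: (i == p.2) => //; case: (i == p.1).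
Qed.

End FixedSize.

Definition fixed_poly (F : {ffun I -> bool}) : {poly R} :=
  \prod_i (if F i then 'X else 1 - 'X).

Lemma horner_fixed_poly n (s : 'S_n) (F : {ffun I -> bool}) : (0 < n)%N ->
  \prod_i (if F i then #|[set x | s x == x]|%:R else n%:R - #|[set x | s x == x]|%:R) =
  n%:R ^+ #|I| * (fixed_poly F).[fixed_ratio R s].
Proof.
move=> n0; transitivity (\prod_i (n%:R *
    (if F i then 'X else 1 - 'X).[fixed_ratio R s])); last first.
  by rewrite big_split /= prodr_const /fixed_poly horner_prod.
have nn : n%:R != 0 :> R by rewrite pnatr_eq0 -lt0n.
apply: eq_bigr => i _; rewrite /fixed_ratio; case: (F i).
  by rewrite hornerX mulrC divfK.
rewrite hornerD hornerN hornerX -(polyC1 R) hornerC mulrBr mulr1.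
by rewrite [n%:R * (_ / _)]mulrC divfK.
Qed.

Lemma sum_pair_type_expansion : exists (al be ga : {poly R}) (C : R),
  forall n (s : 'S_n), (0 < n)%N ->
  `|\sum_(c : {ffun I -> 'I_n}) Gam (pair_type s c)
    - n%:R ^+ #|I| * (al.[fixed_ratio R s]
      + (be.[fixed_ratio R s] + two_cycle_ratio R s * ga.[fixed_ratio R s]) / n%:R)|
  <= C * n%:R ^+ #|I| / n%:R ^+ 2.
Proof.
pose h p F b kd : R := Gam (one_conflict_type (update (update F p.1 b) p.2 b) p kd)
  - Gam (free_type (update (update F p.1 b) p.2 b)).
pose h1 p F := h p F true (true, true, true).
pose h2 p F := h p F false (true, false, false).
pose h3 p F := h p F false (false, true, true).
pose h45 p F := h p F false (false, true, false) + h p F false (false, false, true).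
exists (\sum_F Gam (free_type F) *: fixed_poly F).
exists (\sum_(p | pair_lt p) \sum_F
   (h1 p F *: 'X + (h2 p F + h45 p F) *: (1 - 'X)) * fixed_poly F).
(* In [sum_one_conflict], the 2-cycle count multiplies [h3 - h45]: a 2-cycle replaces two one-sided
   conflicts by a two-sided one. *)
exists (\sum_(p | pair_lt p) \sum_F (h3 p F - h45 p F) *: fixed_poly F).
pose D := (\sum_T `|Gam T|) * (2 + 2 * #|{: I * I}|%:R).
exists (D * \sum_(p | pair_lt p) \sum_(q | pair_lt q && (q != p)) 9).
move=> n s n0; set x := fixed_ratio R s; have nn : n%:R != 0 :> R by rewrite pnatr_eq0 -lt0n.
have np : 0 < n%:R :> R by rewrite ltr0n.
set z := two_cycle_ratio R s.
have main : n%:R ^+ #|I| * (((\sum_F Gam (free_type F) *: fixed_poly F)).[x] +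
   ((\sum_(p | pair_lt p) \sum_F
   (h1 p F *: 'X + (h2 p F + h45 p F) *: (1 - 'X)) * fixed_poly F).[x] + z *
   (\sum_(p | pair_lt p) \sum_F (h3 p F - h45 p F) *: fixed_poly F).[x]) / n%:R) =
  \sum_(c : {ffun I -> 'I_n}) (Gam (free_type (fixed_pattern s c))
    + \sum_(p | pair_lt p) (conflict_at s c p)%:R * first_order s c p).
  rewrite big_split /= mulrDr; congr (_ + _).
    rewrite (sum_fixed_pattern s (fun F => Gam (free_type F))) horner_sum mulr_sumr.
    by apply: eq_bigr => F _; rewrite hornerZ horner_fixed_poly //; ring.
  rewrite [RHS]exchange_big /= !horner_sum mulr_sumr -big_split /= mulr_suml mulr_sumr.
  apply: eq_bigr => p lp.
  apply: (mulfI (_ : n%:R ^+ 2 != 0)); first by rewrite expf_neq0.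
  rewrite (sum_one_conflict s (fun F kd => Gam (one_conflict_type F p kd)
     - Gam (free_type F)) (pair_lt_neq lp)).
  rewrite !horner_sum mulr_sumr -big_split /= mulr_suml !mulr_sumr.
  apply: eq_bigr => F _; rewrite horner_fixed_poly // -/x.
  rewrite !(hornerZ, hornerD, hornerM, hornerN, hornerX) -(polyC1 R) hornerC.
  have -> : #|[set x | s x == x]|%:R = n%:R * x by rewrite mulrC divfK.
  have -> : #|[set x | (s x != x) && (s (s x) == x)]|%:R = n%:R * z.
    by rewrite mulrC divfK.
  rewrite /h45 /h3 /h2 /h1 /h.
  move: (n%:R ^+ #|I|) ((fixed_poly F).[x]) => a b.
  by move: n%:R nn => N nN; field.
rewrite main -sumrB; apply: le_trans (ler_norm_sum _ _ _) _.
rewrite ler_pdivlMr ?exprn_gt0 //.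
apply: (@le_trans _ _ ((\sum_c (D * \sum_(p | pair_lt p) \sum_(q | pair_lt q && (q != p))
        (conflict_at s c p && conflict_at s c q)%:R)) * n%:R ^+ 2)).
  rewrite ler_wpM2r ?exprn_ge0 // ler_sum // => c _; rewrite opprD addrA.
  exact: first_order_error.
have D0 : 0 <= D by rewrite mulr_ge0 ?sumr_ge0 // addr_ge0 // mulr_ge0.
rewrite -mulr_sumr -mulrA -[leRHS]mulrA ler_wpM2l //.
rewrite exchange_big !mulr_suml /=; apply: ler_sum => p lp.
rewrite exchange_big !mulr_suml /=; apply: ler_sum => q /andP[lq qp].
by rewrite mulrC sum_two_conflicts.
Qed.

End TypeSums.

(** * Two-term expansions in 1/n and their algebra *)

Section Expansions.
Variable R : realFieldType.

Definition expansion (al be ga : {poly R}) n (s : 'S_n) : R :=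
  al.[fixed_ratio R s]
  + (be.[fixed_ratio R s] + two_cycle_ratio R s * ga.[fixed_ratio R s]) / n%:R.

Definition has_expansion (M : nat) (F : forall n, 'S_n -> R) (al be ga : {poly R}) :=
  exists C n0, forall n (s : 'S_n), (0 < n)%N -> (n0 <= n)%N ->
    `|F n s / n%:R ^+ M - expansion al be ga s| <= C / n%:R ^+ 2.

Definition expandable M F := exists al be ga, has_expansion M F al be ga.

Lemma fixed_ratio_itv n (s : 'S_n) : 0 <= fixed_ratio R s <= 1.
Proof.
rewrite /fixed_ratio divr_ge0 //=; have [n0|n0] := posnP n.
  have -> : n%:R = 0 :> R by rewrite n0.
  by rewrite invr0 mulr0.
by rewrite ler_pdivrMr ?ltr0n // mul1r ler_nat (leq_trans (max_card _)) // card_ord.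
Qed.

Lemma two_cycle_ratio_itv n (s : 'S_n) : 0 <= two_cycle_ratio R s <= 1.
Proof.
rewrite /two_cycle_ratio divr_ge0 //=; have [n0|n0] := posnP n.
  have -> : n%:R = 0 :> R by rewrite n0.
  by rewrite invr0 mulr0.
by rewrite ler_pdivrMr ?ltr0n // mul1r ler_nat (leq_trans (max_card _)) // card_ord.
Qed.

Lemma poly_bounded01 (p : {poly R}) : exists2 C, 0 <= C &
  forall x, 0 <= x <= 1 -> `|p.[x]| <= C.
Proof.
exists (\sum_(i < size p) `|p`_i|) => [|x /andP[x0 x1]]; first exact: sumr_ge0.
rewrite horner_coef; apply: le_trans (ler_norm_sum _ _ _) _.
apply: ler_sum => i _; rewrite normrM ler_piMr // normrX ger0_norm //.
exact: exprn_ile1.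
Qed.

Lemma expansion_bounded al be ga : exists2 C, 0 <= C &
  forall n (s : 'S_n), (0 < n)%N -> `|expansion al be ga s| <= C.
Proof.
have [a a0 ha] := poly_bounded01 al; have [b b0 hb] := poly_bounded01 be.
have [c c0 hc] := poly_bounded01 ga.
exists (a + (b + c)); first by rewrite !addr_ge0.
move=> n s n0; rewrite /expansion; set x := fixed_ratio R s.
have x01 : 0 <= x <= 1 := fixed_ratio_itv s.
apply: le_trans (ler_normD _ _) _; rewrite lerD ?ha // normrM.
have n1 : `|n%:R^-1| <= 1 :> R.
  by rewrite ger0_norm ?invr_ge0 // invf_le1 ?ltr0n // ler1n.
rewrite -[leRHS]mulr1 ler_pM // (le_trans (ler_normD _ _)) // lerD ?hb // normrM.
have /andP[z0 z1] := two_cycle_ratio_itv s.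
by rewrite -[leRHS]mul1r ler_pM ?hc // ger0_norm.
Qed.

Lemma eq_expandable M F G :
  (exists n0, forall n (s : 'S_n), (n0 <= n)%N -> F n s = G n s) ->
  expandable M F -> expandable M G.
Proof.
move=> [n1 FG] [al [be [ga [C [n0 H]]]]]; exists al, be, ga, C, (maxn n0 n1).
move=> n s npos; rewrite geq_max => /andP[nn0 nn1]; rewrite -FG //; exact: H.
Qed.

Lemma expandable0 M : expandable M (fun _ _ => 0).
Proof.
exists 0, 0, 0, 0, 0%N => n s _ _.
by rewrite /expansion !horner0 !(mulr0, addr0, mul0r, subr0, normr0).
Qed.

Lemma expandableD M F G : expandable M F -> expandable M G ->
  expandable M (fun n s => F n s + G n s).
Proof.
move=> [a1 [b1 [c1 [C1 [n1 H1]]]]] [a2 [b2 [c2 [C2 [n2 H2]]]]].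
exists (a1 + a2), (b1 + b2), (c1 + c2), (C1 + C2), (maxn n1 n2).
move=> n s npos; rewrite geq_max => /andP[nn1 nn2].
have -> : (F n s + G n s) / n%:R ^+ M - expansion (a1 + a2) (b1 + b2) (c1 + c2) s =
  (F n s / n%:R ^+ M - expansion a1 b1 c1 s) + (G n s / n%:R ^+ M - expansion a2 b2 c2 s).
  by rewrite /expansion !hornerD; ring.
by rewrite (le_trans (ler_normD _ _)) // mulrDl lerD ?H1 ?H2.
Qed.

Lemma expandable_sum M (J : finType) (F : J -> forall n, 'S_n -> R) :
  (forall j, expandable M (F j)) -> expandable M (fun n s => \sum_j F j n s).
Proof.
move=> HF; suff H (r : seq J) : expandable M (fun n s => \sum_(j <- r) F j n s).
  exact: H.
elim: r => [|j r IH].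
  apply: eq_expandable (expandable0 M); exists 0%N => n s _; by rewrite big_nil.
apply: eq_expandable (expandableD (HF j) IH); exists 0%N => n s _.
by rewrite big_cons.
Qed.

(** The 2-cycle ratio occurs at order [1 / n] only, so its square appears in a product only at order
    [1 / n ^ 2], within the error: linearity in it is preserved. *)
Lemma has_expansionM M N F G a1 b1 c1 a2 b2 c2 :
  has_expansion M F a1 b1 c1 -> has_expansion N G a2 b2 c2 ->
  has_expansion (M + N) (fun n s => F n s * G n s)
    (a1 * a2) (a1 * b2 + b1 * a2) (a1 * c2 + c1 * a2).
Proof.
move=> [C1 [n1 H1]] [C2 [n2 H2]].
have [A A0 HA] := expansion_bounded a1 b1 c1; have [B B0 HB] := expansion_bounded a2 b2 c2.
have [u1 u10 Hu1] := poly_bounded01 b1; have [v1 v10 Hv1] := poly_bounded01 c1.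
have [u2 u20 Hu2] := poly_bounded01 b2; have [v2 v20 Hv2] := poly_bounded01 c2.
exists (`|C1| * (B + `|C2|) + A * `|C2| + (u1 + v1) * (u2 + v2)), (maxn n1 n2).
move=> n s npos; rewrite geq_max => /andP[nn1 nn2].
have nn : 0 < n%:R :> R by rewrite ltr0n.
set x := F n s / n%:R ^+ M; set y := G n s / n%:R ^+ N.
have -> : F n s * G n s / n%:R ^+ (M + N) = x * y.
  by rewrite /x /y exprD invfM mulrACA.
set ex := expansion a1 b1 c1 s; set ey := expansion a2 b2 c2 s.
set X := fixed_ratio R s; set z := two_cycle_ratio R s.
pose r1 := b1.[X] + z * c1.[X]; pose r2 := b2.[X] + z * c2.[X].
have E : expansion (a1 * a2) (a1 * b2 + b1 * a2) (a1 * c2 + c1 * a2) s =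
    ex * ey - r1 * r2 / n%:R ^+ 2.
  rewrite /ex /ey /r1 /r2 /expansion !(hornerD, hornerM) -/X -/z.
  by field; rewrite gt_eqF.
have -> : x * y - expansion (a1 * a2) (a1 * b2 + b1 * a2) (a1 * c2 + c1 * a2) s =
    (x - ex) * y + ex * (y - ey) + r1 * r2 / n%:R ^+ 2 by rewrite E; ring.
have n2p : 0 < n%:R ^+ 2 :> R by rewrite exprn_gt0.
have n2i : 0 <= (n%:R ^+ 2)^-1 :> R by rewrite invr_ge0 ltW.
have h1 : `|x - ex| <= `|C1| / n%:R ^+ 2.
  by apply: le_trans (H1 n s npos nn1) _; rewrite ler_wpM2r // ler_norm.
have h2 : `|y - ey| <= `|C2| / n%:R ^+ 2.
  by apply: le_trans (H2 n s npos nn2) _; rewrite ler_wpM2r // ler_norm.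
have hy : `|y| <= B + `|C2|.
  have -> : y = ey + (y - ey) by ring.
  apply: le_trans (ler_normD _ _) _; rewrite lerD ?HB // (le_trans h2) //.
  by rewrite ler_pdivrMr // ler_peMr // exprn_ege1 // ler1n.
have X01 : 0 <= X <= 1 := fixed_ratio_itv s.
have /andP[z0 z1] : 0 <= z <= 1 := two_cycle_ratio_itv s.
have hr (b c : {poly R}) u v : 0 <= v -> `|b.[X]| <= u -> `|c.[X]| <= v ->
    `|b.[X] + z * c.[X]| <= u + v.
  move=> v0 hb hc; apply: le_trans (ler_normD _ _) _; rewrite lerD // normrM.
  by rewrite -[leRHS]mul1r ler_pM // ger0_norm.
have hr1 : `|r1| <= u1 + v1 by apply: hr; rewrite ?Hu1 ?Hv1.
have hr2 : `|r2| <= u2 + v2 by apply: hr; rewrite ?Hu2 ?Hv2.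
apply: le_trans (ler_normD _ _) _; rewrite [leRHS]mulrDl; apply: lerD; last first.
  rewrite normrM [Num.norm (_^-1)]ger0_norm // ler_wpM2r //.
  by rewrite normrM ler_pM.
apply: le_trans (ler_normD _ _) _; rewrite [leRHS]mulrDl; apply: lerD.
  by rewrite normrM mulrAC ler_pM.
by rewrite normrM -mulrA ler_pM ?HA.
Qed.

Lemma expandableM M N F G : expandable M F -> expandable N G ->
  expandable (M + N) (fun n s => F n s * G n s).
Proof.
move=> [a1 [b1 [c1 H1]]] [a2 [b2 [c2 H2]]].
by do 3!eexists; exact: has_expansionM H1 H2.
Qed.

Lemma expandable_exprn k : expandable k (fun n _ => n%:R ^+ k).
Proof.
exists 1, 0, 0, 0, 0%N => n s n0 _.
have nn : n%:R != 0 :> R by rewrite pnatr_eq0 -lt0n.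
rewrite /expansion -(polyC1 R) hornerC !horner0 mulr0 addr0 mul0r addr0.
by rewrite divff ?expf_neq0 // subrr normr0 mul0r.
Qed.

(** One more division by [n] moves [al] to the second place and sends the old correction into the
    error. *)
Lemma expandableS M F : expandable M F -> expandable M.+1 F.
Proof.
move=> [al [be [ga [C [n0 H]]]]].
have [b b0 hb] := poly_bounded01 be; have [c c0 hc] := poly_bounded01 ga.
exists 0, al, 0, (b + c + `|C|), n0 => n s npos nn0.
have nn : 0 < n%:R :> R by rewrite ltr0n.
have -> : F n s / n%:R ^+ M.+1 - expansion 0 al 0 s =
  (F n s / n%:R ^+ M - expansion al be ga s) / n%:R +
  (be.[fixed_ratio R s] + two_cycle_ratio R s * ga.[fixed_ratio R s]) / n%:R ^+ 2.
  rewrite /expansion !horner0 exprSr.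
  have : n%:R ^+ M != 0 :> R by rewrite expf_neq0 // gt_eqF.
  move: (n%:R ^+ M) => a a0; field.
  by rewrite a0 gt_eqF.
have /andP[z0 z1] := two_cycle_ratio_itv s; have X01 := fixed_ratio_itv s.
have n2 : 0 <= (n%:R ^+ 2)^-1 :> R by rewrite invr_ge0 exprn_ge0.
apply: le_trans (ler_normD _ _) _; rewrite [leLHS]addrC [leRHS]mulrDl; apply: lerD.
  rewrite normrM [Num.norm (_^-1)]ger0_norm // ler_wpM2r // (le_trans (ler_normD _ _)) //.
  rewrite lerD ?hb // normrM -[leRHS]mul1r ler_pM ?hc // ger0_norm //.
rewrite normrM -[leRHS]mulr1 ler_pM //.
  by apply: le_trans (H n s npos nn0) _; rewrite ler_wpM2r // ler_norm.
by rewrite ger0_norm ?invr_ge0 ?ler0n // invf_le1 // ler1n.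
Qed.

Lemma expandableW M N F : (M <= N)%N -> expandable M F -> expandable N F.
Proof.
move=> /subnK <-; elim: (N - M)%N => // d IH /IH; rewrite addSn; exact: expandableS.
Qed.

Lemma expandable_ffact_ratio b : expandable 0 (fun n _ => n%:R ^+ b / (n ^_ b)%:R).
Proof.
elim: b => [|b IH].
  apply: eq_expandable (expandable_exprn 0); exists 0%N => n s _.
  by rewrite ffactn0 expr0 divr1.
have step : expandable 0 (fun n _ => n%:R / (n%:R - b%:R)).
  (* For [n > 2 * b] one has [n - b >= n / 2], so the remainder [b ^ 2 / (n * (n - b))] is at most
     [2 * b ^ 2 / n ^ 2]. *)
  exists 1, (b%:R%:P), 0, (2 * b%:R ^+ 2), (2 * b).+1 => n s npos nb.
  have nn : 0 < n%:R :> R by rewrite ltr0n.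
  have nb2 : 2 * b%:R < n%:R :> R by rewrite -natrM ltr_nat.
  have bp : 0 <= b%:R :> R by [].
  have nbp : 0 < n%:R - b%:R :> R by lra.
  rewrite /expansion -{1}(polyC1 R) !hornerC ?horner0 mulr0 addr0 expr0 divr1.
  have -> : n%:R / (n%:R - b%:R) - (1 + b%:R / n%:R) =
      b%:R ^+ 2 / (n%:R * (n%:R - b%:R)) :> R.
    have nz : n%:R != 0 :> R by rewrite gt_eqF.
    have nbz : n%:R - b%:R != 0 :> R by rewrite gt_eqF.
    by field; rewrite ?nz ?nbz.
  rewrite ger0_norm; last by rewrite divr_ge0 ?exprn_ge0 // mulr_ge0 // ltW.
  rewrite ler_pdivrMr ?mulr_gt0 //.
  have -> : 2 * b%:R ^+ 2 / n%:R ^+ 2 * (n%:R * (n%:R - b%:R)) =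
      b%:R ^+ 2 * (2 * (n%:R - b%:R) / n%:R) :> R by field; rewrite gt_eqF.
  by rewrite ler_peMr ?exprn_ge0 // ler_pdivlMr // mul1r; lra.
apply: eq_expandable (expandableM IH step); exists b => n s bn.
by rewrite exprSr ffactnSr natrM natrB // invfM mulrACA.
Qed.

Lemma expandable_div_ffact M b F : expandable (M + b) F ->
  expandable M (fun n s => F n s / (n ^_ b)%:R).
Proof.
move=> HF; have := expandableM HF (expandable_ffact_ratio b); rewrite addn0.
move=> [al [be [ga [C [n0 H]]]]]; exists al, be, ga, C, n0 => n s npos nn0.
have := H n s npos nn0; congr (`|_ - _| <= _); rewrite exprD.
have : n%:R ^+ b != 0 :> R by rewrite expf_neq0 // pnatr_eq0 -lt0n.
move: (n%:R ^+ b) (n%:R ^+ M) (n ^_ b)%:R => u v w u0.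
have -> : F n s * (u / w) / (v * u) = F n s / w / v * (u / u) by rewrite invfM; ring.
by rewrite divff // mulr1.
Qed.

Lemma expandableZ M (a : R) F : expandable M F -> expandable M (fun n s => a * F n s).
Proof.
move=> [al [be [ga [C [n0 H]]]]].
exists (a *: al), (a *: be), (a *: ga), (`|a| * C), n0 => n s npos nn0.
have -> : a * F n s / n%:R ^+ M - expansion (a *: al) (a *: be) (a *: ga) s =
  a * (F n s / n%:R ^+ M - expansion al be ga s).
  by rewrite /expansion !hornerZ; ring.
by rewrite normrM -mulrA ler_wpM2l // H.
Qed.

Lemma expandable_div_exp M r F : expandable (M + r) F ->
  expandable M (fun n s => F n s / n%:R ^+ r).
Proof.
move=> [al [be [ga [C [n0 H]]]]]; exists al, be, ga, C, n0 => n s npos nn0.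
by have := H n s npos nn0; rewrite addnC exprD invfM mulrA.
Qed.

End Expansions.

(** * Expansion of mean pattern counts *)

Section PatternExpansion.
Variables (R : realFieldType) (I : finType) (B : {set I * I}).
Variable psi : {ffun (I + I) * (I + I) -> bool} -> R.

Definition graph_labels n (s : 'S_n) (c : {ffun I -> 'I_n}) (i : I + I) : 'I_n :=
  match i with inl j => c j | inr j => s (c j) end.

(** The map [e] merges equal labels: constraints that become identical are then counted once, as the
    injectivity hypothesis of [mean_weight_kernel] requires. *)
Definition left_pairs (e : I -> I) : {set (I + I) * (I + I)} :=
  [set (inl (e p.1), inl (e p.2)) | p in B].

Definition pattern_sum n (s : 'S_n) : R :=
  \sum_(c : {ffun I -> 'I_n})
    mean (fun t : 'S_n => pattern_weight (left_pairs id) psi (fun i => t (graph_labels s c i))).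

(* Canonical idempotent map whose fibres are the level sets of [c]. *)
Definition kernel_map n (c : {ffun I -> 'I_n}) : {ffun I -> I} :=
  [ffun i => odflt i [pick j | c j == c i]].

Lemma kernel_mapE n (c : {ffun I -> 'I_n}) i : c (kernel_map c i) = c i.
Proof. by rewrite ffunE; case: pickP => [j /eqP //|/(_ i)]; rewrite eqxx. Qed.

Lemma kernel_map_eq n (c : {ffun I -> 'I_n}) i j :
  (kernel_map c i == kernel_map c j) = (c i == c j).
Proof.
apply/eqP/eqP => [/(congr1 c)|cij]; first by rewrite !kernel_mapE.
rewrite !ffunE; have -> : [pick l | c l == c j] = [pick l | c l == c i].
  by apply: eq_pick => l; rewrite cij.
by case: pickP => [l //|/(_ i)]; rewrite eqxx.
Qed.

Definition type_map (T : {ffun I * I -> bool * bool}) : {ffun I -> I} :=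
  [ffun i => odflt i [pick j | (T (j, i)).1]].

Lemma type_mapE n (s : 'S_n) c : type_map (pair_type s c) = kernel_map c.
Proof.
apply/ffunP => i; rewrite !ffunE; congr odflt; apply: eq_pick => j.
by rewrite ffunE.
Qed.

Definition pull_type (e : I -> I) (T : {ffun I * I -> bool * bool}) :
    {ffun I * I -> bool * bool} := [ffun p => T (e p.1, e p.2)].

Definition pull_labels n (e : I -> I) (d : {ffun I -> 'I_n}) : {ffun I -> 'I_n} :=
  [ffun i => d (e i)].

Lemma pull_typeE n (s : 'S_n) e d :
  pull_type e (pair_type s d) = pair_type s (pull_labels e d).
Proof. by apply/ffunP => p; rewrite !ffunE. Qed.

Definition type_kernel (T : {ffun I * I -> bool * bool}) :
    {ffun (I + I) * (I + I) -> bool} :=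
  [ffun p => match p with
    | (inl i, inl j) => (T (i, j)).1
    | (inl i, inr j) => (T (j, i)).2
    | (inr i, inl j) => (T (i, j)).2
    | (inr i, inr j) => (T (i, j)).1 end].

Lemma type_kernelE n (s : 'S_n) c :
  type_kernel (pair_type s c) = kernel_of (graph_labels s c).
Proof.
by apply/ffunP => -[[i|i] [j|j]]; rewrite !ffunE /= ?ffunE ?(inj_eq perm_inj) //= eq_sym.
Qed.

(** Only the coordinates of [d] in the image of [e] matter, the others being compensated by the
    power of [n]. The sum over all [d] has the form required by [sum_pair_type_expansion]. *)
Lemma sum_kernel_map n (e : {ffun I -> I}) (H : {ffun I -> 'I_n} -> R) : (0 < n)%N ->
  \sum_(c | kernel_map c == e) H c =
  (\sum_d (kernel_map (pull_labels e d) == e)%:R * H (pull_labels e d))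
    / n%:R ^+ (#|I| - #|[set e i | i in I]|).
Proof.
move=> n0; set J := [set e i | i in I].
set q : R := n%:R ^+ _; have q0 : q != 0.
  by rewrite expf_neq0 // pnatr_eq0 -lt0n.
apply: (mulIf q0); rewrite divfK // mulr_suml.
rewrite [RHS](partition_big (@pull_labels n e) xpredT) //= [LHS]big_mkcond /=.
apply: eq_bigr => c _; case: ifPn => [/eqP ce|cN]; last first.
  by rewrite big1 // => d /eqP ->; rewrite (negPf cN) mul0r.
rewrite (eq_bigr (fun=> H c)) => [|d /eqP ->]; last by rewrite ce eqxx mul1r.
rewrite sumr_const -[RHS]mulr_natr; congr (_ * _).
have -> : #|[pred d | pull_labels e d == c]| =
    #|family (fun i => if i \in J then pred1 (c i) else predT)|.
  have cE i : c (e i) = c i by rewrite -ce kernel_mapE.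
  apply: eq_card => d; transitivity (pull_labels e d == c); first by [].
  apply/eqP/familyP => [dc i|H'].
    case: ifPn => // /imsetP[j _ ->]; rewrite inE cE.
    by have := congr1 (fun f : {ffun I -> 'I_n} => f j) dc; rewrite ffunE => ->.
  apply/ffunP => i; rewrite ffunE.
  by have := H' (e i); rewrite imset_f // inE cE => /eqP.
rewrite card_family foldrE big_map big_enum /= (bigID (mem J)) /=.
rewrite big1 ?mul1n => [|i ->]; last exact: card1.
rewrite (eq_bigr (fun=> n)) => [|i /negPf ->]; last by rewrite card_ord.
rewrite prod_nat_const natrX; congr (_ ^+ _).
by rewrite -[in LHS](cardC J) addKn.
Qed.

(** After merging, each class contains the upper end of a constraint unless all its members are
    roots, of which there are at most [M]. *)
Lemma card_kernel_image (e : I -> I) (M : nat) :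
  (#|[set i | [forall p in B, p.2 != i]]| <= M)%N ->
  (#|[set e i | i in I]| <= M + #|left_pairs e|)%N.
Proof.
move=> roots; set Rt := [set i | _] in roots.
pose f (x : I + I) := match x with inl j => j | inr j => j end.
have sub : [set e i | i in I] \subset
    [set e i | i in Rt] :|: [set f p.2 | p in left_pairs e].
  apply/subsetP => _ /imsetP[i _ ->]; rewrite in_setU.
  have [iR|iR] := boolP (i \in Rt); first by rewrite imset_f.
  apply/orP; right; move: iR; rewrite inE => /forall_inPn[p pB].
  rewrite negbK => /eqP <-; apply/imsetP.
  by exists (inl (e p.1), inl (e p.2)) => //; apply/imsetP; exists p.
rewrite (leq_trans (subset_leq_card sub)) // (leq_trans (leq_card_setU _ _)) //.
by rewrite leq_add ?leq_imset_card // (leq_trans (leq_imset_card _ _)).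
Qed.

Lemma pattern_weight_pull n (s t : 'S_n) (c : {ffun I -> 'I_n}) (e : I -> I) :
  (forall i, c (e i) = c i) ->
  pattern_weight (left_pairs id) psi (fun i => t (graph_labels s c i)) =
  pattern_weight (left_pairs e) psi (fun i => t (graph_labels s c i)).
Proof.
move=> ce; rewrite /pattern_weight; congr (_%:R * _); congr nat_of_bool.
apply/forall_inP/forall_inP => H _ /imsetP[p pB ->] /=.
  have := H (inl p.1, inl p.2); rewrite /= !ce; apply.
  by apply/imsetP; exists p.
have := H (inl (e p.1), inl (e p.2)); rewrite /= !ce; apply.
by apply/imsetP; exists p.
Qed.

(** Tuples are sorted by their coincidences [e]. There are of order [n ^ #|image of e|] choices of
    labels, the adjacencies cost a falling factorial of order [n ^ b], and [card_kernel_image]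
    bounds the net exponent by [M]. *)
Lemma pattern_sum_expandable M :
  (#|[set i | [forall p in B, p.2 != i]]| <= M)%N -> expandable M pattern_sum.
Proof.
move=> roots.
have kapP (e : {ffun I -> I}) := mean_weight_kernel (left_pairs e) psi.
pose Fe (e : {ffun I -> I}) n (s : 'S_n) : R := \sum_(c | kernel_map c == e)
  mean (fun t : 'S_n => pattern_weight (left_pairs id) psi
    (fun i => t (graph_labels s c i))).
have HF e : expandable M (Fe e); last first.
  apply: eq_expandable (expandable_sum HF); exists 0%N => n s _.
  by rewrite /pattern_sum (partition_big (@kernel_map n) xpredT).
have [kap Hkap] := kapP e.
(* The indicator that the coincidences are exactly those of [e] is itself a function of the pair
   type, hence can be part of [Gam]. *)
pose Gam T : R := (type_map (pull_type e T) == e)%:R * kap (type_kernel (pull_type e T)).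
pose r := (#|I| - #|[set e i | i in I]|)%N.
have rI : (#|[set e i | i in I]| <= #|I|)%N by exact: leq_imset_card.
pose b := #|left_pairs e|.
have G1 : expandable #|I| (fun n s => \sum_(d : {ffun I -> 'I_n}) Gam (pair_type s d)).
  have [al [be [ga [C HC]]]] := sum_pair_type_expansion Gam.
  exists al, be, ga, C, 0%N => n s n0 _; have := HC n s n0.
  have nn : 0 < n%:R ^+ #|I| :> R by rewrite exprn_gt0 // ltr0n.
  rewrite -/(expansion al be ga s) => H.
  set S := \sum_d _; set u := n%:R ^+ #|I| in nn H *.
  have -> : S / u - expansion al be ga s = (S - u * expansion al be ga s) / u.
    by rewrite mulrBl [u * _]mulrC mulfK ?gt_eqF.
  by rewrite normrM [Num.norm (u^-1)]gtr0_norm ?invr_gt0 // ler_pdivrMr // mulrAC.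
have G2 : expandable (M + b) (fun n s =>
    (\sum_(d : {ffun I -> 'I_n}) Gam (pair_type s d)) / n%:R ^+ r).
  apply: (@expandableW _ #|[set e i | i in I]|); first exact: card_kernel_image.
  by apply: expandable_div_exp; rewrite subnKC.
apply: eq_expandable (expandable_div_ffact G2); exists b.+1 => n s bn.
have n0 : (0 < n)%N by rewrite (leq_trans _ bn).
have fb : (n ^_ b)%:R != 0 :> R by rewrite pnatr_eq0 -lt0n ffact_gt0 ltnW.
rewrite /Fe (sum_kernel_map e (fun c => mean (fun t : 'S_n =>
  pattern_weight (left_pairs id) psi (fun i => t (graph_labels s c i))))) //.
rewrite mulrAC; congr (_ / _); apply: (mulIf fb); rewrite divfK // mulr_suml.
apply: eq_bigr => d _; rewrite /Gam pull_typeE type_mapE.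
case: eqP => [ce|_]; rewrite ?mul0r // !mul1r type_kernelE.
set c := pull_labels e d in ce *.
have cE i : c (e i) = c i by rewrite -ce kernel_mapE.
have inj : {in left_pairs e &,
    injective (fun p => (graph_labels s c p.1, graph_labels s c p.2))}.
  move=> p q /imsetP[p' _ ->] /imsetP[q' _ ->] /= [/eqP + /eqP].
  by rewrite !cE -!(kernel_map_eq c) ce => /eqP -> /eqP ->.
rewrite -(Hkap _ _ inj) /mean_weight mulrC; congr (_ * _).
by apply: eq_mean => t; rewrite (pattern_weight_pull s t cE).
Qed.

End PatternExpansion.

(** * Cycle types and conjugacy classes *)

Lemma geq_total : total geq.
Proof. by move=> a b; exact: leq_total. Qed.

Lemma geq_trans : transitive geq.
Proof. by move=> a b c /= ab bc; exact: leq_trans bc ab. Qed.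

Lemma geq_anti : antisymmetric geq.
Proof. by move=> a b /= /andP[ab ba]; apply/eqP; rewrite eqn_leq ba. Qed.

Section CycleTypes.
Variable n : nat.
Implicit Types s t : 'S_n.

Lemma fconnect_porbit s x y : fconnect s x y = (y \in porbit s x).
Proof.
apply/idP/porbitP => [xy|[i ->]]; last by rewrite permX fconnect_iter.
by exists (findex s x y); rewrite permX iter_findex.
Qed.

(** Cut the list of all points into consecutive blocks of the prescribed sizes and rotate each block
    with [next]. *)
Lemma cycle_type_exists lam : is_partition n lam -> exists s : 'S_n, cycle_type s = lam.
Proof.
case/and3P => slam plam /eqP nlam.
pose bs := reshape lam (enum 'I_n).
have shb : shape bs = lam by rewrite reshapeKl // size_enum_ord nlam.
have flb : flatten bs = enum 'I_n by rewrite reshapeKr // size_enum_ord nlam.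
have ub : uniq (flatten bs) by rewrite flb enum_uniq.
have b0 c : c \in bs -> c != [::].
  move=> cb; have : size c \in lam by rewrite -shb; exact: map_f.
  by move/(allP plam); case: c {cb}.
have disj c c' x : c \in bs -> c' \in bs -> x \in c -> x \in c' -> c = c'.
  elim: bs ub {shb flb b0} => //= b l IH; rewrite cat_uniq => /and3P[_ /hasPn bl ul].
  rewrite !inE => /orP[/eqP->|cl] /orP[/eqP->|cl'] // xc xc'.
  - by have /negP[] := bl x (introT flattenP (ex_intro2 _ _ c' cl' xc')).
  - by have /negP[] := bl x (introT flattenP (ex_intro2 _ _ c cl xc)).
  - exact: IH.
have ucat c : c \in bs -> uniq c.
  elim: bs ub {shb flb b0 disj} => //= b l IH; rewrite cat_uniq => /and3P[ub _ ul].
  by rewrite inE => /orP[/eqP ->|/(IH ul)].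
have ubs : uniq bs.
  elim: bs ub b0 {shb flb disj ucat} => //= b l IH.
  rewrite cat_uniq => /and3P[ub /hasPn bl ul] b0; rewrite IH // ?andbT.
    apply/negP => bil; have := b0 b (mem_head _ _); case E: b => [//|x b'] _.
    have /negP[] : x \notin b by apply: bl; apply/flattenP; exists b; rewrite // E mem_head.
    by rewrite E mem_head.
  by move=> c cl; apply: b0; rewrite inE cl orbT.
have ex x : exists2 c, c \in bs & x \in c.
  have : x \in flatten bs by rewrite flb mem_enum.
  by move/flattenP => [c]; exists c.
pose blk x := s2val (sig2W (ex x)).
have blk1 x : blk x \in bs by rewrite /blk; case: sig2W.
have blk2 x : x \in blk x by rewrite /blk; case: sig2W.
have blkE c x : c \in bs -> x \in c -> blk x = c by move=> cb xc; apply: (@disj _ _ x).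
pose f x := next (blk x) x; pose g x := prev (blk x) x.
have fK : cancel f g.
  move=> x; rewrite /g /f (@blkE (blk x)) ?mem_next //.
  by apply: prev_next; exact: ucat.
pose s : 'S_n := perm (can_inj fK); exists s.
have fc c : c \in bs -> fcycle s c.
  move=> cb; have := cycle_next (ucat c cb); apply: (@sub_in_cycle _ (mem c)).
    by move=> x y xc yc /=; rewrite permE /f (blkE c).
  exact/allP.
have orb c x : c \in bs -> x \in c -> porbit s x = [set y in c].
  move=> cb xc; apply/setP => y.
  by rewrite inE -fconnect_porbit (fconnect_cycle (fc c cb)).
have perm1 : perm_eq (enum (porbits s)) [seq [set y in c] | c <- bs].
  apply: uniq_perm; first exact: enum_uniq.
    rewrite map_inj_in_uniq // => c c' cb cb' /setP cc'.
    have /hasP[x xc _] : has predT c by rewrite has_predT; case: (c) (b0 c cb).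
    by apply: (@disj _ _ x) => //; have := cc' x; rewrite !inE xc => <-.
  move=> C; rewrite mem_enum; apply/imsetP/mapP => [[x _ ->]|[c cb ->]].
    by exists (blk x) => //; exact: orb.
  have /hasP[x xc _] : has predT c by rewrite has_predT; case: (c) (b0 c cb).
  by exists x => //; rewrite (orb c).
rewrite /cycle_type -[RHS](sorted_sort geq_trans) //.
apply/(perm_sortP geq_total geq_trans geq_anti).
apply: perm_trans (perm_map _ perm1) _; rewrite -map_comp -shb.
rewrite (_ : map _ bs = shape bs) //; apply/eq_in_map => c cb /=.
by rewrite cardsE; apply/card_uniqP; exact: ucat.
Qed.

Lemma porbit_conj s t x : porbit (s ^ t)%g (t x) = t @: porbit s x.
Proof.
have iterJ i : ((s ^ t) ^+ i)%g (t x) = t ((s ^+ i)%g x) by rewrite -conjXg permJ.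
apply/setP => y; apply/porbitP/imsetP => [[i ->]|[_ /porbitP[i ->] ->]].
  by exists ((s ^+ i)%g x); rewrite ?mem_porbit.
by exists i.
Qed.

Lemma cycle_type_conj s t : cycle_type (s ^ t)%g = cycle_type s.
Proof.
apply/(perm_sortP geq_total geq_trans geq_anti).
have ti : injective (fun C : {set 'I_n} => t @: C) by exact: imset_inj perm_inj.
have E : perm_eq (enum (porbits (s ^ t)%g)) [seq t @: C | C : {set 'I_n} <- enum (porbits s)].
  apply: uniq_perm; rewrite ?enum_uniq ?map_inj_uniq ?enum_uniq // => C.
  rewrite mem_enum; apply/imsetP/mapP => [[y _ ->]|[D]].
    exists (porbit s ((t^-1)%g y)); first by rewrite mem_enum imset_f.
    by rewrite -porbit_conj permKV.
  by rewrite mem_enum => /imsetP[x _ ->] ->; exists (t x); rewrite ?porbit_conj.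
apply: perm_trans (perm_map _ E) _; rewrite -map_comp.
rewrite (@eq_map _ _ _ (fun C : {set 'I_n} => #|C|)) // => C /=.
by rewrite card_imset //; exact: perm_inj.
Qed.

Lemma iter_porbit_mod s x i : iter i s x = iter (i %% #|porbit s x|)%N s x.
Proof.
rewrite {1}(divn_eq i #|porbit s x|) addnC iterD; congr (iter _ _ _).
elim: (i %/ _)%N => //= q IH; rewrite mulSn iterD IH; exact: iter_porbit.
Qed.

Lemma iter_porbit_inj s x i j : (i < #|porbit s x|)%N -> (j < #|porbit s x|)%N ->
  iter i s x = iter j s x -> i = j.
Proof.
move=> ip jp; have u := uniq_traject_porbit s x.
rewrite -(nth_traject s ip x) -(nth_traject s jp x) => /eqP.
by rewrite nth_uniq ?size_traject // => /eqP.
Qed.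

(** Match the orbits by sizes with [phi], choose base points [R x] and [R' x] in matched orbits, and
    send the [i]-th iterate of the one to the [i]-th iterate of the other; equality of the sizes
    makes this well defined and injective. *)
Lemma cycle_type_eq_conj s t : cycle_type s = cycle_type t -> exists u, t = (s ^ u)%g.
Proof.
move/(perm_sortP geq_total geq_trans geq_anti); set P := enum (porbits s); set Q := enum (porbits t).
move/(perm_iotaP 0%N) => [Is pIs]; rewrite size_map in pIs => mapP.
have sIs : size Is = size P by rewrite -(size_map (nth 0%N [seq #|c| | c : {set 'I_n} <- Q])) -mapP size_map.
have uP : uniq P by exact: enum_uniq.
have uQ : uniq Q by exact: enum_uniq.
have uIs : uniq Is by rewrite (perm_uniq pIs) iota_uniq.
pose phi C := nth set0 Q (nth 0%N Is (index C P)).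
have idx C : C \in P -> (nth 0%N Is (index C P) < size Q)%N.
  move=> CP; have : nth 0%N Is (index C P) \in Is by rewrite mem_nth // sIs index_mem.
  by rewrite (perm_mem pIs) mem_iota.
have phiQ C : C \in P -> phi C \in Q by move=> CP; rewrite mem_nth // idx.
have phic C : C \in P -> #|phi C| = #|C|.
  move=> CP; have := congr1 (fun l => nth 0%N l (index C P)) mapP.
  rewrite (nth_map set0) ?index_mem // nth_index // => ->.
  by rewrite (nth_map 0%N) ?sIs ?index_mem // (nth_map set0) // idx.
have phiI C D : C \in P -> D \in P -> phi C = phi D -> C = D.
  move=> CP DP /eqP; rewrite nth_uniq ?idx // => /eqP/eqP.
  rewrite nth_uniq ?sIs ?index_mem // => /eqP ij.
  by rewrite -(nth_index set0 CP) ij nth_index.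
have inP x : porbit s x \in P by rewrite mem_enum imset_f.
have repP (x0 : 'I_n) : {r : {set 'I_n} -> 'I_n | forall x, porbit s (r (porbit s x)) = porbit s x}.
  exists (fun C : {set 'I_n} => odflt x0 [pick x in C]) => x; case: pickP => [y /= yx|/(_ x)].
    by apply/esym/eqP; rewrite eq_sym eq_porbit_mem.
  by rewrite porbit_id.
have repQ (x0 : 'I_n) : {r : {set 'I_n} -> 'I_n | forall C, C \in Q -> porbit t (r C) = C}.
  exists (fun C : {set 'I_n} => odflt x0 [pick x in C]) => C; rewrite mem_enum => /imsetP[x _ ->].
  case: pickP => [y /= yx|/(_ x)]; last by rewrite porbit_id.
  by apply/eqP; rewrite eq_porbit_mem.
have [n0|n0] := posnP n.
  exists 1%g; apply/permP => x; have := ltn_ord x; by rewrite {2}n0.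
have [r Hr] := repP (Ordinal n0); have [r' Hr'] := repQ (Ordinal n0).
pose R x := r (porbit s x); pose R' x := r' (phi (porbit s x)).
have R'E x : porbit t (R' x) = phi (porbit s x) by rewrite Hr' // phiQ.
have ex x : exists i, x == iter i s (R x).
  have : x \in porbit s (R x) by rewrite /R Hr porbit_id.
  by case/porbitP => i xi; exists i; rewrite -permX -xi.
pose f x := iter (xchoose (ex x)) t (R' x).
have fE x i : x = iter i s (R x) -> f x = iter i t (R' x).
  move=> xi; have /eqP xe := xchooseP (ex x).
  have cE : #|porbit t (R' x)| = #|porbit s (R x)| by rewrite R'E phic // /R Hr.
  rewrite /f iter_porbit_mod [RHS]iter_porbit_mod cE; congr (iter _ _ _).
  have d0 : (0 < #|porbit s (R x)|)%N by rewrite lt0n card_porbit_neq0.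
  apply: (@iter_porbit_inj s (R x)); rewrite ?ltn_pmod //.
  by rewrite -!iter_porbit_mod -xe -xi.
have sp x : porbit s (s x) = porbit s x by have := porbit_perm s 1 x; rewrite expg1.
have sR x : R (s x) = R x by rewrite /R sp.
have sR' x : R' (s x) = R' x by rewrite /R' sp.
have fs x : f (s x) = t (f x).
  have /eqP xe := xchooseP (ex x).
  by rewrite (fE (s x) (xchoose (ex x)).+1) ?sR' //= sR -xe.
have f_orb x : porbit t (f x) = phi (porbit s x).
  by rewrite /f -permX porbit_perm R'E.
have fi : injective f.
  move=> x y fxy.
  have pxy : porbit s x = porbit s y by apply: phiI => //; rewrite -!f_orb fxy.
  have Rxy : R x = R y by rewrite /R pxy.
  have R'xy : R' x = R' y by rewrite /R' pxy.
  have /eqP xe := xchooseP (ex x); have /eqP ye := xchooseP (ex y).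
  move: (xchoose (ex x)) (xchoose (ex y)) xe ye => i j xe ye.
  have cE : #|porbit t (R' x)| = #|porbit s (R x)| by rewrite R'E phic // /R Hr.
  move: fxy; rewrite (fE _ _ xe) (fE _ _ ye) -R'xy iter_porbit_mod [RHS]iter_porbit_mod cE.
  have d0 : (0 < #|porbit s (R x)|)%N by rewrite lt0n card_porbit_neq0.
  move/(@iter_porbit_inj t (R' x)); rewrite cE !ltn_pmod // => /(_ isT isT) ij.
  by rewrite [LHS]xe [RHS]ye -Rxy iter_porbit_mod [RHS]iter_porbit_mod ij.
exists (perm fi); apply/permP => y; rewrite -(permKV (perm fi) y) permJ !permE.
by rewrite fs.
Qed.

(** No count of centralizers is needed: conjugation by a fixed [t] permutes the class, and the mean
    over [t] is the same from every starting point of the class. *)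
Lemma mean_conj_class (R : realFieldType) s (F : 'S_n -> R) :
  mean (fun t => F (s ^ t)%g) =
  (\sum_(u in cycle_class n (cycle_type s)) F u) / #|cycle_class n (cycle_type s)|%:R.
Proof.
set C := cycle_class _ _.
have sC : s \in C by rewrite inE.
have C0 : #|C|%:R != 0 :> R by rewrite pnatr_eq0 -lt0n; apply/card_gt0P; exists s.
apply: (mulIf C0); rewrite divfK //.
have CJ t u : (u ^ t \in C)%g = (u \in C) by rewrite !inE cycle_type_conj.
have key : \sum_(u in C) mean (fun t => F (u ^ t)%g) = \sum_(u in C) F u.
  have -> : \sum_(u in C) mean (fun t => F (u ^ t)%g) =
      mean (fun t => \sum_(u in C) F (u ^ t)%g).
    by rewrite mean.unlock -mulr_suml exchange_big.
  rewrite -[RHS](@mean_cst R {perm 'I_n}) ?card_Sn ?fact_gt0 //.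
  apply: eq_mean => t; rewrite [RHS](reindex_inj (conjg_inj t)) /=.
  by apply: eq_bigl => u; rewrite CJ.
rewrite -key (eq_bigr (fun=> mean (fun t => F (s ^ t)%g))) ?sumr_const ?mulr_natr //.
move=> u; rewrite inE => /eqP/esym/cycle_type_eq_conj[w ->].
rewrite -[RHS](mean_reindex _ (mulgI w)); apply: eq_mean => t /=.
by rewrite conjgM.
Qed.

Lemma count_cycle_type s d :
  (count_mem d (cycle_type s) * d)%N = #|[set x | #|porbit s x| == d]|.
Proof.
rewrite /cycle_type (seq.permP (permEl (perm_sort _ _))) count_map.
have -> : count (preim (fun C : {set 'I_n} => #|C|) (pred1 d)) (enum (porbits s)) =
    #|[set C in porbits s | #|C| == d]|.
  rewrite cardE -size_filter; apply/perm_size/uniq_perm.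
  - by rewrite filter_uniq ?enum_uniq.
  - exact: enum_uniq.
  - by move=> C; rewrite mem_filter !mem_enum in_set /= andbC.
rewrite -sum_nat_const -[RHS]sum1_card.
rewrite (partition_big (porbit s) [in [set C in porbits s | #|C| == d]]) /=; last first.
  by move=> x; rewrite !inE => ->; rewrite imset_f.
apply: eq_bigr => C; rewrite inE => /andP[/imsetP[y _ ->] /eqP Cd].
rewrite -[LHS]Cd -sum1_card; apply: eq_bigl => x.
rewrite inE eq_porbit_mem; apply/idP/andP => [xy|[]//]; split => //.
by move: xy; rewrite -eq_porbit_mem => /eqP ->; rewrite Cd.
Qed.

Lemma card_porbit1 s x : (#|porbit s x| == 1%N) = (s x == x).
Proof.
apply/eqP/eqP => [h|sx].
  by have := iter_porbit s x; rewrite h.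
suff -> : porbit s x = [set x] by rewrite cards1.
apply/setP => y; rewrite inE; apply/porbitP/eqP => [[i ->]|->].
  by rewrite permX; elim: i => //= i ->.
by exists 0%N; rewrite expg0 perm1.
Qed.

Lemma card_porbit2 s x : (#|porbit s x| == 2) = (s x != x) && (s (s x) == x).
Proof.
apply/eqP/andP => [h|[sx /eqP ssx]].
  have := iter_porbit s x; rewrite h /= => ->; split => //.
  by rewrite -card_porbit1 h.
suff -> : porbit s x = [set x; s x] by rewrite cards2 eq_sym sx.
apply/setP => y; rewrite !inE; apply/porbitP/orP => [[i ->]|].
  rewrite permX; elim: i => [|i /= [/eqP ->|/eqP ->]]; first by left.
    by right.
  by left; rewrite ssx.
case=> /eqP ->; first by exists 0%N; rewrite expg0 perm1.
by exists 1%N; rewrite expg1.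
Qed.

End CycleTypes.

Lemma fixed_ratio_cycle_type (R : realFieldType) n (s : 'S_n) :
  fixed_ratio R s = (count_mem 1%N (cycle_type s))%:R / n%:R.
Proof.
rewrite /fixed_ratio; congr (_%:R / _); rewrite -[RHS]muln1 count_cycle_type.
by apply: eq_card => x; rewrite !inE card_porbit1.
Qed.

Lemma two_cycle_ratio_cycle_type (R : realFieldType) n (s : 'S_n) :
  two_cycle_ratio R s = 2 * ((count_mem 2 (cycle_type s))%:R / n%:R).
Proof.
rewrite /two_cycle_ratio mulrA mulrC [2 * _]mulrC -natrM mulrC; congr (_%:R / _).
by rewrite count_cycle_type; apply: eq_card => x; rewrite !inE card_porbit2.
Qed.

(** * Asymptotic variance *)

Section OccurrenceMoments.
Variables (R : realFieldType) (k : nat) (tau : 'S_k) (A : {set 'I_k.-1}).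
Local Notation m := (k - #|A|)%N.

Definition adjacency_pairs : {set 'I_k * 'I_k} :=
  [set p : 'I_k * 'I_k | [exists a in A, (p.1 == a :> nat) && (p.2 == a.+1 :> nat)]].

Lemma adjacentE n (i : {ffun 'I_k -> 'I_n}) :
  adjacent A i = [forall p in adjacency_pairs, i p.2 == (i p.1).+1 :> nat].
Proof.
apply/forall_inP/forall_inP => [H p|H a aA].
  rewrite inE => /exists_inP[a aA pa].
  by have /forallP/(_ p.1)/forallP/(_ p.2)/implyP/(_ pa) := H a aA.
apply/forallP => b; apply/forallP => c; apply/implyP => bc.
by apply: (H (b, c)); rewrite inE; apply/exists_inP; exists a.
Qed.

Lemma adjacency_roots :
  [set i | [forall p in adjacency_pairs, p.2 != i]] = block_root A.
Proof.
apply/setP => r; rewrite !inE; apply/forall_inP/negP => [H /exists_inP[a aA ra]|H p].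
  have ak : (a < k)%N by case: a {aA ra} => a /=; lia.
  have := H (Ordinal ak, r); rewrite inE /= eqxx => /(_ _)/negP; apply => //.
  by apply/exists_inP; exists a; rewrite // eqxx.
rewrite inE => /exists_inP[a aA /andP[_ pa]]; apply: contra_notN H => /eqP <-.
by apply/exists_inP; exists a.
Qed.

(** [f] and [g] tell where the positions and the values of a tuple are read in the order matrix [M],
    so that one formula serves for a single tuple and for each half of a pair of tuples. *)
Definition occ_order (J : Type) (f : 'I_k -> J) (g : 'I_k -> J) (M : J * J -> bool) : R :=
  ([forall a : 'I_k, forall b : 'I_k, (a < b)%N ==> M (f a, f b)] &&
   [forall a : 'I_k, forall b : 'I_k, (a < b)%N ==>
      M (g ((tau^-1)%g a), g ((tau^-1)%g b))])%:R.

Lemma occ_atE n (s t : 'S_n) (a : {ffun 'I_k -> 'I_n}) :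
  occ_at R tau A s a t =
  [forall p in adjacency_pairs, t (a p.2) == (t (a p.1)).+1 :> nat]%:R *
  ([forall i : 'I_k, forall j : 'I_k, (i < j)%N ==> (t (a i) < t (a j))%N] &&
   [forall i : 'I_k, forall j : 'I_k, (i < j)%N ==>
      (t (s (a ((tau^-1)%g i))) < t (s (a ((tau^-1)%g j))))%N])%:R.
Proof.
rewrite /occ_at /is_occurrence -natrM mulnb andbA andbC; congr (nat_of_bool (_ && _))%:R.
  rewrite -/(adjacent A _) adjacentE; apply: eq_forallb => p.
  by rewrite !ffunE.
congr (_ && _); apply: eq_forallb => i; apply: eq_forallb => j; rewrite !ffunE //.
by rewrite !permJ.
Qed.

Lemma adjacent_values_left (I : finType) (B : {set I * I}) (v : I + I -> nat) :
  adjacent_values (left_pairs B id) v =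
  [forall p in B, v (inl p.2) == (v (inl p.1)).+1].
Proof.
apply/forall_inP/forall_inP => H p pB.
  by apply: (H (inl p.1, inl p.2)); apply/imsetP; exists p.
by case/imsetP: pB => q qB -> /=; exact: H.
Qed.

Lemma occ_orderE (J : finType) (f g : 'I_k -> J) (v : J -> nat) :
  occ_order f g [ffun p => (v p.1 < v p.2)%N] =
  ([forall i : 'I_k, forall j : 'I_k, (i < j)%N ==> (v (f i) < v (f j))%N] &&
   [forall i : 'I_k, forall j : 'I_k, (i < j)%N ==>
      (v (g ((tau^-1)%g i)) < v (g ((tau^-1)%g j)))%N])%:R.
Proof.
rewrite /occ_order; congr (nat_of_bool (_ && _))%:R.
  by apply: eq_forallb => i; apply: eq_forallb => j; rewrite ffunE.
by apply: eq_forallb => i; apply: eq_forallb => j; rewrite ffunE.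
Qed.

Lemma mean_occ_expandable : expandable m (fun n s => mean (occ_conj R tau A s)).
Proof.
pose psi (M : {ffun ('I_k + 'I_k) * ('I_k + 'I_k) -> bool}) := occ_order inl inr M.
have roots : (#|[set i | [forall p in adjacency_pairs, p.2 != i]]| <= m)%N.
  by rewrite adjacency_roots card_block_root.
apply: eq_expandable (pattern_sum_expandable psi roots); exists 0%N => n s _.
rewrite /pattern_sum -mean_sum; apply: eq_mean => t; rewrite occ_conjE.
apply: eq_bigr => c _; rewrite occ_atE /pattern_weight adjacent_values_left.
by rewrite /psi (occ_orderE _ _ (fun x => t (graph_labels s c x))).
Qed.

Definition double_pairs : {set ('I_k + 'I_k) * ('I_k + 'I_k)} :=
  [set (inl p.1, inl p.2) | p in adjacency_pairs] :|:
  [set (inr p.1, inr p.2) | p in adjacency_pairs].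

Lemma forall_double_pairs (v : 'I_k + 'I_k -> nat) :
  [forall p in double_pairs, v p.2 == (v p.1).+1] =
  [forall p in adjacency_pairs, v (inl p.2) == (v (inl p.1)).+1] &&
  [forall p in adjacency_pairs, v (inr p.2) == (v (inr p.1)).+1].
Proof.
apply/forall_inP/andP => [H|[/forall_inP H1 /forall_inP H2] p].
  split; apply/forall_inP => p pA.
    by apply: (H (inl p.1, inl p.2)); rewrite in_setU; apply/orP; left; apply/imsetP; exists p.
  by apply: (H (inr p.1, inr p.2)); rewrite in_setU; apply/orP; right; apply/imsetP; exists p.
by rewrite in_setU => /orP[] /imsetP[q qA ->] /=; [exact: H1 | exact: H2].
Qed.

Lemma double_roots :
  (#|[set i | [forall p in double_pairs, p.2 != i]]| <= m + m)%N.
Proof.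
set S := [set i | _].
have sub : S \subset [set inl i | i in block_root A] :|: [set inr i | i in block_root A].
  apply/subsetP => -[] i; rewrite /S in_set => /forall_inP H; rewrite in_setU; apply/orP.
    left; apply/imsetP; exists i => //; rewrite -adjacency_roots in_set.
    apply/forall_inP => p pA; have := H (inl p.1, inl p.2); rewrite /= in_setU.
    by move=> /(_ _) h; apply: contraNneq (h _) => [->//|]; apply/orP; left; apply/imsetP; exists p.
  right; apply/imsetP; exists i => //; rewrite -adjacency_roots in_set.
  apply/forall_inP => p pA; have := H (inr p.1, inr p.2); rewrite /= in_setU.
  by move=> /(_ _) h; apply: contraNneq (h _) => [->//|]; apply/orP; right; apply/imsetP; exists p.
rewrite (leq_trans (subset_leq_card sub)) // (leq_trans (leq_card_setU _ _)) //.
by rewrite -card_block_root leq_add ?leq_imset_card.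
Qed.

(** A pair of label tuples is one tuple over the disjoint union of the index sets; labels shared by
    the two halves are ordinary coincidences. *)
Lemma mean_occ_sqr_expandable :
  expandable (m + m) (fun n s => mean (fun t => occ_conj R tau A s t ^+ 2)).
Proof.
pose psi (M : {ffun (('I_k + 'I_k) + ('I_k + 'I_k)) * (('I_k + 'I_k) + ('I_k + 'I_k))
    -> bool}) : R :=
  occ_order (fun i => inl (inl i)) (fun i => inr (inl i)) M *
  occ_order (fun i => inl (inr i)) (fun i => inr (inr i)) M.
apply: eq_expandable (pattern_sum_expandable psi double_roots); exists 0%N => n s _.
rewrite /pattern_sum -mean_sum; apply: eq_mean => t.
rewrite expr2 occ_conjE mulr_suml.
under [RHS]eq_bigr do rewrite mulr_sumr.
rewrite pair_bigA /=.
pose h (p : {ffun 'I_k -> 'I_n} * {ffun 'I_k -> 'I_n}) : {ffun 'I_k + 'I_k -> 'I_n} :=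
  [ffun x => match x with inl i => p.1 i | inr i => p.2 i end].
have hb : bijective h.
  exists (fun c : {ffun 'I_k + 'I_k -> 'I_n} => ([ffun i => c (inl i)], [ffun i => c (inr i)])).
    by move=> [a a']; congr pair; apply/ffunP => i; rewrite !ffunE.
  by move=> c; apply/ffunP => -[] i; rewrite !ffunE.
rewrite (reindex _ (onW_bij _ hb)); apply: eq_bigr => -[a a'] _ /=.
rewrite !occ_atE /pattern_weight adjacent_values_left /=.
rewrite (forall_double_pairs (fun x => t (h (a, a') x))) -mulnb natrM.
rewrite /psi (occ_orderE _ _ (fun x => t (graph_labels s (h (a, a')) x))).
rewrite (occ_orderE _ _ (fun x => t (graph_labels s (h (a, a')) x))) [RHS]mulrACA /=.
congr (_%:R * _%:R * (_%:R * _%:R)).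
- by congr nat_of_bool; apply: eq_forallb => p; rewrite !ffunE.
- by congr nat_of_bool; apply: eq_forallb => p; rewrite !ffunE.
- congr (nat_of_bool (_ && _)); apply: eq_forallb => i; apply: eq_forallb => j;
    by rewrite !ffunE.
- congr (nat_of_bool (_ && _)); apply: eq_forallb => i; apply: eq_forallb => j;
    by rewrite !ffunE.
Qed.

Lemma fixed_points_exist n f : (f + 2 <= n)%N ->
  exists s : 'S_n, fixed_ratio R s = f%:R / n%:R.
Proof.
move=> fn; have nf : is_partition n ((n - f)%N :: nseq f 1%N).
  apply/and3P; split.
  - rewrite /= path_min_sorted; last by apply/allP => x /nseqP[-> _] /=; lia.
    by elim: (f) => [|[|f'] IH].
  - rewrite /= all_nseq orbT andbT; lia.
  - rewrite /= sumn_nseq; lia.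
have [s sl] := cycle_type_exists nf; exists s.
rewrite fixed_ratio_cycle_type sl /= count_nseq /= mul1n.
by rewrite (_ : (n - f == 1)%N = false) //; apply/negP => /eqP; lia.
Qed.

End OccurrenceMoments.

Lemma conj_variance_expansion (R : archiRcfType) k (tau : 'S_k) (A : {set 'I_k.-1}) :
  exists (be ga : {poly R}) (C : R) n0, forall n (s : 'S_n), (0 < n)%N -> (n0 <= n)%N ->
    `|mean (fun t => centered_conj R tau A s t ^+ 2)
      - (be.[fixed_ratio R s] + two_cycle_ratio R s * ga.[fixed_ratio R s])| <= C / n%:R.
Proof.
set m := (k - #|A|)%N.
have vexp : expandable (m + m) (fun n s => mean (fun t => occ_conj R tau A s t ^+ 2)
    - mean (occ_conj R tau A s) * mean (occ_conj R tau A s)).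
  have e1 := expandableM (mean_occ_expandable R tau A) (mean_occ_expandable R tau A).
  have e2 := expandableD (mean_occ_sqr_expandable R tau A) (expandableZ (-1) e1).
  by apply: eq_expandable e2; exists 0%N => n s _; rewrite mulN1r.
(* The squared scale is [n ^ (2 m - 1)]: the correction of order [1 / n] in the variance of the
   count becomes the leading term for the normalized count. *)
have Vz n (s : 'S_n) : (0 < n)%N ->
    (mean (fun t => occ_conj R tau A s t ^+ 2)
      - mean (occ_conj R tau A s) * mean (occ_conj R tau A s)) / n%:R ^+ (m + m) =
    mean (fun t => centered_conj R tau A s t ^+ 2) / n%:R.
  move=> n0; have nn : 0 < n%:R :> R by rewrite ltr0n.
  have Sn0 : (0 < #|{: 'S_n}|)%N by rewrite card_Sn fact_gt0.
  set X := occ_conj R tau A s.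
  have -> : mean (fun t => centered_conj R tau A s t ^+ 2) =
      (n%:R / n%:R ^+ (m + m)) * mean (fun t => (X t - mean X) ^+ 2).
    rewrite -meanZ; apply: eq_mean => t; rewrite /centered_conj expr_div_n -/X mulrC.
    congr (_ * _); rewrite /conj_scale expr_div_n sqr_sqrtr ?ltW // invf_div.
    by rewrite -exprM muln2 addnn.
  have := mean_sqr_center X 0 Sn0; rewrite subr0.
  have -> : mean (fun t => (X t - 0) ^+ 2) = mean (fun t => X t ^+ 2).
    by apply: eq_mean => t; rewrite subr0.
  move=> ->; rewrite expr2 addrK.
  have nz : n%:R != 0 :> R by rewrite gt_eqF.
  have un : n%:R ^+ (m + m) != 0 :> R by rewrite expf_neq0.
  move: (n%:R ^+ (m + m)) un (mean _) => u un V.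
  by field; rewrite ?un ?nz.
have [C1 C10 HC1] := conj_variance_bound R tau A.
move: vexp => [al [be [ga [C [n0 H]]]]].
have [b b0 hb] := poly_bounded01 be; have [c c0 hc] := poly_bounded01 ga.
have al_small n (s : 'S_n) : (0 < n)%N -> (n0 <= n)%N ->
    `|al.[fixed_ratio R s]| * n%:R <= C1 + (b + c) + `|C|.
  move=> npos nn0; have nn : 0 < n%:R :> R by rewrite ltr0n.
  have := H n s npos nn0; rewrite Vz // /expansion.
  set V := mean _; set x := fixed_ratio R s; set z := two_cycle_ratio R s => HV.
  have V0 : 0 <= V by apply: mean_ge0 => t; exact: sqr_ge0.
  have VC : V <= C1 := HC1 n s npos.
  have /andP[z0 z1] : 0 <= z <= 1 := two_cycle_ratio_itv R s.
  have hr : `|be.[x] + z * ga.[x]| <= b + c.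
    apply: le_trans (ler_normD _ _) _; rewrite lerD ?hb ?fixed_ratio_itv // normrM.
    by rewrite -[leRHS]mul1r ler_pM ?hc ?fixed_ratio_itv // ger0_norm.
  rewrite -ler_pdivlMr //.
  have -> : al.[x] = V / n%:R - (be.[x] + z * ga.[x]) / n%:R
      - (V / n%:R - (al.[x] + (be.[x] + z * ga.[x]) / n%:R)) by ring.
  have ni : 0 <= n%:R^-1 :> R by rewrite invr_ge0 ltW.
  apply: le_trans (ler_normB _ _) _; rewrite [leRHS]mulrDl lerD //.
    apply: le_trans (ler_normB _ _) _; rewrite [leRHS]mulrDl.
    by rewrite !normrM [Num.norm (_^-1)]ger0_norm // lerD // ler_wpM2r // ger0_norm.
  apply: le_trans HV _; rewrite expr2 invfM mulrA ler_wpM2r //.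
  apply: (@le_trans _ _ (`|C| / n%:R)); first by rewrite ler_wpM2r // ler_norm.
  by rewrite ler_pdivrMr // ler_peMr // ler1n.
have al0 : al = 0.
  (* Each ratio [1 / (i + 2)] is reached at the sizes [(i + 2) * (N + 1)] with [N + 1] fixed points.
     As [N] grows, [al_small] forces [al] to vanish there, and [size al] distinct roots are too many
     for a nonzero polynomial. *)
  pose rs := [seq (i.+2%:R)^-1 : R | i <- iota 0 (size al)].
  apply: (@roots_geq_poly_eq0 _ al rs).
  - apply/allP => _ /mapP[i _ ->]; rewrite /root.
    set x : R := i.+2%:R^-1.
    have small N : (n0 <= N)%N -> (0 < N)%N ->
        `|al.[x]| * (i.+2 * N.+1)%:R <= C1 + (b + c) + `|C|.
      move=> N0 Np; have [|s sx] := @fixed_points_exist R (i.+2 * N.+1)%N N.+1; first by lia.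
      have -> : x = fixed_ratio R s.
        by rewrite sx natrM invfM mulrCA divff ?mulr1 // pnatr_eq0.
      by apply: al_small; lia.
    apply: contraT => nz; have px : 0 < `|al.[x]| by rewrite normr_gt0.
    pose D := C1 + (b + c) + `|C|.
    have D0 : 0 <= D / `|al.[x]| by rewrite divr_ge0 // !addr_ge0.
    pose N := maxn n0.+1 (Num.bound (D / `|al.[x]|)).
    have := small N (leq_trans (leqnSn _) (leq_maxl _ _)) (leq_trans _ (leq_maxl _ _)).
    move=> /(_ isT); rewrite -/D mulrC -ler_pdivlMr // => hN.
    have := archi_boundP D0; rewrite ltNge => /negP[].
    apply: le_trans hN; rewrite ler_nat (leq_trans (leq_maxr n0.+1 _)) // -/N; lia.
  - rewrite map_inj_uniq ?iota_uniq // => i j /invr_inj/eqP.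
    by rewrite eqr_nat => /eqP[].
  - by rewrite size_map size_iota.
exists be, ga, C, n0 => n s npos nn0.
have nn : 0 < n%:R :> R by rewrite ltr0n.
have := H n s npos nn0; rewrite Vz // /expansion al0 horner0 add0r -mulrBl normrM.
rewrite [Num.norm (_^-1)]ger0_norm ?invr_ge0 ?ler0n // ler_pdivrMr //.
by rewrite expr2 invfM mulrA divfK // gt_eqF.
Qed.

(** * Gaussian moments *)

From mathcomp Require Import finmap all_classical all_reals all_analysis measurable_realfun.
Import Order.TTheory GRing.Theory Num.Theory.
Import numFieldNormedType.Exports.

Local Open Scope classical_set_scope.
Local Open Scope ring_scope.

Section GaussianMoments.
Variables (R : realType) (s : R).
Hypothesis s0 : s != 0.
Local Notation mu := (@lebesgue_measure R).
Local Notation p := (normal_pdf 0 s).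
Local Notation P := (normal_prob 0 s).

Let w : R := s ^+ 2 *+ 2.
Let w0 : 0 < w.
Proof. by rewrite /w pmulrn_lgt0 // exprn_even_gt0. Qed.

Lemma normal_pdf0E x : p x = normal_peak s * expR (- x ^+ 2 / w).
Proof. by rewrite /normal_pdf (negbTE s0) /normal_fun subr0. Qed.

(** For [|x| > 1] the power is at most [x ^+ r.*2], which one term of the exponential series
    controls. *)
Lemma exprn_le_expR (a x : R) r : 0 < a ->
  `|x| ^+ r <= (1 + a ^- r * r`!%:R) * expR (a * x ^+ 2).
Proof.
move=> a0; have ax : 0 <= a * x ^+ 2 by rewrite mulr_ge0 ?sqr_ge0 // ltW.
have e1 : 1 <= expR (a * x ^+ 2) by rewrite -expR0 ler_expR.
have er : (a * x ^+ 2) ^+ r <= r`!%:R * expR (a * x ^+ 2).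
  case: r => [|r]; first by rewrite expr0 fact0 mul1r.
  have : (a * x ^+ 2) ^+ r.+1 / r.+1`!%:R <= expR (a * x ^+ 2).
    by apply: le_trans (expR_ge1Dxn r ax); rewrite lerDr.
  by rewrite ler_pdivrMr ?ltr0n ?fact_gt0 // => h; rewrite [leRHS]mulrC.
rewrite mulrDl mul1r; have [x1|x1] := lerP `|x| 1.
  rewrite -[leLHS]addr0 lerD //; first by rewrite (le_trans _ e1) // exprn_ile1.
  by rewrite !mulr_ge0 ?invr_ge0 ?exprn_ge0 ?expR_ge0 // ltW.
apply: (@le_trans _ _ (`|x| ^+ r.*2)).
  by rewrite ler_weXn2l ?ltW // -addnn leq_addr.
rewrite -[leLHS]add0r lerD ?expR_ge0 // -mulrA.
rewrite mulrC -ler_pdivrMr ?invr_gt0 ?exprn_gt0 // invrK.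
by rewrite -mul2n exprM real_normK ?num_real // mulrC -exprMn.
Qed.

Lemma integrable_exprn_normal_pdf r :
  mu.-integrable [set: R] (fun x => (x ^+ r * p x)%:E).
Proof.
(* Half of the Gaussian exponent absorbs the power; the other half, [- x ^+ 2 / (2 * w)], is below
   the exponent [- x ^+ 2 / (4 * w)] of the density of standard deviation [2 * s]. *)
have a0 : 0 < (2 * w)^-1 by rewrite invr_gt0 mulr_gt0.
have s20 : 2 * s != 0 by rewrite mulf_neq0.
pose K : R := (1 + (2 * w)^-1 ^- r * r`!%:R) * (normal_peak s / normal_peak (2 * s)).
have mp : measurable_fun [set: R] (fun x : R => x ^+ r * p x).
  apply: measurable_funM; first exact: measurable_funX.
  exact: measurable_normal_pdf.
apply: (@le_integrable _ _ _ mu _ measurableT _ (fun x => K%:E * (normal_pdf 0 (2 * s) x)%:E)%E) => //.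
- exact/measurable_EFinP.
- move=> x _; rewrite /= lee_fin normrM [Num.norm (p x)]ger0_norm ?normal_pdf_ge0 //.
  have K0 : 0 <= K.
    rewrite mulr_ge0 // ?divr_ge0 ?normal_peak_ge0 // addr_ge0 // mulr_ge0 //.
    by rewrite invr_ge0 exprn_ge0 // ltW.
  have pd0 : 0 <= normal_pdf 0 (2 * s) x := normal_pdf_ge0 _ _ _.
  rewrite normrX [leRHS]ger0_norm; last by rewrite mulr_ge0.
  rewrite normal_pdf0E /normal_pdf (negbTE s20) /normal_fun subr0.
  apply: (le_trans (ler_wpM2r _ (exprn_le_expR x r a0))).
    by rewrite mulr_ge0 ?normal_peak_ge0 ?expR_ge0.
  set k := 1 + _ in K0 *; set B := expR (_ * x ^+ 2); set A := expR (- x ^+ 2 / w).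
  set D := expR (- x ^+ 2 / _).
  have k0 : 0 <= k by rewrite addr_ge0 // mulr_ge0 // invr_ge0 exprn_ge0 // ltW.
  have BAD : B * A <= D.
    rewrite -expRD ler_expR; have -> : (2 * s) ^+ 2 *+ 2 = 4 * w by rewrite /w; ring.
    have : 0 <= x ^+ 2 / w by rewrite divr_ge0 ?sqr_ge0 // ltW.
    by rewrite !invfM; lra.
  have c0 : normal_peak (2 * s) != 0 by rewrite gt_eqF // normal_peak_gt0.
  have -> : k * B * (normal_peak s * A) = k * normal_peak s * (B * A) by ring.
  have -> : K * (normal_peak (2 * s) * D) = k * normal_peak s * D.
    rewrite /K -/k -!mulrA; congr (_ * (_ * _)).
    by rewrite mulrA mulVf // mul1r.
  by rewrite ler_wpM2l // mulr_ge0 // normal_peak_ge0.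
- by apply: integrableZl => //; exact: integrable_normal_pdf.
Qed.

(** The density is the Radon-Nikodym derivative. The change of variables is first applied to [|f|],
    to obtain integrability under [P], and then to [f]. *)
Lemma integral_normal_probE (f : R -> R) : measurable_fun [set: R] f ->
  mu.-integrable [set: R] (fun x => (f x * p x)%:E) ->
  (\int[P]_x (f x)%:E = \int[mu]_x (f x * p x)%:E)%E /\
  P.-integrable [set: R] (fun x => (f x)%:E).
Proof.
move=> mf intf; have dom := normal_prob_dominates 0 s.
have mp : measurable_fun [set: R] p by exact: measurable_normal_pdf.
have RN : ae_eq mu [set: R]
    (Radon_Nikodym (charge_of_finite_measure P) mu) (fun x => (p x)%:E).
  rewrite Radon_NikodymE //=; case: cid => /= h [h1 h2 h3].
  apply: integral_ae_eq => //=.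
  - exact/measurable_EFinP.
  - by move=> E _ mE; rewrite -h3.
have RNi : mu.-integrable [set: R] (Radon_Nikodym (charge_of_finite_measure P) mu).
  by apply: Radon_Nikodym_integrable; exact: normal_prob_dominates.
have fin : P.-integrable [set: R] (fun x => (f x)%:E).
  apply/integrableP; split; first exact/measurable_EFinP.
  have -> : (\int[P]_x `|(f x)%:E| = \int[mu]_x `|(f x * p x)%:E|)%E.
    rewrite -(Radon_Nikodym_SigmaFinite.change_of_variables dom) //; last first.
      by apply/measurable_EFinP; exact: measurableT_comp.
    apply: ae_eq_integral => //.
    - apply: emeasurable_funM; first by apply/measurable_EFinP; exact: measurableT_comp.
      exact: measurable_int (Radon_Nikodym_SigmaFinite.f_integrable dom).
    - by apply: measurableT_comp => //; exact: measurable_int intf.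
    - have E1 := ae_eq_Radon_Nikodym_SigmaFinite dom measurableT.
      have E2 := ae_eq_trans E1 RN.
      have -> : (fun x => `|(f x * p x)%:E|%E) = (fun x => `|(f x)%:E| * (p x)%:E)%E.
        by apply/funext => x; rewrite /= -EFinM normrM [Num.norm (p x)]ger0_norm // normal_pdf_ge0.
      by apply: ae_eqe_mul2l; exact: E2.
  by have /integrableP[_] := intf.
split=> //; rewrite -(Radon_Nikodym_change_of_variables dom) //.
apply: ae_eq_integral => //.
- apply: emeasurable_funM; first exact/measurable_EFinP.
  exact: measurable_int RNi.
- exact: measurable_int intf.
- have -> : (fun x => (f x * p x)%:E) = (fun x => (f x)%:E * (p x)%:E)%E.
    by apply/funext => x; rewrite EFinM.
  by apply: ae_eqe_mul2l; exact: RN.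
Qed.

Lemma is_derive_exprn_normal_pdf r (x : R) :
  is_derive x 1 (fun y => y ^+ r * p y)
    ((r%:R * x ^+ r.-1 - x ^+ r.+1 / s ^+ 2) * p x).
Proof.
have -> : (s ^+ 2)^-1 = 2 / w by rewrite /w; field.
have -> : p = fun y => normal_peak s * expR (- y ^+ 2 / w).
  by apply/funext => y; rewrite normal_pdf0E.
have wn0 : w != 0 by rewrite gt_eqF.
have h1 : is_derive x 1 (fun x : R => - x ^+ 2 / w) (- (2 * x) / w).
  have -> : (fun x : R => - x ^+ 2 / w) = (fun x : R => - w^-1 * x ^+ 2).
    by apply/funext => y; ring.
  by apply: is_derive_eq; rewrite /GRing.scale /= ?expr1 ?mulr1; ring.
have h2 : is_derive x 1 (fun x : R => expR (- x ^+ 2 / w))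
    (expR (- x ^+ 2 / w) * (- (2 * x) / w)).
  exact: (@is_derive1_comp _ expR (fun x : R => - x ^+ 2 / w)).
have h3 : is_derive x 1 (fun x : R => x ^+ r) (r%:R * x ^+ r.-1).
  have := is_deriveX (f := @id R) r (is_derive_id x 1).
  by rewrite exprfctE /GRing.scale /= mulr1.
have h4 := is_deriveM h3 (is_deriveZ (normal_peak s) h2).
refine (is_derive_eq h4 _).
rewrite /GRing.scale /=.
rewrite /GRing.scale_fun /GRing.scale /=.
clear h1 h2 h3 h4; move: (expR _) (normal_peak s) => E K.
clearbody w; case: r => [|r] /=; rewrite ?exprS; first by ring.
by ring.
Qed.

Lemma continuous_exprn_normal_pdf r : continuous (fun y : R => y ^+ r * p y : R).
Proof.
move=> x; apply/differentiable_continuous/derivable1_diffP.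
by have [] := is_derive_exprn_normal_pdf r x.
Qed.

Lemma exprn_normal_pdf_cvg0 r (u : R ^nat) : (forall n, `|u n| = n.+1%:R) ->
  u n ^+ r * p (u n) @[n --> \oo] --> (0 : R).
Proof.
move=> hu; have w1 : 0 < w^-1 by rewrite invr_gt0.
pose K : R := (1 + w^-1 ^- r.+1 * r.+1`!%:R) * normal_peak s.
have b n : `|u n ^+ r * p (u n)| <= K * n.+1%:R^-1.
  rewrite ler_pdivlMr // normrM normrX [Num.norm (p _)]ger0_norm ?normal_pdf_ge0 //.
  rewrite mulrAC -[X in _ * X * _](hu n) -exprSr normal_pdf0E.
  apply: (le_trans (ler_wpM2r _ (exprn_le_expR (u n) r.+1 w1))).
    by rewrite mulr_ge0 ?normal_peak_ge0 ?expR_ge0.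
  have -> : - u n ^+ 2 / w = - (w^-1 * u n ^+ 2) by ring.
  rewrite /K -!mulrA [expR _ * _]mulrCA -expRD subrr expR0 mulr1.
  by rewrite lexx.
apply: (@squeeze_cvgr _ _ _ _ (fun n => - (K * n.+1%:R^-1)) (fun n => K * n.+1%:R^-1)).
- by apply: nearW => n; rewrite -ler_norml.
- rewrite -oppr0 -(mulr0 K); apply: cvgN; apply: cvgMl_tmp; exact: cvg_harmonic.
- rewrite -(mulr0 K); apply: cvgMl_tmp; exact: cvg_harmonic.
Qed.

(** The integrand is the derivative of [x ^+ r * p x]: its integral over growing symmetric intervals
    is a boundary term that vanishes in the limit, and dominated convergence identifies that limit
    with the full integral. *)
Lemma integral_derive_exprn_normal_pdf r :
  (\int[mu]_x ((r%:R * x ^+ r.-1 - x ^+ r.+1 / s ^+ 2) * p x)%:E = 0)%E.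
Proof.
set f := fun x : R => (r%:R * x ^+ r.-1 - x ^+ r.+1 / s ^+ 2) * p x.
have fE : f = (fun x => r%:R * (x ^+ r.-1 * p x) - (s ^+ 2)^-1 * (x ^+ r.+1 * p x)).
  by apply/funext => x; rewrite /f; ring.
have cf : continuous f.
  rewrite fE => x; apply: cvgB; apply: cvgMl_tmp; exact: continuous_exprn_normal_pdf.
have fi : mu.-integrable [set: R] (EFin \o f).
  rewrite fE (_ : EFin \o _ = fun x => (r%:R%:E * (x ^+ r.-1 * p x)%:E
     - (s ^+ 2)^-1%:E * (x ^+ r.+1 * p x)%:E)%E); last first.
    by apply/funext => x; rewrite /= EFinB !EFinM.
  by apply: integrableB => //; apply: integrableZl => //; exact: integrable_exprn_normal_pdf.
pose B n : set R := `[- n.+1%:R, n.+1%:R]%classic.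
have FTC n : (\int[mu]_(x in B n) (f x)%:E =
    (n.+1%:R ^+ r * p n.+1%:R - (- n.+1%:R) ^+ r * p (- n.+1%:R))%:E)%E.
  rewrite EFinB; apply: (continuous_FTC2 (F := fun y => y ^+ r * p y)).
  - by rewrite gtrN.
  - exact: continuous_subspaceT.
  - split.
    + by move=> x _; have [] := is_derive_exprn_normal_pdf r x.
    + by apply: cvg_at_right_filter; exact: continuous_exprn_normal_pdf.
    + by apply: cvg_at_left_filter; exact: continuous_exprn_normal_pdf.
  - move=> x _; rewrite derive1E; have h := is_derive_exprn_normal_pdf r x.
    by rewrite derive_val.
have dom : ((\int[mu]_x ((EFin \o f) \_ (B n)) x) @[n --> \oo] --> \int[mu]_x (f x)%:E)%E.
  apply: (@dominated_cvg _ _ _ mu [set: R] measurableT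
    (fun n => (EFin \o f) \_ (B n)) _ (fun x => `|(f x)%:E|%E)) => //.
  - move=> n; apply/(measurable_restrictT _ _).1 => //; first exact: measurable_itv.
    by apply: measurable_funTS; exact: measurable_int fi.
  - move=> x _; apply: cvg_near_cst; near=> n.
    rewrite patchE mem_set // /B /= in_itv /= -ler_norml.
    apply: (@le_trans _ _ n%:R); last by rewrite ler_nat.
    near: n; exact: nbhs_infty_ger.
  - exact: integrable_abse.
  - move=> n x _; rewrite patchE; case: ifP => // _; rewrite /= normr0 lee_fin //.
have lim0 : ((\int[mu]_x ((EFin \o f) \_ (B n)) x) @[n --> \oo] --> 0)%E.
  under eq_fun do rewrite -integral_mkcond FTC.
  apply: cvg_EFin; first by apply: nearW.
  rewrite [X in X @ _ --> _](_ : _ = fun n : nat =>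
    n.+1%:R ^+ r * p n.+1%:R - (- n.+1%:R) ^+ r * p (- n.+1%:R)) //.
  rewrite -[X in _ --> X](subrr (0 : R)); apply: cvgB.
    apply: (@exprn_normal_pdf_cvg0 r (fun n => n.+1%:R)) => n.
    by rewrite ger0_norm.
  apply: (@exprn_normal_pdf_cvg0 r (fun n => - n.+1%:R)) => n.
  by rewrite normrN ger0_norm.
exact: cvg_unique dom lim0.
Unshelve. all: by end_near. Qed.

Lemma integral_exprn_normal_pdf_rec r (a b : R) :
  (\int[mu]_x (x ^+ r.-1 * p x)%:E = a%:E)%E ->
  (\int[mu]_x (x ^+ r.+1 * p x)%:E = b%:E)%E -> b = r%:R * s ^+ 2 * a.
Proof.
move=> ha hb; have := integral_derive_exprn_normal_pdf r.
have -> : (fun x : R => ((r%:R * x ^+ r.-1 - x ^+ r.+1 / s ^+ 2) * p x)%:E) =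
    (fun x => r%:R%:E * (x ^+ r.-1 * p x)%:E - (s ^+ 2)^-1%:E * (x ^+ r.+1 * p x)%:E)%E.
  by apply/funext => x; rewrite -!EFinM -EFinB; congr (_%:E); ring.
have ii q := integrable_exprn_normal_pdf q.
rewrite integralB //; try by apply: integrableZl => //; exact: ii.
rewrite !integralZl //; try exact: ii.
rewrite ha hb -!EFinM -EFinB => -[] h.
have s2 : s ^+ 2 != 0 by rewrite expf_neq0.
have -> : b = s ^+ 2 * ((s ^+ 2)^-1 * b) by rewrite mulrA divff // mul1r.
by rewrite -[X in _ * X](subKr (r%:R * a)) h subr0; ring.
Qed.

End GaussianMoments.

Fixpoint gaussian_moment (R : pzRingType) (v : R) (r : nat) : R :=
  match r with
  | 0 => 1
  | 1 => 0
  | r'.+2 => r'.+1%:R * v * gaussian_moment v r'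
  end.

Lemma gaussian_momentP (R : realType) (v : R) : 0 <= v -> forall r,
  (gaussian v).-integrable [set: R] (fun x : R => (x ^+ r)%:E) /\
  (\int[gaussian v]_x (x ^+ r)%:E = (gaussian_moment v r)%:E)%E.
Proof.
move=> v0 r; rewrite /gaussian; have [->|vn0] := eqVneq v 0.
  have mr : measurable_fun [set: R] (fun x : R => (x ^+ r)%:E).
    by apply/measurable_EFinP; exact: measurable_funX.
  split.
    apply/integrableP; split=> //.
    rewrite integral_dirac //= ?diracT ?mul1e ?ltry //.
    by apply/measurable_EFinP; apply: measurableT_comp => //; exact: measurable_funX.
  rewrite integral_dirac // diracT mul1e expr0n.
  by case: r {mr} => [|[|r]] //=; rewrite mulr0 mul0r.
have s0 : Num.sqrt v != 0 by rewrite sqrtr_eq0 -ltNge lt_neqAle eq_sym vn0.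
have mr q : measurable_fun [set: R] (fun x : R => x ^+ q) by exact: measurable_funX.
have h q := integral_normal_probE (mr q) (integrable_exprn_normal_pdf s0 q).
split; first by have [] := h r.
rewrite (h r).1.
have m0 : (\int[lebesgue_measure]_x (x ^+ 0 * normal_pdf 0 (Num.sqrt v) x)%:E = 1%:E)%E.
  by rewrite -(h 0%N).1 (_ : (fun=> _) = cst 1%E) // integral_cst // mul1e; exact: probability_setT.
have [q ->] : exists q, r = q by exists r.
have fin q' : (\int[lebesgue_measure]_x (x ^+ q' * normal_pdf 0 (Num.sqrt v) x)%:E)%E \is a fin_num.
  apply: integrable_fin_num => //; exact: integrable_exprn_normal_pdf.
suff : (\int[lebesgue_measure]_x (x ^+ q * normal_pdf 0 (Num.sqrt v) x)%:E = (gaussian_moment v q)%:E /\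
  \int[lebesgue_measure]_x (x ^+ q.+1 * normal_pdf 0 (Num.sqrt v) x)%:E = (gaussian_moment v q.+1)%:E)%E.
  by case.
elim: q => [|q [IH1 IH2]]; split=> //; rewrite -(fineK (fin _)); congr (_%:E).
  (* At [r = 0] the predecessor is [0] and its coefficient vanishes, so the recursion gives the
     first moment. *)
  rewrite (integral_exprn_normal_pdf_rec (r := 0) s0 m0 (esym (fineK (fin 1%N)))).
  by rewrite !mul0r.
rewrite (integral_exprn_normal_pdf_rec (r := q.+1) s0 IH1 (esym (fineK (fin q.+2)))).
by rewrite sqr_sqrtr.
Qed.

(** * The method of moments *)

Section CosTaylor.
Variable R : realType.
Implicit Types (a t x y : R) (f g : R -> R).

Lemma ge0_derive_le f (df : R -> R) y : 0 <= y ->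
  (forall z : R, is_derive z 1 f (df z)) -> (forall z, 0 <= z -> 0 <= df z) ->
  f 0 <= f y.
Proof.
move=> y0 h df0; have [z|c /andP[c0 _] e] := @MVT_segment _ f df 0 y y0 (fun z _ => h z).
  apply/continuous_subspaceT => u; apply/differentiable_continuous/derivable1_diffP.
  by have [] := h u.
by rewrite -subr_ge0 e subr0 mulr_ge0 // df0.
Qed.

Lemma is_derive_monomial (c : R) k x :
  is_derive x 1 (fun y => c * y ^+ k.+1) (c * (k.+1%:R * x ^+ k)).
Proof.
have h : is_derive x 1 (fun x : R => x ^+ k.+1) (k.+1%:R * x ^+ k).
  have := is_deriveX (f := @id R) k.+1 (is_derive_id x 1).
  by rewrite exprfctE /GRing.scale /= mulr1.
exact: (is_deriveZ c h).
Qed.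

(** Takes the place of integrating the bound on [dg]: the monomial plus or minus [g] is
    nondecreasing for nonnegative arguments. *)
Lemma derive_bound g (dg : R -> R) (K : R) k y : 0 <= y ->
  (forall z : R, is_derive z 1 g (dg z)) -> g 0 = 0 ->
  (forall z, 0 <= z -> `|dg z| <= K * z ^+ k / k`!%:R) ->
  `|g y| <= K * y ^+ k.+1 / k.+1`!%:R.
Proof.
move=> y0 hg g0 hb.
have kf : k.+1`!%:R = k.+1%:R * k`!%:R :> R by rewrite factS natrM.
have k1 : k.+1%:R != 0 :> R by rewrite pnatr_eq0.
have k2 : k`!%:R != 0 :> R by rewrite pnatr_eq0 -lt0n fact_gt0.
pose c : R := K / k.+1`!%:R.
have dc z : c * (k.+1%:R * z ^+ k) = K * z ^+ k / k`!%:R.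
  by rewrite /c kf; move: (k.+1%:R) k1 (k`!%:R) k2 (z ^+ k) => *; field; apply/andP.
have -> : K * y ^+ k.+1 / k.+1`!%:R = c * y ^+ k.+1 by rewrite mulrAC.
rewrite ler_norml; apply/andP; split.
  rewrite -subr_ge0 opprK.
  have := @ge0_derive_le (fun z => g z + c * z ^+ k.+1) (fun z => dg z + c * (k.+1%:R * z ^+ k)) y y0.
  rewrite g0 expr0n mulr0 addr0; apply.
    by move=> z; apply: is_deriveD; exact: is_derive_monomial.
  by move=> z /hb; rewrite dc ler_norml => /andP[h _]; rewrite -subr_ge0 opprK in h; rewrite h.
rewrite -subr_ge0.
have := @ge0_derive_le (fun z => c * z ^+ k.+1 - g z) (fun z => c * (k.+1%:R * z ^+ k) - dg z) y y0.
rewrite g0 expr0n mulr0 subr0; apply.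
  by move=> z; apply: is_deriveB; exact: is_derive_monomial.
by move=> z /hb; rewrite dc ler_norml subr_ge0 => /andP[].
Qed.

(** Taylor polynomial of [cos (a + t * y)] in [y], with [k] terms. Each derivative adds [pi / 2] to
    the phase, so that cosines with a free phase are closed under differentiation. *)
Fixpoint cos_taylor (k : nat) a t y : R :=
  if k is k'.+1 then
    t ^+ k' * cos (a + k'%:R * (pi / 2)) / k'`!%:R * y ^+ k' + cos_taylor k' a t y
  else 0.

Lemma cos_taylor0 k a t : cos_taylor k.+1 a t 0 = cos a.
Proof.
elim: k => [|k IH] /=; first by rewrite !expr0 mul0r !addr0 divr1 mulr1 mul1r.
by rewrite -/(cos_taylor k.+1 a t 0) IH expr0n mulr0 add0r.
Qed.

Lemma is_derive_cos_taylor k a t y :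
  is_derive y 1 (cos_taylor k.+1 a t) (t * cos_taylor k (a + pi / 2) t y).
Proof.
elim: k => [|k IH].
  rewrite (_ : cos_taylor 1 a t = fun=> cos_taylor 1 a t 0); last first.
    by apply/funext => z; rewrite /= !expr0.
  by rewrite /= mulr0; exact: is_derive_cst.
have -> : cos_taylor k.+2 a t = (fun y =>
  t ^+ k.+1 * cos (a + k.+1%:R * (pi / 2)) / k.+1`!%:R * y ^+ k.+1 + cos_taylor k.+1 a t y) by [].
refine (is_derive_eq (is_deriveD (is_derive_monomial _ _ _) IH) _).
have kf : k.+1`!%:R = k.+1%:R * k`!%:R :> R by rewrite factS natrM.
have k1 : k.+1%:R != 0 :> R by rewrite pnatr_eq0.
have k2 : k`!%:R != 0 :> R by rewrite pnatr_eq0 -lt0n fact_gt0.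
have -> : a + k.+1%:R * (pi / 2) = a + pi / 2 + k%:R * (pi / 2).
  by rewrite -natr1; ring.
rewrite [in RHS]/= mulrDr; congr (_ + _).
rewrite exprS kf; move: (cos _) (k.+1%:R) k1 (k`!%:R) k2 (t ^+ k) (y ^+ k) => *.
by field; apply/andP.
Qed.

Lemma cos_taylor_bound_ge0 k a t y : 0 <= y ->
  `|cos (a + t * y) - cos_taylor k a t y| <= `|t| ^+ k * y ^+ k / k`!%:R.
Proof.
elim: k a y => [|k IH] a y y0.
  by rewrite subr0 !expr0 fact0 divr1 mulr1 ler_norml cos_geN1 cos_le1.
apply: (@derive_bound (fun z => cos (a + t * z) - cos_taylor k.+1 a t z)
  (fun z => t * (cos (a + pi / 2 + t * z) - cos_taylor k (a + pi / 2) t z)) (`|t| ^+ k.+1) k y y0).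
- move=> z; rewrite mulrBr.
  apply: is_deriveB; last exact: is_derive_cos_taylor.
  have h : is_derive z 1 (fun z => a + t * z) t.
    refine (is_derive_eq (is_deriveD (is_derive_cst _ _ _) (is_deriveZ t (is_derive_id z 1))) _).
    by rewrite add0r /GRing.scale /= mulr1.
  refine (is_derive_eq (@is_derive1_comp _ cos (fun z => a + t * z) _ _ _ (is_derive_cos _) h) _).
  have -> : a + pi / 2 + t * z = a + t * z + pi / 2 by ring.
  by rewrite cosD cos_pihalf sin_pihalf; ring.
- by rewrite cos_taylor0 mulr0 addr0 subrr.
- move=> z z0; rewrite normrM exprS -!mulrA ler_wpM2l //.
  by rewrite mulrA; exact: IH.
Qed.

Lemma cos_taylorN k a t y : cos_taylor k a (- t) (- y) = cos_taylor k a t y.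
Proof.
elim: k => //= k ->; congr (_ + _).
have -> : (- t) ^+ k = (-1) ^+ k * t ^+ k by rewrite -exprNn.
have -> : (- y) ^+ k = (-1) ^+ k * y ^+ k by rewrite -exprNn.
have : (-1) ^+ k * (-1) ^+ k = 1 :> R by rewrite -expr2 sqrr_sign.
by move: ((-1) ^+ k) => e ee; rewrite -[RHS]mul1r -ee; ring.
Qed.

Lemma cos_taylor_bound k a t x :
  `|cos (a + t * x) - cos_taylor k a t x| <= `|t * x| ^+ k / k`!%:R.
Proof.
rewrite normrM exprMn; have [x0|x0] := ger0P x.
  exact: cos_taylor_bound_ge0.
have := @cos_taylor_bound_ge0 k a (- t) (- x).
rewrite oppr_ge0 mulrNN cos_taylorN normrN; apply; exact: ltW.
Qed.

End CosTaylor.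

(** The right-hand side is a term of an exponential series: the mean of the Taylor remainder of a
    cosine tends to zero. *)
Lemma gaussian_moment_even (R : realType) (v : R) J :
  gaussian_moment v J.*2 / J.*2`!%:R = (v / 2) ^+ J / J`!%:R.
Proof.
elim: J => [|J IH]; first by rewrite expr0.
rewrite doubleS [gaussian_moment _ _]/= exprSr !factS !natrM.
have n1 : J.*2.+1%:R != 0 :> R by rewrite pnatr_eq0.
have n2 : J.+1%:R != 0 :> R by rewrite pnatr_eq0.
have n3 : J.*2`!%:R != 0 :> R by rewrite pnatr_eq0 -lt0n fact_gt0.
have n4 : J`!%:R != 0 :> R by rewrite pnatr_eq0 -lt0n fact_gt0.
have -> : J.*2.+2%:R = 2 * J.+1%:R :> R by rewrite -doubleS -muln2 natrM mulrC.
transitivity (v / 2 / J.+1%:R * (gaussian_moment v J.*2 / J.*2`!%:R)).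
  move: (J.*2.+1%:R) n1 (J.+1%:R) n2 (J.*2`!%:R) n3 => *; field.
  by repeat (apply/andP; split).
rewrite IH; move: (J.+1%:R) n2 (J`!%:R) n4 ((v / 2) ^+ J) => *; field.
by apply/andP.
Qed.

Section BinomialMean.
Variable R : realType.
Implicit Types (y : R) (phi psi : nat -> R).

(* The expectation of [phi S] for [S] binomial with parameters [N] and [y]. *)
Fixpoint binomial_mean N y phi : R :=
  if N is N'.+1 then
    (1 - y) * binomial_mean N' y phi + y * binomial_mean N' y (fun j => phi j.+1)
  else phi 0%N.

Lemma binomial_mean_lin N y (a : R) phi psi :
  binomial_mean N y (fun j => a * phi j + psi j) =
  a * binomial_mean N y phi + binomial_mean N y psi.
Proof. by elim: N phi psi => //= N IH phi psi; rewrite !IH; ring. Qed.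

Lemma ler_binomial_mean N y phi psi : 0 <= y <= 1 ->
  (forall j, phi j <= psi j) -> binomial_mean N y phi <= binomial_mean N y psi.
Proof.
move=> /andP[y0 y1]; elim: N phi psi => [|N IH] phi psi h //=.
by apply: lerD; apply: ler_wpM2l; rewrite ?subr_ge0 //; apply: IH.
Qed.

Lemma binomial_mean_cst N y (a : R) : binomial_mean N y (fun=> a) = a.
Proof. by elim: N => //= N ->; ring. Qed.

(** The shift [a] makes the induction close, a success replacing [a] by [a + 1]. *)
Lemma binomial_mean_sqr N y (a : R) :
  binomial_mean N y (fun j => (a + j%:R) ^+ 2) = (a + N%:R * y) ^+ 2 + N%:R * (y * (1 - y)).
Proof.
elim: N a => [|N IH] a /=; first by ring.
rewrite IH (_ : (fun j : nat => (a + j.+1%:R) ^+ 2) = fun j => (a + 1 + j%:R) ^+ 2).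
  by rewrite IH -natr1; ring.
by apply/funext => j; rewrite -natr1 -addrA [1 + _]addrC.
Qed.

End BinomialMean.

(* Uniform continuity on compacts and boundedness, in a form that can be averaged
   against a binomial law knowing its variance only. *)
Lemma continuous_quadratic_modulus (R : realType) (h : R -> R) (B M e : R) :
  continuous h -> (forall x, `|h x| <= B) -> 0 < e ->
  exists2 K, 0 <= K &
    forall x z, `|x| <= M -> `|h z - h x| <= e + K * (z - x) ^+ 2.
Proof.
move=> ch hB e0; have B0 : 0 <= B := le_trans (normr_ge0 _) (hB 0).
have cpt : compact (`[- M, M] : set R) by exact: segment_compact.
have : \forall d \near (0 : R)^'+, `[- M, M]%classic `<=`
    (fun x => forall z, `|z - x| < d -> `|h z - h x| <= e).
  move/compact_near_coveringP : cpt; apply => x _.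
  have /cvgrPdist_le /(_ (e / 2)) := ch x.
  rewrite divr_gt0 // => /(_ isT) /nbhs_ballP[d /= d0 hd].
  exists (ball x (d / 2), [set t : R | t < d / 2]).
    split; first by apply/nbhs_ballP; exists (d / 2) => //=; rewrite divr_gt0.
    by apply: nbhs_right_lt; rewrite divr_gt0.
  move=> [x' t] [/= xx' td] z zx'.
  have h1 : `|h x - h x'| <= e / 2.
    apply: hd; apply: lt_le_trans xx' _; lra.
  have h2 : `|h x - h z| <= e / 2.
    apply: hd; rewrite /ball /=.
    rewrite (le_lt_trans (ler_distD x' _ _)) // (splitr d) ltrD //.
    by rewrite distrC; apply: lt_trans zx' td.
  move: h1 h2; rewrite !ler_norml => /andP[? ?] /andP[? ?]; apply/andP; split; lra.
move=> h0; have [d [/= d0 hd0]] := filter_ex (filterI (nbhs_right_gt (0 : R)) h0).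
have hd x z : `|x| <= M -> `|z - x| < d -> `|h z - h x| <= e.
  by move=> xM; apply: hd0; rewrite /= in_itv /= -ler_norml.
(* Beyond distance [d], the trivial bound [2 * B] is at most this constant times [(z - x) ^+ 2]. *)
exists (2 * B / d ^+ 2); first by rewrite divr_ge0 ?sqr_ge0 ?mulr_ge0.
move=> x z xM; have [zx|zx] := ltP `|z - x| d.
  rewrite (le_trans (hd _ _ xM zx)) // lerDl mulr_ge0 ?sqr_ge0 //.
  by rewrite divr_ge0 ?sqr_ge0 ?mulr_ge0.
apply: (@le_trans _ _ (2 * B)).
  by rewrite (le_trans (ler_normB _ _)) // mulr2n mulrDl !mul1r lerD.
rewrite -[leLHS]add0r; apply: lerD; first exact: ltW.
have -> : 2 * B / d ^+ 2 * (z - x) ^+ 2 = 2 * B * ((z - x) ^+ 2 / d ^+ 2) by ring.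
rewrite ler_peMr ?mulr_ge0 //.
rewrite ler_pdivlMr ?exprn_gt0 // mul1r -(real_normK (num_real (z - x))).
by rewrite ler_pXn2r ?nnegrE // ltW.
Qed.

(** * From convergence of moments to bounded continuous functions *)

Section MomentMethod.
Variables (R : realType) (v : R).
Variables (L : nat -> (R -> R) -> R) (D : (R -> R) -> Prop) (E : (R -> R) -> R).
Implicit Types (f g u h : R -> R) (a t c : R).

Hypothesis L_lin : forall n a f g,
  L n (fun x => a * f x + g x) = a * L n f + L n g.
Hypothesis L_mono : forall n f g, (forall x, f x <= g x) -> L n f <= L n g.
Hypothesis D_lin : forall a f g, D f -> D g -> D (fun x => a * f x + g x).
Hypothesis D_bounded : forall f B, continuous f -> (forall x, `|f x| <= B) -> D f.
Hypothesis E_lin : forall a f g, D f -> D g ->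
  E (fun x => a * f x + g x) = a * E f + E g.
Hypothesis E_mono : forall f g, D f -> D g -> (forall x, f x <= g x) -> E f <= E g.
Hypothesis D_exprn : forall r, D (fun x => x ^+ r).
Hypothesis E_exprn : forall r, E (fun x => x ^+ r) = gaussian_moment v r.
Hypothesis L_exprn : forall r,
  L n (fun x => x ^+ r) @[n --> \oo] --> gaussian_moment v r.

Let cv f := D f /\ L n f @[n --> \oo] --> E f.

Let cv_lin a f g : cv f -> cv g -> cv (fun x => a * f x + g x).
Proof.
move=> [Df Lf] [Dg Lg]; split; first exact: D_lin.
rewrite E_lin // (_ : (fun n => L n _) = fun n => a * L n f + L n g); last first.
  by apply/funext => n; rewrite L_lin.
by apply: cvgD => //; exact: cvgMl_tmp.
Qed.

Let cv_exprn r : cv (fun x => x ^+ r).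
Proof. by split=> //; rewrite E_exprn. Qed.

Let cv0 : cv (fun=> 0).
Proof.
have := cv_lin (-1) (cv_exprn 0) (cv_exprn 0); congr (cv _); apply/funext => x.
by rewrite mulN1r addNr.
Qed.

Let cvZ a f : cv f -> cv (fun x => a * f x).
Proof.
move=> cf; have := cv_lin a cf cv0; congr (cv _); apply/funext => x.
by rewrite addr0.
Qed.

Let E0 : E (fun=> 0) = 0.
Proof.
have -> : (fun=> 0) = (fun x : R => -1 * x ^+ 0 + x ^+ 0).
  by apply/funext => x; rewrite mulN1r addNr.
by rewrite E_lin // mulN1r addNr.
Qed.

Let EZ a f : cv f -> E (fun x => a * f x) = a * E f.
Proof.
move=> cf; have -> : (fun x => a * f x) = (fun x => a * f x + 0).
  by apply/funext => x; rewrite addr0.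
by rewrite E_lin ?E0 ?addr0 //; [exact: cf.1 | exact: cv0.1].
Qed.

(* Since [u] itself belongs to the class, a polynomial error bound with a small
   limiting mean is enough. *)
Let cv_approx f : D f ->
  (forall e, 0 < e -> exists g u,
     [/\ cv g, cv u, forall x, `|f x - g x| <= u x & E u <= e]) -> cv f.
Proof.
move=> Df h; split=> //; apply/cvgrPdist_le => e e0.
(* The mean of [u] is used twice, and the convergence for [g] and for [u] once each: four fifths of
   [e] in all. *)
have [g [u [cg cu fgu Eu]]] := h (e / 5) (divr_gt0 e0 (ltr0Sn _ _)).
have e5 : 0 < e / 5 by rewrite divr_gt0.
have /cvgrPdist_le /(_ _ e5) Lg := cg.2.
have /cvgrPdist_le /(_ _ e5) Lu := cu.2.
have one_lin f1 f2 : (fun x => f1 x + f2 x) = (fun x : R => 1 * f1 x + f2 x).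
  by apply/funext => x; rewrite mul1r.
have LD n f1 f2 : L n (fun x => f1 x + f2 x) = L n f1 + L n f2.
  by rewrite one_lin L_lin mul1r.
have ED f1 f2 : D f1 -> D f2 -> E (fun x => f1 x + f2 x) = E f1 + E f2.
  by move=> *; rewrite one_lin E_lin // mul1r.
have DD f1 f2 : D f1 -> D f2 -> D (fun x => f1 x + f2 x).
  by move=> *; rewrite one_lin; exact: D_lin.
have fg x : f x <= g x + u x.
  by have := fgu x; rewrite ler_norml => /andP[_]; lra.
have gf x : g x <= f x + u x.
  by have := fgu x; rewrite ler_norml => /andP[+ _]; lra.
have Efg := E_mono Df (DD _ _ cg.1 cu.1) fg.
have Egf := E_mono cg.1 (DD _ _ Df cu.1) gf.
have [Dg _] := cg; have [Du _] := cu.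
rewrite !ED // in Efg Egf.
near=> n.
have := L_mono n fg; have := L_mono n gf; rewrite !LD.
have : `|E g - L n g| <= e / 5 by near: n.
have : `|E u - L n u| <= e / 5 by near: n.
rewrite !ler_norml => /andP[? ?] /andP[? ?] ? ?; apply/andP; split; lra.
Unshelve. all: by end_near. Qed.

Let cv_cos_taylor k a t : cv (cos_taylor k a t).
Proof. by elim: k => [|k IH] /=; [exact: cv0 | exact: cv_lin (cv_exprn k) IH]. Qed.

Let cv_cos a t : cv (fun x => cos (a + t * x)).
Proof.
apply: cv_approx.
  apply: (@D_bounded _ 1); last by move=> x; rewrite ler_norml cos_geN1 cos_le1.
  move=> x; apply: continuous_comp; last exact: continuous_cos.
  by apply: cvgD; [exact: cvg_cst | apply: cvgMl_tmp].
(* The Taylor remainder of even order has as its Gaussian mean the exponential-series term of [w],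
   which is small for a suitable [J]. *)
move=> e e0; pose w := t ^+ 2 * v / 2.
have /cvgrPdist_le /(_ _ e0) := cvg_exp_coeff w.
move=> [J _ /(_ J (leqnn J))] /=; rewrite sub0r normrN => wJ.
pose b : R := t ^+ J.*2 / J.*2`!%:R.
exists (cos_taylor J.*2 a t), (fun x => b * x ^+ J.*2); split=> //.
- exact: cvZ.
- move=> x; apply: le_trans (cos_taylor_bound _ _ _ _) _.
  rewrite -mul2n exprM real_normK ?num_real // -exprM exprMn /b mul2n.
  by rewrite mulrAC lexx.
rewrite EZ // E_exprn /b mulrAC -mulrA gaussian_moment_even.
apply: le_trans wJ; apply: le_trans (ler_norm _).
rewrite /exp_coeff /= /w -mul2n exprM.
have -> : t ^+ 2 * v / 2 = t ^+ 2 * (v / 2) by ring.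
by rewrite [(t ^+ 2 * _) ^+ J]exprMn mulrA lexx.
Qed.

(** Unlike [cv], this class is stable under multiplication by [sin (c * x)], which merely shifts
    phases and frequencies. *)
Let trig f := forall a t, cv (fun x => cos (a + t * x) * f x).

Let trig_cst b : trig (fun=> b).
Proof.
move=> a t; have := cvZ b (cv_cos a t); congr (cv _); apply/funext => x.
by rewrite mulrC.
Qed.

Let trig_lin b f g : trig f -> trig g -> trig (fun x => b * f x + g x).
Proof.
move=> tf tg a t; have := cv_lin b (tf a t) (tg a t).
by congr (cv _); apply/funext => x; ring.
Qed.

Let trig_sin c f : trig f -> trig (fun x => sin (c * x) * f x).
Proof.
move=> tf a t.
have := cv_lin 2^-1 (tf (a - pi / 2) (t + c)) (cvZ (- 2^-1) (tf (a - pi / 2) (t - c))).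
congr (cv _); apply/funext => x.
have e1 : a - pi / 2 + (t + c) * x = (a + t * x + c * x) - pi / 2 by ring.
have e2 : a - pi / 2 + (t - c) * x = (a + t * x - c * x) - pi / 2 by ring.
rewrite e1 e2 !cosB cos_pihalf sin_pihalf sinD sinB.
by field.
Qed.

Let trig_binomial_mean c N (phi : nat -> R) :
  trig (fun x => binomial_mean N ((1 + sin (c * x)) / 2) phi).
Proof.
elim: N phi => [|N IH] phi /=; first exact: trig_cst.
have t0 := trig_cst 0.
have := trig_lin 2^-1 (IH phi) (trig_lin 2^-1 (IH (fun j => phi j.+1))
  (trig_lin 2^-1 (trig_sin c (IH (fun j => phi j.+1)))
  (trig_lin (- 2^-1) (trig_sin c (IH phi)) t0))).
by congr (trig _); apply/funext => x; field.
Qed.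

Let small (A e : R) : 0 <= A -> 0 < e -> exists2 d, 0 < d & d * A <= e.
Proof.
move=> A0 e0; exists (e / (A + 1)); first by rewrite divr_gt0 // ltr_wpDl.
by rewrite mulrAC ler_pdivrMr ?ltr_wpDl // ler_pM2l // lerDl.
Qed.

Lemma moment_method h B : 0 <= v -> continuous h -> (forall x, `|h x| <= B) ->
  L n h @[n --> \oo] --> E h.
Proof.
move=> v0 ch hB; suff [] : cv h by [].
have B0 : 0 <= B := le_trans (normr_ge0 _) (hB 0).
apply: cv_approx; first exact: D_bounded hB.
move=> e e0; have e4 : 0 < e / 4 by rewrite divr_gt0.
(* Outside [[-M, M]] the trivial bound [2 * B] is at most [2 * B * d1 * x ^+ 2], whose mean is at
   most [e / 4] by the choice of [d1]. *)
have [d1 d10 hd1] := small (mulr_ge0 (mulr_ge0 (ler0n R 2) B0) v0) e4.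
pose M := (Num.sqrt d1)^-1.
have M0 : 0 < M by rewrite invr_gt0 sqrtr_gt0.
have M2 : M ^+ 2 = d1^-1 by rewrite exprVn sqr_sqrtr // ltW.
have [K K0 hK] := continuous_quadratic_modulus M ch hB e4.
have m4 : 0 <= gaussian_moment v 4 by rewrite /= !mulr_ge0.
have [d2 d20 hd2] := small (mulr_ge0 K0 m4) e4.
pose c := Num.sqrt d2.
have c0 : 0 < c by rewrite sqrtr_gt0.
have c2 : c ^+ 2 = d2 by rewrite sqr_sqrtr // ltW.
have [d3 d30 hd3] := small (divr_ge0 K0 (ltW d20)) e4.
have [N Nd3] : exists N : nat, d3^-1 <= N.+1%:R.
  exists (Num.bound d3^-1); rewrite (le_trans (ltW (archi_boundP _))) ?ler_nat //.
  by rewrite invr_ge0 ltW.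
have [n nE] : exists n : R, n = N.+1%:R by exists N.+1%:R.
have n0 : 0 < n by rewrite nE ltr0n.
pose y x := (1 + sin (c * x)) / 2.
have y01 x : 0 <= y x <= 1.
  have := sin_geN1 (c * x); have := sin_le1 (c * x); rewrite /y => ? ?.
  by apply/andP; split; lra.
(* Solves [(1 + c * x) / 2 = j / n] for [x]: the nodes invert the linearization of [y], so [g x] is
   the mean of [h] at a random point close to [x]. *)
pose node (j : nat) : R := (2 * j%:R / n - 1) / c.
pose g x := binomial_mean N.+1 (y x) (h \o node).
pose c4 := K * c ^+ 2 / 4; pose cc2 := 2 * B * d1; pose c00 := e / 4 + K / (n * c ^+ 2).
exists g, (fun x => c4 * x ^+ 4 + (cc2 * x ^+ 2 + c00 * x ^+ 0)); split.
- have := trig_binomial_mean c N.+1 (h \o node) 0 0.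
  by congr (cv _); apply/funext => x; rewrite mul0r addr0 cos0 mul1r.
- by apply: cv_lin => //; apply: cv_lin => //; apply: cvZ.
- move=> x; rewrite expr0 mulr1.
  have c40 : 0 <= c4 by rewrite divr_ge0 // mulr_ge0 // sqr_ge0.
  have cc20 : 0 <= cc2 by rewrite mulr_ge0 ?mulr_ge0 // ltW.
  have c000 : 0 <= c00.
    apply: addr_ge0; first exact: ltW.
    by rewrite divr_ge0 // mulr_ge0 ?sqr_ge0 // ltW.
  have x40 : 0 <= x ^+ 4 by rewrite exprn_even_ge0.
  have x20 := sqr_ge0 x.
  have [xM|xM] := lerP `|x| M.
  + have near_x : `|g x - h x| <= e / 4 + K * ((4 / (c * n) ^+ 2) *
        ((- (n * (1 + c * x) / 2) + n * y x) ^+ 2 + n * (y x * (1 - y x)))).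
      pose b (j : nat) : R := e / 4 + K * (4 / (c * n) ^+ 2) *
        (- (n * (1 + c * x) / 2) + j%:R) ^+ 2.
      have hb j : `|h (node j) - h x| <= b j.
        apply: le_trans (hK x (node j) xM) _; rewrite /b lerD2l -mulrA ler_wpM2l //.
        rewrite le_eqVlt; apply/orP; left; apply/eqP; rewrite /node.
        by field; rewrite !gt_eqF.
      have bE : binomial_mean N.+1 (y x) b = e / 4 + K * ((4 / (c * n) ^+ 2) *
        ((- (n * (1 + c * x) / 2) + n * y x) ^+ 2 + n * (y x * (1 - y x)))).
        rewrite (_ : b = fun j => (K * (4 / (c * n) ^+ 2)) *
          (- (n * (1 + c * x) / 2) + j%:R) ^+ 2 + e / 4); last first.
          by apply/funext => j; rewrite /b addrC.
        by rewrite binomial_mean_lin binomial_mean_cst binomial_mean_sqr -nE; ring.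
      rewrite -bE.
      have gE : g x - h x = binomial_mean N.+1 (y x) (fun j => h (node j) - h x).
        rewrite (_ : (fun j => h (node j) - h x) = fun j => 1 * h (node j) + (- h x)).
          by rewrite binomial_mean_lin binomial_mean_cst mul1r.
        by apply/funext => j; rewrite mul1r.
      rewrite gE ler_norml -mulN1r -[leLHS]addr0.
      rewrite -[X in _ + X](binomial_mean_cst N.+1 (y x)) -binomial_mean_lin.
      apply/andP; split; apply: ler_binomial_mean => // j.
        by rewrite addr0 mulN1r; have := hb j; rewrite ler_norml => /andP[].
      by have := hb j; rewrite ler_norml => /andP[].
    rewrite distrC; apply: (le_trans near_x).
    have yy : y x * (1 - y x) <= 4^-1.
      by rewrite -subr_ge0 (_ : _ - _ = (y x - 2^-1) ^+ 2) ?sqr_ge0 //; field.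
    (* The error of the linearization is quadratic in [c * x]; its square divided by [c ^+ 2] gives
       the term in [x ^+ 4], small with [c]. The binomial variance gives the term in
       [1 / (n * c ^+ 2)], made small by choosing [n] after [c]. *)
    have sx : (sin (c * x) - c * x) ^+ 2 <= (c * x) ^+ 4 / 4.
      have := cos_taylor_bound 2 (- (pi / 2)) 1 (c * x).
      rewrite /= !expr1n !mul1r mul0r !addr0 addNr cos0 cosN cos_pihalf mul0r mul0r addr0.
      rewrite (_ : 1`!%:R = 1 :> R) // divr1 mul1r [- _ + _]addrC cosB cos_pihalf sin_pihalf mulr0 add0r mulr1.
      move=> hs; rewrite -(real_normK (num_real (sin _ - _))).
      apply: le_trans (_ : (`|c * x| ^+ 2 / 2) ^+ 2 <= _).
        by rewrite ler_pXn2r ?nnegrE ?divr_ge0 ?sqr_ge0.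
      by rewrite real_normK ?num_real // (_ : (_ / 2) ^+ 2 = (c * x) ^+ 4 / 4) //; field.
    have -> : 4 / (c * n) ^+ 2 * ((- (n * (1 + c * x) / 2) + n * y x) ^+ 2 + n * (y x * (1 - y x))) =
       (sin (c * x) - c * x) ^+ 2 / c ^+ 2 + 4 * (y x * (1 - y x)) / (n * c ^+ 2).
      rewrite /y; move: (sin _) => s; field.
      by rewrite !gt_eqF.
    have -> : c4 * x ^+ 4 + (cc2 * x ^+ 2 + c00) =
       e / 4 + K * ((c * x) ^+ 4 / 4 / c ^+ 2 + 1 / (n * c ^+ 2)) + cc2 * x ^+ 2.
      rewrite /c4 /c00; field.
      by rewrite !gt_eqF.
    rewrite -[leLHS]addr0; apply: lerD; last exact: mulr_ge0.
    rewrite lerD2l ler_wpM2l //; apply: lerD.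
      by rewrite ler_pM2r // invr_gt0 exprn_gt0.
    rewrite ler_pM2r ?invr_gt0 ?mulr_gt0 ?exprn_gt0 //; lra.
  + apply: (@le_trans _ _ (cc2 * x ^+ 2)); last by rewrite addrCA lerDl addr_ge0 // mulr_ge0.
    apply: (@le_trans _ _ (2 * B)).
      have gB : `|g x| <= B.
        rewrite ler_norml -[B](binomial_mean_cst N.+1 (y x)).
        rewrite -[X in X <= _](_ : binomial_mean N.+1 (y x) (fun=> - B) = _); last first.
          by rewrite !binomial_mean_cst.
        apply/andP; split; apply: ler_binomial_mean => // j.
          by have := hB (node j); rewrite ler_norml => /andP[].
        by have := hB (node j); rewrite ler_norml => /andP[].
      by rewrite (le_trans (ler_normB _ _)) // mulr2n mulrDl !mul1r lerD.
    rewrite /cc2 -mulrA ler_peMr ?mulr_ge0 //.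
    rewrite mulrC -ler_pdivrMr ?mul1r //.
    rewrite -M2 -(real_normK (num_real x)) ler_pXn2r ?nnegrE //; exact: ltW.
- have D2 : D (fun x => c00 * x ^+ 0) by exact: (cvZ _ _).1.
  rewrite !E_lin //; last by apply: D_lin.
  rewrite EZ // !E_exprn.
  have t1 : c4 * gaussian_moment v 4 <= e / 4.
    apply: le_trans hd2; rewrite /c4 c2.
    by have := mulr_ge0 (ltW d20) (mulr_ge0 K0 m4); nra.
  have t2 : cc2 * gaussian_moment v 2 <= e / 4.
    by rewrite /= !mulr1 mul1r /cc2 mulrAC mulrC.
  have t3 : c00 * gaussian_moment v 0 <= e / 4 + e / 4.
    rewrite /= mulr1 lerD2l; apply: le_trans hd3.
    rewrite c2 invfM mulrCA; apply: ler_wpM2r; first exact: divr_ge0 K0 (ltW d20).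
    by rewrite -[leRHS]invrK lef_pV2 ?posrE ?invr_gt0 // nE.
  by rewrite (splitr e) (splitr (e / 2)); lra.
Qed.
End MomentMethod.

(** * Convergence of the normalized number of occurrences *)

Lemma integral_perm (R : realType) n (P : probability 'S_n R) (f : 'S_n -> R) :
  (\int[P]_s (f s)%:E = \sum_(s : 'S_n) (f s)%:E * P [set s])%E.
Proof.
have ii s : P.-integrable [set: 'S_n] (fun x => (f s)%:E * (\1_[set s] x)%:E)%E.
  by apply: integrableZl => //; apply: integrable_indic.
rewrite (eq_integral (fun x => \sum_(s : 'S_n) (f s)%:E * (\1_[set s] x)%:E)%E); last first.
  move=> x _; rewrite (bigD1 x) //= indicE mem_set // mule1.
  rewrite big1 ?adde0 // => s sx; rewrite indicE memNset ?mule0 //=.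
  by move=> xs; rewrite xs eqxx in sx.
rewrite integral_sum //; apply: eq_bigr => s _.
rewrite integralZl //; last exact: integrable_indic.
by rewrite integral_indic // setIT.
Qed.

Lemma counting_perm (R : realType) n (C : {set 'S_n}) :
  @counting 'S_n R [set` C] = (#|C|%:R)%:E.
Proof.
have -> : [set` C] = [set` [fset x in enum C]%fset].
  by apply/seteqP; split=> x /=; rewrite in_fset_ mem_enum.
rewrite /counting asboolT; last exact: finite_fset.
by rewrite set_fsetK card_fseq undup_id ?enum_uniq // -cardE.
Qed.

Lemma integral_uniform_class (R : realType) n lam (f : 'S_n -> R) :
  (0 < #|cycle_class n lam|)%N ->
  (\int[uniform_class R n lam]_s (f s)%:E =
   ((\sum_(u in cycle_class n lam) f u) / #|cycle_class n lam|%:R)%:E)%E.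
Proof.
move=> c0; rewrite integral_perm; set C := cycle_class n lam in c0 *.
have h s : uniform_class R n lam [set s] = ((if s \in C then 1 else 0) / #|C|%:R)%:E.
  pose cnt (U : set 'S_n) : \bar R := counting (U `&` [set` C]).
  have cT : cnt [set: 'S_n] = #|C|%:R%:E by rewrite /cnt setTI counting_perm.
  transitivity ((if (cnt [set: 'S_n] == 0%E) || (cnt [set: 'S_n] == +oo%E)
    then fun U : set 'S_n => \d_(1%g : 'S_n) U
    else fun U => (cnt U * (fine (cnt [set: 'S_n]))^-1%:E)%E) [set s]).
    by [].
  rewrite cT eqe pnatr_eq0 gtn_eqF //= EFinM; congr (_ * _)%E; rewrite /cnt.
  case: ifP => sC.
    rewrite (_ : _ `&` _ = [set` [set s]%SET]) ?counting_perm ?cards1 //.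
    apply/seteqP; split=> x /=; first by case=> -> _; rewrite inE.
    by rewrite inE => /eqP ->.
  rewrite (_ : _ `&` _ = [set` (finset.set0 : {set 'S_n})]) ?counting_perm ?cards0 //.
  by apply/seteqP; split=> x /=; [case=> ->; rewrite sC | rewrite inE].
rewrite [in RHS]big_mkcond mulr_suml -sumEFin; apply: eq_bigr => s _.
by rewrite h -EFinM; congr (_%:E); case: ifP => _; rewrite ?mul0r ?mulr0 // mul1r.
Qed.

Lemma card_perm_gt0 n : (0 < #|{: 'S_n}|)%N.
Proof. by apply/card_gt0P; exists 1%g. Qed.

Lemma integral_uniform_class_conj (R : realType) n (s0 : 'S_n) (f : 'S_n -> R) :
  (\int[uniform_class R n (cycle_type s0)]_s (f s)%:E =
   (mean (fun t => f (s0 ^ t)%g))%:E)%E.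
Proof.
rewrite integral_uniform_class -?mean_conj_class //.
by apply/card_gt0P; exists s0; rewrite inE.
Qed.

Lemma normalized_occurrences_conj (R : realType) k (tau : 'S_k) (A : {set 'I_k.-1})
    n (s0 t : 'S_n) : (0 < n)%N ->
  normalized_occurrences R n tau A (cycle_type s0) (s0 ^ t)%g =
  centered_conj R tau A s0 t.
Proof.
move=> n0; rewrite /normalized_occurrences unlock integral_uniform_class_conj /=.
rewrite /centered_conj /conj_scale powRB ?pnatr_eq0 -?lt0n ?n0 ?implybT //.
by rewrite powR_mulrn // powR12_sqrt.
Qed.

Lemma cvg_inv_nat (R : realType) : (n%:R^-1 : R) @[n --> \oo] --> 0.
Proof. by rewrite -cvg_shiftS; exact: cvg_harmonic. Qed.

Lemma cvg_inv_sqrt_nat (R : realType) : ((Num.sqrt n%:R)^-1 : R) @[n --> \oo] --> 0.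
Proof.
rewrite (_ : (fun n => _) = fun n : nat => Num.sqrt (n%:R^-1 : R)).
  rewrite -[X in _ --> X](sqrtr0 R).
  exact: (continuous_cvg _ (@sqrt_continuous R 0) (@cvg_inv_nat R)).
by apply/funext => n; rewrite sqrtrV.
Qed.

Lemma cvg_perturb (R : realType) (u w b : nat -> R) (l : R) :
  (\forall n \near \oo, `|u n - w n| <= b n) ->
  b n @[n --> \oo] --> 0 -> w n @[n --> \oo] --> l -> u n @[n --> \oo] --> l.
Proof.
move=> h b0 wl; rewrite (_ : u = fun n => (u n - w n) + w n); last first.
  by apply/funext => n; rewrite subrK.
rewrite -[l]add0r; apply: cvgD => //.
apply: (@squeeze_cvgr _ _ _ _ (fun n => - b n) b) => //.
  by near=> n; rewrite -ler_norml; near: n.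
by rewrite -oppr0; exact: cvgN.
Unshelve. all: by end_near. Qed.

Section ConjugationMoments.
Variables (R : realType) (k : nat) (tau : 'S_k) (A : {set 'I_k.-1}).
Variable s0 : forall n, 'S_n.
Local Notation Z n t := (centered_conj R tau A (s0 n) t).

Lemma conj_moments_cvg (v : R) :
  mean (fun t => Z n t ^+ 2) @[n --> \oo] --> v -> forall r,
  mean (fun t => Z n t ^+ r) @[n --> \oo] --> gaussian_moment v r.
Proof.
move=> hv r.
suff : mean (fun t => Z n t ^+ r) @[n --> \oo] --> gaussian_moment v r /\
    mean (fun t => Z n t ^+ r.+1) @[n --> \oo] --> gaussian_moment v r.+1 by case.
elim: r => [|r [IH1 IH2]]; split=> //=.
- rewrite (_ : (fun n => _) = fun=> 1); first exact: cvg_cst.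
  by apply/funext => n; rewrite mean_cst ?card_perm_gt0.
- rewrite (_ : (fun n => _) = fun=> 0); first exact: cvg_cst.
  by apply/funext => n; exact: mean_centered_conj.
have [C hC] := conj_moment_recursion R tau A r.
apply: (@cvg_perturb _ _ (fun n => r.+1%:R * mean (fun t => Z n t ^+ 2) *
    mean (fun t => Z n t ^+ r)) (fun n => C * (Num.sqrt n%:R)^-1)).
- by near=> n; apply: hC; near: n; exact: nbhs_infty_gt.
- by rewrite -(mulr0 C); apply: cvgMl_tmp; exact: cvg_inv_sqrt_nat.
- by apply: cvgM => //; apply: cvgMl_tmp.
Unshelve. all: by end_near. Qed.

Lemma conj_cvg_gaussian (v : R) : 0 <= v ->
  mean (fun t => Z n t ^+ 2) @[n --> \oo] --> v ->
  forall h (B : R), continuous h -> (forall x, `|h x| <= B) ->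
  (mean (fun t => h (Z n t)))%:E @[n --> \oo] --> (\int[gaussian v]_x (h x)%:E)%E.
Proof.
move=> v0 hv h B ch hB.
pose D (f : R -> R) := (gaussian v).-integrable [set: R] (fun x => (f x)%:E).
pose E (f : R -> R) : R := fine (\int[gaussian v]_x (f x)%:E)%E.
have Dfin f : D f -> (\int[gaussian v]_x (f x)%:E = (E f)%:E)%E.
  by move=> Df; rewrite fineK //; exact: integrable_fin_num.
have D_bounded f B' : continuous f -> (forall x, `|f x| <= B') -> D f.
  move=> cf fB; apply: measurable_bounded_integrable => //.
  - by apply: le_lt_trans (probability_le1 _ measurableT) (ltry _).
  - exact: continuous_measurable_fun.
  - exists B'; split; first exact: num_real.
    by move=> M BM x _ /=; exact: le_trans (fB x) (ltW BM).
rewrite (Dfin h (D_bounded _ _ ch hB)); apply: cvg_EFin; first exact: nearW.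
apply: (@moment_method R v (fun n f => mean (fun t => f (Z n t))) D E) ch hB => //.
- by move=> n a f g; rewrite meanD meanZ.
- by move=> n f g fg; apply: ler_mean.
- move=> a f g Df Dg; rewrite /D (_ : (fun x => _) = (fun x => a%:E * (f x)%:E + (g x)%:E)%E) //.
  by apply: integrableD => //; apply: integrableZl.
- move=> a f g Df Dg; rewrite /E.
  rewrite (_ : (fun x => (_ + _)%:E) = (fun x => a%:E * (f x)%:E + (g x)%:E)%E) //.
  rewrite integralD //; last exact: integrableZl.
  by rewrite integralZl // !Dfin.
- move=> f g Df Dg fg; rewrite -lee_fin -!Dfin //; apply: le_integral => //.
  by move=> x _; rewrite lee_fin.
- by move=> r; have [] := gaussian_momentP v0 r.
- by move=> r; rewrite /E; have [_ ->] := gaussian_momentP v0 r.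
- exact: conj_moments_cvg.
Qed.

End ConjugationMoments.

Theorem theorem1 (R : realType) (k : nat) (tau : 'S_k) (A : {set 'I_k.-1}) :
  exists f g : {poly R},
  forall (lam : nat -> seq nat) (p1 p2 : R),
    (forall n, (0 < n)%N -> is_partition n (lam n)) ->
    ((count_mem 1%N (lam n))%:R / n%:R : R) @[n --> \oo] --> p1 ->
    ((count_mem 2%N (lam n))%:R / n%:R : R) @[n --> \oo] --> p2 ->
    let v := f.[p1] + p2 * g.[p1] in
    let P := fun n => uniform_class R n (lam n) in
    let Z := fun n : nat =>
      normalized_occurrences R n tau A (lam n) : {RV (P n) >-> R} in
    [/\ 0 <= v,
        cvg_in_distribution Z (gaussian v) &
        forall r : nat,
          ('E_(P n)[fun s => (Z n s ^+ r)%R])%E @[n --> \oo]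
            --> (\int[gaussian v]_x (x ^+ r)%:E)%E].
Proof.
have [be [ga [C [n0 hC]]]] := @conj_variance_expansion R k tau A.
(* The factor 2 converts 2-cycles into the points they contain, which is what [two_cycle_ratio]
   counts. *)
exists be, (2 *: ga) => lam p1 p2 lamP cvg1 cvg2 v P Z.
have hs n : exists s : 'S_n, (0 < n)%N -> cycle_type s = lam n.
  (* Nothing is assumed on [lam 0], so any permutation serves for [n = 0]. *)
  case: n => [|n]; first by exists 1%g.
  by have [s hs] := cycle_type_exists (lamP n.+1 isT); exists s.
pose s0 n : 'S_n := projT1 (cid (hs n)).
have s0E n : (0 < n)%N -> cycle_type (s0 n) = lam n := projT2 (cid (hs n)).
have hE n (f : R -> R) : (0 < n)%N -> ('E_(P n)[fun s => f (Z n s)] =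
    (mean (fun t => f (centered_conj R tau A (s0 n) t)))%:E)%E.
  move=> n_gt0; rewrite unlock /P /Z -(s0E _ n_gt0) integral_uniform_class_conj.
  by congr (_%:E); apply: eq_mean => t; congr (f _); exact: normalized_occurrences_conj.
have hv : mean (fun t => centered_conj R tau A (s0 n) t ^+ 2) @[n --> \oo] --> v.
  apply: (@cvg_perturb _ _ (fun n => be.[(count_mem 1%N (lam n))%:R / n%:R] +
    (count_mem 2%N (lam n))%:R / n%:R * (2 *: ga).[(count_mem 1%N (lam n))%:R / n%:R])
    (fun n => C * n%:R^-1)).
  - near=> n; have n_gt0 : (0 < n)%N by near: n; exact: nbhs_infty_gt.
    have := hC n (s0 n) n_gt0.
    rewrite fixed_ratio_cycle_type two_cycle_ratio_cycle_type s0E // hornerZ.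
    have e (x y : R) : 2 * x * y = x * (2 * y) by ring.
    by rewrite e; apply; near: n; exact: nbhs_infty_ge.
  - by rewrite -(mulr0 C); apply: cvgMl_tmp; exact: cvg_inv_nat.
  - by apply: cvgD; [|apply: cvgM => //]; apply: continuous_cvg => //; exact: continuous_horner.
have v0 : 0 <= v.
  (* A limit of second moments is nonnegative, whatever the polynomials are. *)
  by apply: (cvgr_to_ge hv); apply: nearW => n; apply: mean_ge0 => t; exact: sqr_ge0.
have near_E (f : R -> R) (l : \bar R) : ((mean (fun t => f (centered_conj R tau A (s0 n) t)))%:E
    @[n --> \oo] --> l -> ('E_(P n)[fun s => f (Z n s)])%E @[n --> \oo] --> l)%E.
  apply: cvg_trans; apply: near_eq_cvg; near=> n; rewrite hE //.
  by near: n; exact: nbhs_infty_gt.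
split=> //.
- move=> h ch [M [_ hM]]; apply: near_E.
  (* Boundedness of [h] provides every bound strictly above [M], hence [M + 1]. *)
  apply: (conj_cvg_gaussian (B := M + 1) v0 hv ch) => x.
  by apply: hM => //; rewrite ltrDl.
- move=> r; have [_ ->] := gaussian_momentP v0 r.
  have := near_E (fun x => x ^+ r) (gaussian_moment v r)%:E; apply.
  by apply: cvg_EFin; [exact: nearW | exact: conj_moments_cvg].
Unshelve. all: by end_near. Qed.
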